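(* Let $k$ be an algebraically closed field of characteristic $p>0$ containing a primitive $l'$-th root of unity $\varepsilon$ with $l'=l\ge3$ odd, and let $r\ge0$. Then $\overline{\Lambda^+(2,r)}_l=\overline{\mathsf X_1(l,r)}_l$, and for every $\lambda\in\Lambda^+(2,r)$ the block $\mathfrak b^{2,r}(\bar\lambda)$ of the little $q$-Schur algebra $\tilde u_k(2,r)$ containing $\mathfrak L_k(\bar\lambda)$ is given by $$\mathfrak b^{2,r}(\bar\lambda)=\overline{(\mathfrak S_2\cdot\lambda)}_l\cap\overline{\Lambda^+(2,r)}_l=\overline{\mathcal B^{2,r}(\lambda)}_l=\overline{\mathcal B_1^{2,r}(\lambda)}_l .$$
   Context: Modules are finite dimensional left modules. $\mathbb N=\{0,1,2,\dots\}$, $\upsilon$ is an indeterminate, $\mathcal Z=\mathbb Z[\upsilon,\upsilon^{-1}]$, and $k$ is a $\mathcal Z$-algebra via $\upsilon\mapsto\varepsilon$. $[m]=\frac{\upsilon^m-\upsilon^{-m}}{\upsilon-\upsilon^{-1}}$, $[m]!=[1]\cdots[m]$. Quantum $\mathfrak{gl}_n$ (here $n=2$): $\mathbf U(n)$ is the $\mathbb Q(\upsilon)$-algebra with generators $E_i,F_i$ ($1\le i\le n-1$), $K_j^{\pm1}$ ($1\le j\le n$) and relations $K_iK_j=K_jK_i$, $K_iK_i^{-1}=1$; $K_iE_j=\upsilon^{\delta_{i,j}-\delta_{i,j+1}}E_jK_i$; $K_iF_j=\upsilon^{-\delta_{i,j}+\delta_{i,j+1}}F_jK_i$; $E_iF_j-F_jE_i=\delta_{ij}\frac{\tilde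 K_i-\tilde K_i^{-1}}{\upsilon-\upsilon^{-1}}$ with $\tilde K_i=K_iK_{i+1}^{-1}$ (and the quantum Serre relations, which are empty for $n=2$). $U_{\mathcal Z}(n)$ is its $\mathcal Z$-subalgebra generated by all $E_i^{(m)}=E_i^m/[m]!$, $F_i^{(m)}=F_i^m/[m]!$, $K_j^{\pm1}$ and $\left[{K_j;0\atop t}\right]=\prod_{s=1}^t\frac{K_j\upsilon^{1-s}-K_j^{-1}\upsilon^{s-1}}{\upsilon^s-\upsilon^{-s}}$ ($m,t\in\mathbb N$). $U_k(n)=U_{\mathcal Z}(n)\otimes_{\mathcal Z}k$, and $\tilde u_k(n)$ is the $k$-subalgebra generated by all $E_i,F_i,K_j^{\pm1}$. $q$-Schur algebras: for a commutative ring $R$ and $q^{1/2}\in R$, $A_q(n)$ is the $R$-algebra generated by $c_{ij}$ ($1\le i,j\le n$) with relations $c_{ij}c_{im}=c_{im}c_{ij}$ for all $i,j,m$; $c_{ij}c_{rs}=qc_{rs}c_{ij}$ for $i>r$, $j\le s$; $c_{ij}c_{rs}=(q-1)c_{rj}c_{is}+c_{rs}c_{ij}$ for $i>r$, $j>s$. It is a bialgebra with $\Delta(c_{ij})=\sum_tc_{it}\otimes c_{tj}$, counit $c_{ij}\mapsto\delta_{ij}$. Its degree $r$ part $A_q(n,r)$ is a subcoalgebra, and $U_R(n,r)=A_q(n,r)^*$ is the $q$-Schur algebra. Let $\Xi(n,r)$ be the set of $n\times n$ matrices over $\mathbb N$ with entry sum $r$; $\{\xi_A\}$ is the basis dual to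 the monomials $c^A=c_{11}^{a_{11}}c_{21}^{a_{21}}\cdots c_{n1}^{a_{n1}}c_{12}^{a_{12}}\cdots c_{nn}^{a_{nn}}$ ($A\in\Xi(n,r)$), and $[A]=q^{-d_A/2}\xi_A$ with $d_A=-\sum_{i<s,j>t}a_{ij}a_{st}+\sum_{j>t}a_{ij}a_{it}$. Write $\mathbf U(n,r)=U_{\mathbb Q(\upsilon)}(n,r)$ and $U_{\mathcal Z}(n,r)$ for $q^{1/2}=\upsilon$, and $U_k(n,r)\cong U_{\mathcal Z}(n,r)\otimes_{\mathcal Z}k$ for $q^{1/2}=\varepsilon$. For a matrix $A$ over $\mathbb N$ with zero diagonal and $\mathbf j\in\mathbb Z^n$ put $A(\mathbf j,r)=\sum_D\upsilon^{\sum_id_ij_i}[A+D]$, over diagonal $D=\mathrm{diag}(d_1,\dots,d_n)$ over $\mathbb N$ with $A+D\in\Xi(n,r)$. There is an algebra epimorphism $\zeta_r:\mathbf U(n)\to\mathbf U(n,r)$ with $E_h\mapsto E_{h,h+1}(\mathbf 0,r)$, $F_h\mapsto E_{h+1,h}(\mathbf 0,r)$ ($E_{i,j}$ matrix units), $K_1^{j_1}\cdots K_n^{j_n}\mapsto 0(\mathbf j,r)$, mapping $U_{\mathcal Z}(n)$ onto $U_{\mathcal Z}(n,r)$; base change gives $\zeta_r:U_k(n)\to U_k(n,r)$. Put $\mathtt e_i=\zeta_r(E_i)$, $\mathtt f_i=\zeta_r(F_i)$, $\mathtt k_j=\zeta_r(K_j)$, $\left[{\mathtt k_j;0\atop t}\right]=\zeta_r\left(\left[{K_j;0\atop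 t}\right]\right)$, and $\mathtt k_\lambda=\prod_i\left[{\mathtt k_i;0\atop\lambda_i}\right]$ for $\lambda\in\Lambda(n,r)=\{\lambda\in\mathbb N^n\mid\sum\lambda_i=r\}$. The little $q$-Schur algebra is $\tilde u_k(n,r)=\zeta_r(\tilde u_k(n))$. The infinitesimal $q$-Schur algebra $s_k(n,r)$ is the subalgebra of $U_k(n,r)$ generated by all $\mathtt e_i,\mathtt f_i,\mathtt k_j,\left[{\mathtt k_j;0\atop t}\right]$. Weights and simple modules: $\Lambda^+(n,r)=\{\lambda\in\Lambda(n,r)\mid\lambda_1\ge\cdots\ge\lambda_n\}$; $\mathsf X_1=\{\lambda\in\mathbb Z^n\mid0\le\lambda_i-\lambda_{i+1}\le l-1,\ 1\le i\le n\}$ with $\lambda_{n+1}:=0$; $\mathsf X_1(l,r)=\{\lambda\in\mathsf X_1+l\mathbb N^n\mid\sum\lambda_i=r\}$ (which contains $\Lambda^+(2,r)$ when $n=2$). For $Y\subseteq\mathbb Z^n$, $\overline Y_l$ is its image in $(\mathbb Z/l\mathbb Z)^n$ under entrywise reduction, and $\bar\lambda$ is the image of $\lambda$. The dot action: $w\cdot\lambda=w(\lambda+\rho)-\rho$, with $\mathfrak S_n$ acting on $\mathbb Z^n$ by place permutations and $\rho=(n-1,\dots,1,0)$; $\mathfrak S_2\cdot\lambda$ is the orbit. For $\lambda\in\Lambda^+(n,r)$, $L_k(\lambda)$ is the simple $U_k(n,r)$-module with highest weight $\lambda$ (generated by $v\neq 0$ with $\mathtt k_\lambda v=v$ and $\zeta_r(E_i^{(m)})v=0$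 for all $i$, $m\ge1$); for $\lambda\in\mathsf X_1(l,r)$, $\widehat L_1(\lambda)$ is the simple $s_k(n,r)$-module with highest weight $\lambda$ (generated by $v\ne0$ with $\mathtt k_\lambda v=v$, $\mathtt e_iv=0$). $\mathfrak L_k(\bar\lambda)$ is the unique simple quotient of the $\tilde u_k(n)$-module $\tilde u_k(n)/\big(\sum_i\tilde u_k(n)E_i+\sum_j\tilde u_k(n)(K_j-\varepsilon^{\lambda_j})\big)$; the $\mathfrak L_k(\nu)$ with $\nu\in\overline{\mathsf X_1(l,r)}_l$ factor through $\zeta_r$ and are exactly the simple $\tilde u_k(n,r)$-modules. Blocks are identified with sets of labels of simple modules: $\mathfrak b^{2,r}(\bar\lambda)$ is the set of $\bar\mu\in\overline{\mathsf X_1(l,r)}_l$ such that $\mathfrak L_k(\bar\mu)$ lies in the same block of $\tilde u_k(2,r)$ as $\mathfrak L_k(\bar\lambda)$; $\mathcal B^{2,r}(\lambda)$ is the set of $\mu\in\Lambda^+(2,r)$ such that $L_k(\mu)$ lies in the same block of $U_k(2,r)$ as $L_k(\lambda)$; $\mathcal B_1^{2,r}(\lambda)$ is the set of $\mu\in\mathsf X_1(l,r)$ such that $\widehat L_1(\mu)$ lies in the same block of $s_k(2,r)$ as $\widehat L_1(\lambda)$. *)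

(* Defs.v *)
From HB Require Import structures.
From mathcomp Require Import all_boot all_order perm all_algebra.
From mathcomp Require Import ring.
From mathcomp Require Import boolp classical_sets.

Set Implicit Arguments.
Unset Strict Implicit.
Unset Printing Implicit Defensive.

Import GRing.Theory.

Local Open Scope classical_set_scope.
Local Open Scope ring_scope.
Local Open Scope quotient_scope.

(* An algebra over R, as a ring with a central structure map R -> A.  The
   library's algType is not usable here: it requires 1 != 0, which is not known
   a priori for an algebra given by generators and relations. *)
HB.mixin Record isAlgebraOver (R : comNzRingType) A of GRing.PzRing A := {
  cst : R -> A;
  cst_zmod_morphism : zmod_morphism cst;
  cst_monoid_morphism : monoid_morphism cst;
  cst_central : forall a x, cst a * x = x * cst a
}.

#[short(type="algebraType")]
HB.structure Definition AlgebraOver (R : comNzRingType) :=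
  {A of isAlgebraOver R A & GRing.PzRing A}.

Notation "a %:S" := (cst a) (at level 2, left associativity, format "a %:S") :
  ring_scope.

Section Scalars.
Variables (R : comNzRingType) (A : algebraType R).

HB.instance Definition _ :=
  GRing.isZmodMorphism.Build R A (@cst R A) (@cst_zmod_morphism R A).
HB.instance Definition _ :=
  GRing.isMonoidMorphism.Build R A (@cst R A) (@cst_monoid_morphism R A).

End Scalars.

Definition is_alghom (R : comNzRingType) (A B : algebraType R) (f : A -> B) :=
  [/\ zmod_morphism f, monoid_morphism f & forall a : R, f a%:S = a%:S].

Inductive term (R G : Type) : Type :=
| Var of G
| Cst of R
| Add of term R G & term R G
| Mul of term R G & term R G.

Arguments Var {R G} g.
Arguments Cst {R G} a.

Declare Scope term_scope.
Delimit Scope term_scope with T.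
Bind Scope term_scope with term.
Notation "s + t" := (Add s t) : term_scope.
Notation "s * t" := (Mul s t) : term_scope.
Notation "a *: t" := (Mul (Cst a%R) t) : term_scope.
Notation "s - t" := (Add s (Mul (Cst (-1)%R) t)) : term_scope.

(* [cong rel] is the smallest congruence that contains [rel] and the axioms of
   R-algebras, so that [palg rel] is the R-algebra with generators G and
   relations s = t for all s, t such that [rel s t]. *)
Section Presentation.
Variables (R : comNzRingType) (G : Type).
Local Notation term := (term R G).

Inductive cong (rel : term -> term -> Prop) : term -> term -> Prop :=
| cong_rel s t : rel s t -> cong rel s t
| cong_refl t : cong rel t t
| cong_sym s t : cong rel s t -> cong rel t s
| cong_trans t s u : cong rel s t -> cong rel t u -> cong rel s u
| congD s s' t t' : cong rel s s' -> cong rel t t' -> cong rel (s + t) (s' + t')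
| congM s s' t t' : cong rel s s' -> cong rel t t' -> cong rel (s * t) (s' * t')
| cong_addA s t u : cong rel (s + (t + u)) (s + t + u)
| cong_addC s t : cong rel (s + t) (t + s)
| cong_add0 t : cong rel (Cst 0 + t) t
| cong_addN t : cong rel (-1 *: t + t) (Cst 0)
| cong_mulA s t u : cong rel (s * (t * u)) (s * t * u)
| cong_mul1l t : cong rel (Cst 1 * t) t
| cong_mul1r t : cong rel (t * Cst 1) t
| cong_mulDl s t u : cong rel ((s + t) * u) (s * u + t * u)
| cong_mulDr s t u : cong rel (s * (t + u)) (s * t + s * u)
| cong_cstD a b : cong rel (Cst (a + b)) (Cst a + Cst b)
| cong_cstM a b : cong rel (Cst (a * b)) (Cst a * Cst b)
| cong_cstC a t : cong rel (a *: t) (t * Cst a).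

HB.instance Definition _ := gen_eqMixin term.
HB.instance Definition _ := gen_choiceMixin term.

Variable rel : term -> term -> Prop.

Let congb (s t : term) : bool := `[< cong rel s t >].

Lemma congb_refl : reflexive congb.
Proof. by move=> t; apply/asboolP/cong_refl. Qed.

Lemma congb_sym : symmetric congb.
Proof. by move=> s t; apply/asboolP/asboolP => /cong_sym. Qed.

Lemma congb_trans : transitive congb.
Proof.
by move=> t s u /asboolP st /asboolP tu; apply/asboolP/(cong_trans st tu).
Qed.

Definition cong_equiv := EquivRel congb congb_refl congb_sym congb_trans.

Definition palg := {eq_quot cong_equiv}.

HB.instance Definition _ := Choice.on palg.

Definition pclass (t : term) : palg := \pi t.
Definition pgen (g : G) : palg := pclass (Var g).

Lemma pclassP (s t : term) : pclass s = pclass t <-> cong rel s t.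
Proof.
split=> [/eqquotP /= /asboolP //|st].
by apply/eqquotP => /=; apply/asboolP.
Qed.

Lemma repr_pclass (t : term) : cong rel (repr (pclass t)) t.
Proof. by apply/pclassP; rewrite /pclass reprK. Qed.

Lemma pclassK (x : palg) : pclass (repr x) = x.
Proof. exact: reprK. Qed.

Lemma pclass_ind (P : palg -> Prop) : (forall t, P (pclass t)) -> forall x, P x.
Proof. by move=> Pt x; rewrite -(pclassK x). Qed.

Definition palg_add (x y : palg) : palg := pclass (repr x + repr y).
Definition palg_mul (x y : palg) : palg := pclass (repr x * repr y).
Definition palg_opp (x : palg) : palg := pclass (-1 *: repr x).

Lemma palg_addE s t : palg_add (pclass s) (pclass t) = pclass (s + t)%T.
Proof. by apply/pclassP/congD; apply: repr_pclass. Qed.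

Lemma palg_mulE s t : palg_mul (pclass s) (pclass t) = pclass (s * t)%T.
Proof. by apply/pclassP/congM; apply: repr_pclass. Qed.

Lemma palg_oppE t : palg_opp (pclass t) = pclass (-1 *: t)%T.
Proof. by apply/pclassP/congM; [exact: cong_refl | exact: repr_pclass]. Qed.

Lemma palg_addA : associative palg_add.
Proof.
elim/pclass_ind => s; elim/pclass_ind => t; elim/pclass_ind => u.
by rewrite !palg_addE; apply/pclassP/cong_addA.
Qed.

Lemma palg_addC : commutative palg_add.
Proof.
elim/pclass_ind => s; elim/pclass_ind => t.
by rewrite !palg_addE; apply/pclassP/cong_addC.
Qed.

Lemma palg_add0 : left_id (pclass (Cst 0)) palg_add.
Proof. by elim/pclass_ind => t; rewrite palg_addE; apply/pclassP/cong_add0. Qed.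

Lemma palg_addN : left_inverse (pclass (Cst 0)) palg_opp palg_add.
Proof.
elim/pclass_ind => t.
by rewrite palg_oppE palg_addE; apply/pclassP/cong_addN.
Qed.

HB.instance Definition _ :=
  GRing.isZmodule.Build palg palg_addA palg_addC palg_add0 palg_addN.

Lemma palg_mulA : associative palg_mul.
Proof.
elim/pclass_ind => s; elim/pclass_ind => t; elim/pclass_ind => u.
by rewrite !palg_mulE; apply/pclassP/cong_mulA.
Qed.

Lemma palg_mul1l : left_id (pclass (Cst 1)) palg_mul.
Proof. by elim/pclass_ind => t; rewrite palg_mulE; apply/pclassP/cong_mul1l. Qed.

Lemma palg_mul1r : right_id (pclass (Cst 1)) palg_mul.
Proof. by elim/pclass_ind => t; rewrite palg_mulE; apply/pclassP/cong_mul1r. Qed.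

Lemma palg_mulDl : left_distributive palg_mul palg_add.
Proof.
elim/pclass_ind => s; elim/pclass_ind => t; elim/pclass_ind => u.
by rewrite !(palg_mulE, palg_addE); apply/pclassP/cong_mulDl.
Qed.

Lemma palg_mulDr : right_distributive palg_mul palg_add.
Proof.
elim/pclass_ind => s; elim/pclass_ind => t; elim/pclass_ind => u.
by rewrite !(palg_mulE, palg_addE); apply/pclassP/cong_mulDr.
Qed.

HB.instance Definition _ := GRing.Zmodule_isPzRing.Build palg
  palg_mulA palg_mul1l palg_mul1r palg_mulDl palg_mulDr.

Lemma pclassD s t : pclass (s + t)%T = pclass s + pclass t.
Proof. by rewrite -palg_addE. Qed.

Lemma pclassM s t : pclass (s * t)%T = pclass s * pclass t.
Proof. by rewrite -palg_mulE. Qed.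

Lemma pclass_cstB : zmod_morphism (fun a => pclass (Cst a)).
Proof.
move=> a b; apply: (canRL (addrK _)); rewrite -pclassD.
by apply/pclassP/cong_sym; rewrite -{1}(subrK b a); apply: cong_cstD.
Qed.

Lemma pclass_cstM : monoid_morphism (fun a => pclass (Cst a)).
Proof.
by split=> // a b; rewrite -pclassM; apply/pclassP/cong_cstM.
Qed.

Lemma pclass_cstC a x : pclass (Cst a) * x = x * pclass (Cst a).
Proof.
by elim/pclass_ind: x => t; rewrite -!pclassM; apply/pclassP/cong_cstC.
Qed.

HB.instance Definition _ := isAlgebraOver.Build R palg
  pclass_cstB pclass_cstM pclass_cstC.

End Presentation.

(* [galg gen] is the subalgebra of A generated by the family [gen], as a type. *)
Section Generated.
Variables (R : comNzRingType) (A : algebraType R) (I : Type) (gen : I -> A).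

Inductive generated : A -> Prop :=
| generated_gen i : generated (gen i)
| generated_cst (a : R) : generated a%:S
| generatedB x y : generated x -> generated y -> generated (x - y)
| generatedM x y : generated x -> generated y -> generated (x * y).

Definition galg_pred : {pred A} := [pred x | `[< generated x >]].

Lemma galg_cst_subproof (a : R) : a%:S \in galg_pred.
Proof. exact/asboolP/generated_cst. Qed.

Lemma galg_subring : subring_closed galg_pred.
Proof.
split=> [|x y /asboolP gx /asboolP gy|x y /asboolP gx /asboolP gy].
- by rewrite -(rmorph1 (@cst R A)) galg_cst_subproof.
- exact/asboolP/generatedB.
- exact/asboolP/generatedM.
Qed.

HB.instance Definition _ := GRing.isSubringClosed.Build A galg_pred galg_subring.

Record galg := Galg { galg_val : A; _ : galg_val \in galg_pred }.

HB.instance Definition _ := [isSub for galg_val].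
HB.instance Definition _ := [Choice of galg by <:].
HB.instance Definition _ := [SubChoice_isSubZmodule of galg by <:].
HB.instance Definition _ :=
  GRing.SubZmodule_isSubPzRing.Build A galg_pred galg galg_subring.

Definition galg_cst (a : R) : galg := Galg (galg_cst_subproof a).

Lemma galg_cstB : zmod_morphism galg_cst.
Proof. by move=> a b; apply: val_inj; rewrite rmorphB /= rmorphB. Qed.

Lemma galg_cstM : monoid_morphism galg_cst.
Proof.
by split=> [|a b]; apply: val_inj; rewrite ?rmorph1 ?rmorphM /= ?rmorph1 ?rmorphM.
Qed.

Lemma galg_cstC a x : galg_cst a * x = x * galg_cst a.
Proof. by apply: val_inj; rewrite !rmorphM /= cst_central. Qed.

HB.instance Definition _ := isAlgebraOver.Build R galg
  galg_cstB galg_cstM galg_cstC.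

Lemma galg_gen_subproof i : gen i \in galg_pred.
Proof. exact/asboolP/generated_gen. Qed.

Definition ggen (i : I) : galg := Galg (galg_gen_subproof i).

End Generated.

Section QuantumMatrices.
Variables (R : comNzRingType) (q : R) (n : nat).
Local Notation G := ('I_n * 'I_n)%type.
Local Notation c i j := (Var (i, j) : term R G).

Inductive qmat_rel : term R G -> term R G -> Prop :=
| qmat_row i j m : qmat_rel (c i j * c i m) (c i m * c i j)
| qmat_le (i j r s : 'I_n) : (r < i)%N -> (j <= s)%N ->
    qmat_rel (c i j * c r s) (q *: (c r s * c i j))
| qmat_gt (i j r s : 'I_n) : (r < i)%N -> (s < j)%N ->
    qmat_rel (c i j * c r s) ((q - 1) *: (c r j * c i s) + c r s * c i j).

Definition qmat := palg qmat_rel.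

Definition cvar (i j : 'I_n) : qmat := pgen qmat_rel (i, j).

Definition cword (s : seq G) : qmat := \prod_(g <- s) cvar g.1 g.2.

Lemma cvar_row i j m : cvar i j * cvar i m = cvar i m * cvar i j.
Proof. by rewrite /cvar /pgen -!pclassM; apply/pclassP/cong_rel/qmat_row. Qed.

Lemma cvar_le (i j r s : 'I_n) : (r < i)%N -> (j <= s)%N ->
  cvar i j * cvar r s = q%:S * (cvar r s * cvar i j).
Proof.
by move=> ri js; rewrite /cvar /pgen -!pclassM; apply/pclassP/cong_rel/qmat_le.
Qed.

Lemma cvar_gt (i j r s : 'I_n) : (r < i)%N -> (s < j)%N ->
  cvar i j * cvar r s = (q - 1)%:S * (cvar r j * cvar i s) + cvar r s * cvar i j.
Proof.
move=> ri sj; rewrite /cvar /pgen -!pclassM -pclassD.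
exact/pclassP/cong_rel/qmat_gt.
Qed.

Variable r : nat.

Local Notation word := (r.-tuple 'I_n).

(* The monomials c_{i_1 j_1} ... c_{i_r j_r}, for words I = (i_1, ..., i_r) and
   J = (j_1, ..., j_r), span the degree r part A_q(n,r). *)
Definition cmon (I J : word) : qmat := cword (zip I J).

Definition qmat_deg : set qmat :=
  [set x | exists a : word -> word -> R,
     x = \sum_I \sum_J (a I J)%:S * cmon I J].

(* [represents f phi]: f is an R-linear form on A_q(n,r), and phi is its matrix
   of values on the monomials. *)
Definition represents (f : qmat -> R) (phi : 'M[R]_#|{: word}|) : Prop :=
  (forall (a : R) x y, qmat_deg x -> qmat_deg y ->
     f (a%:S * x + y) = a * f x + f y) /\
  (forall I J, phi (enum_rank I) (enum_rank J) = f (cmon I J)).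

Definition qschur_pred : {pred 'M[R]_#|{: word}|} :=
  [pred phi | `[< exists f, represents f phi >]].

Definition wform := seq G -> R.
Definition wform2 := seq G -> wform.

Definition kills_rel (F : wform) : Prop :=
  [/\ forall u w i j m,
        F (u ++ (i, j) :: (i, m) :: w) = F (u ++ (i, m) :: (i, j) :: w),
      forall u w (i j k s : 'I_n), (k < i)%N -> (j <= s)%N ->
        F (u ++ (i, j) :: (k, s) :: w) = q * F (u ++ (k, s) :: (i, j) :: w) &
      forall u w (i j k s : 'I_n), (k < i)%N -> (s < j)%N ->
        F (u ++ (i, j) :: (k, s) :: w) =
          (q - 1) * F (u ++ (k, j) :: (i, s) :: w)
          + F (u ++ (k, s) :: (i, j) :: w)].

Definition kills_rel2 (B : wform2) : Prop :=
  (forall w', kills_rel (B^~ w')) /\ (forall w, kills_rel (B w)).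

(* Delta(t) acts by right translations on forms in two words.  On forms that
   respect the relations, this action factors through A_q(n), and its value at
   the empty words is x |-> (f (x) g)(Delta(x)) when B is f (x) g. *)
Fixpoint Dop (t : term R G) (B : wform2) : wform2 :=
  match t with
  | Var g => fun w w' =>
      \sum_(k < n) B (rcons w (g.1, k)) (rcons w' (k, g.2))
  | Cst a => fun w w' => a * B w w'
  | Add s t => fun w w' => Dop s B w w' + Dop t B w w'
  | Mul s t => Dop s (Dop t B)
  end.

Lemma kills_relD F F' :
  kills_rel F -> kills_rel F' -> kills_rel (fun w => F w + F' w).
Proof.
case=> [h1 h2 h3] [k1 k2 k3]; split=> [u w i j m|u w i j k s ki js|u w i j k s ki js].
- by rewrite h1 k1.
- by rewrite h2 // k2 // mulrDr.
- by rewrite h3 // k3 //; ring.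
Qed.

Lemma kills_relZ a F : kills_rel F -> kills_rel (fun w => a * F w).
Proof.
case=> [h1 h2 h3]; split=> [u w i j m|u w i j k s ki js|u w i j k s ki js].
- by rewrite h1.
- by rewrite h2 //; ring.
- by rewrite h3 //; ring.
Qed.

Lemma kills_rel_sum (I : finType) (F : I -> wform) :
  (forall i, kills_rel (F i)) -> kills_rel (fun w => \sum_i F i w).
Proof.
move=> h; split=> [u w i j m|u w i j k s ki js|u w i j k s ki js].
- by apply: eq_bigr => x _; case: (h x) => -> _ _.
- by rewrite mulr_sumr; apply: eq_bigr => x _; case: (h x) => _ -> .
- rewrite mulr_sumr -big_split /=; apply: eq_bigr => x _.
  by case: (h x) => _ _ -> .
Qed.

Lemma kills_rel_rcons g F : kills_rel F -> kills_rel (fun w => F (rcons w g)).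
Proof.
by case=> h1 h2 h3; split=> *; rewrite !(rcons_cat, rcons_cons); eauto.
Qed.

Lemma Dop_kills t B : kills_rel2 B -> kills_rel2 (Dop t B).
Proof.
elim: t B => [g|a|s IHs t IHt|s IHs t IHt] B /= hB.
- case: hB => hl hr; split=> w; apply: kills_rel_sum => k;
    [exact: (kills_rel_rcons _ (hl _)) | exact: (kills_rel_rcons _ (hr _))].
- by case: hB => hl hr; split=> w; apply: kills_relZ; [exact: hl | exact: hr].
- case: (IHs _ hB) (IHt _ hB) => [sl sr] [tl tr].
  by split=> w; apply: kills_relD;
    [exact: sl | exact: tl | exact: sr | exact: tr].
- exact/IHs/IHt.
Qed.

Lemma DopD t B B' w w' :
  Dop t (fun w w' => B w w' + B' w w') w w' = Dop t B w w' + Dop t B' w w'.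
Proof.
elim: t B B' w w' => [g|a|s IHs t IHt|s IHs t IHt] B B' w w' /=.
- by rewrite big_split.
- by rewrite mulrDr.
- by rewrite IHs IHt addrACA.
- rewrite -IHs; congr (Dop s _ w w').
  by apply/funext => x; apply/funext => y; rewrite IHt.
Qed.

Lemma DopZ t a B w w' :
  Dop t (fun w w' => a * B w w') w w' = a * Dop t B w w'.
Proof.
elim: t B w w' => [g|b|s IHs t IHt|s IHs t IHt] B w w' /=.
- by rewrite mulr_sumr.
- by rewrite mulrCA.
- by rewrite IHs IHt mulrDr.
- rewrite -IHs; congr (Dop s _ w w').
  by apply/funext => x; apply/funext => y; rewrite IHt.
Qed.

Lemma sum_pairs (F : 'I_n -> 'I_n -> R) :
  \sum_x \sum_y F x y =
  \sum_x (F x x + \sum_(y : 'I_n | (y < x)%N) (F x y + F y x)).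
Proof.
rewrite big_split /=.
under [X in _ + X]eq_bigr do rewrite big_split /=.
rewrite big_split /= [X in _ + (_ + X)](exchange_big_dep predT) //=.
rewrite -!big_split /=; apply: eq_bigr => x _.
rewrite (bigD1 x) //=; congr (_ + _).
rewrite (bigID (fun y : 'I_n => (y < x)%N)) /=; congr (_ + _); apply: eq_bigl => y.
- by rewrite -val_eqE /= andbC; case: ltngtP.
- by rewrite -val_eqE /= -leqNgt; case: ltngtP.
Qed.

Section SumRel.
Variable b : G -> G -> G -> G -> R.
Hypotheses
  (a1 : forall i j m z t, b (i, j) (i, m) z t = b (i, m) (i, j) z t)
  (a2 : forall (i j k s : 'I_n) z t, (k < i)%N -> (j <= s)%N ->
     b (i, j) (k, s) z t = q * b (k, s) (i, j) z t)
  (a3 : forall (i j k s : 'I_n) z t, (k < i)%N -> (s < j)%N ->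
     b (i, j) (k, s) z t =
       (q - 1) * b (k, j) (i, s) z t + b (k, s) (i, j) z t)
  (b1 : forall i j m x y, b x y (i, j) (i, m) = b x y (i, m) (i, j))
  (b2 : forall (i j k s : 'I_n) x y, (k < i)%N -> (j <= s)%N ->
     b x y (i, j) (k, s) = q * b x y (k, s) (i, j))
  (b3 : forall (i j k s : 'I_n) x y, (k < i)%N -> (s < j)%N ->
     b x y (i, j) (k, s) =
       (q - 1) * b x y (k, j) (i, s) + b x y (k, s) (i, j)).

Let F i j k s := \sum_x \sum_y b (i, x) (k, y) (x, j) (y, s).

Lemma sum_rel_row (i j m : 'I_n) : F i j i m = F i m i j.
Proof.
rewrite /F !sum_pairs; apply: eq_bigr => x _.
congr (_ + _); first by rewrite b1.
apply: eq_bigr => y yx; rewrite !(a1 i y x).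
case: (ltngtP j m) => [jm|mj|/val_inj -> //].
- by rewrite (b2 _ _ yx (ltnW jm)) (b3 _ _ yx jm); ring.
- by rewrite (b2 _ _ yx (ltnW mj)) (b3 _ _ yx mj); ring.
Qed.

Lemma sum_rel_le (i j k s : 'I_n) :
  (k < i)%N -> (j <= s)%N -> F i j k s = q * F k s i j.
Proof.
move=> ki js; rewrite /F !sum_pairs mulr_sumr; apply: eq_bigr => x _.
rewrite mulrDr; congr (_ + _).
  by rewrite (a2 _ _ ki (leqnn x)) (b1 x j s).
rewrite mulr_sumr; apply: eq_bigr => y yx.
rewrite (a3 _ _ ki yx) (a2 _ _ ki (ltnW yx)) !(b2 _ _ yx js).
move: js; rewrite leq_eqVlt => /orP[/eqP/val_inj <-|js].
  by rewrite (b2 _ _ yx (leqnn j)); ring.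
by rewrite (b3 _ _ yx js); ring.
Qed.

Lemma sum_rel_gt (i j k s : 'I_n) :
  (k < i)%N -> (s < j)%N -> F i j k s = (q - 1) * F k j i s + F k s i j.
Proof.
move=> ki sj; rewrite /F !sum_pairs mulr_sumr -big_split /=.
apply: eq_bigr => x _.
rewrite mulrDr addrACA mulr_sumr -big_split /=; congr (_ + _).
  by rewrite (a2 _ _ ki (leqnn x)) (b1 x s j); ring.
apply: eq_bigr => y yx.
rewrite (a3 _ _ ki yx) (a2 _ _ ki (ltnW yx)) !(b2 _ _ yx (ltnW sj)).
by rewrite !(b3 _ _ yx sj); ring.
Qed.

End SumRel.

Lemma kills_rel_rcons2 F : kills_rel F -> forall w,
  [/\ forall i j m, F (rcons (rcons w (i, j)) (i, m)) =
                    F (rcons (rcons w (i, m)) (i, j)),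
      forall (i j k s : 'I_n), (k < i)%N -> (j <= s)%N ->
        F (rcons (rcons w (i, j)) (k, s)) =
        q * F (rcons (rcons w (k, s)) (i, j)) &
      forall (i j k s : 'I_n), (k < i)%N -> (s < j)%N ->
        F (rcons (rcons w (i, j)) (k, s)) =
        (q - 1) * F (rcons (rcons w (k, j)) (i, s))
        + F (rcons (rcons w (k, s)) (i, j))].
Proof.
by case=> h1 h2 h3 w; split=> *; rewrite -!cats1 -!catA /=; eauto.
Qed.

Lemma Dop_rel s t B : kills_rel2 B -> qmat_rel s t -> Dop s B = Dop t B.
Proof.
case=> hl hr st; apply/funext => w; apply/funext => w'.
pose b x y z u := B (rcons (rcons w x) y) (rcons (rcons w' z) u).
have L z u := kills_rel_rcons2 (hl (rcons (rcons w' z) u)) w.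
have S x y := kills_rel_rcons2 (hr (rcons (rcons w x) y)) w'.
case: st => [i j m|i j k p ki jp|i j k p ki pj] /=.
- apply: (@sum_rel_row b)
    => [? ? ? z u|? ? ? x y|? ? ? ? x y|? ? ? ? x y]; rewrite /b.
  + by case: (L z u).
  + by case: (S x y).
  + by case: (S x y) => _ + _; apply.
  + by case: (S x y) => _ _; apply.
- apply: (@sum_rel_le b) => //
    [? ? ? ? z u|? ? ? ? z u|? ? ? x y|? ? ? ? x y|? ? ? ? x y]; rewrite /b.
  + by case: (L z u) => _ + _; apply.
  + by case: (L z u) => _ _; apply.
  + by case: (S x y).
  + by case: (S x y) => _ + _; apply.
  + by case: (S x y) => _ _; apply.
- apply: (@sum_rel_gt b) => //
    [? ? ? ? z u|? ? ? ? z u|? ? ? x y|? ? ? ? x y|? ? ? ? x y]; rewrite /b.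
  + by case: (L z u) => _ + _; apply.
  + by case: (L z u) => _ _; apply.
  + by case: (S x y).
  + by case: (S x y) => _ + _; apply.
  + by case: (S x y) => _ _; apply.
Qed.

Lemma Dop_cong s t : cong qmat_rel s t ->
  forall B, kills_rel2 B -> Dop s B = Dop t B.
Proof.
elim=> {s t} //=.
- by move=> s t st B hB; apply: Dop_rel.
- by move=> s t _ IH B hB; rewrite IH.
- by move=> t s u _ IH1 _ IH2 B hB; rewrite IH1 // IH2.
- by move=> s s' t t' _ IH1 _ IH2 B hB; rewrite IH1 // IH2.
- by move=> s s' t t' _ IH1 _ IH2 B hB; rewrite IH2 // IH1 //; apply: Dop_kills.
- by move=> s t u B _; do 2!apply/funext=> ?; rewrite addrA.
- by move=> s t B _; do 2!apply/funext=> ?; rewrite addrC.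
- by move=> t B _; do 2!apply/funext=> ?; rewrite mul0r add0r.
- by move=> t B _; do 2!apply/funext=> ?; rewrite mulN1r addNr mul0r.
- by move=> t B _; do 2!apply/funext=> ?; rewrite mul1r.
- move=> t B _; congr (Dop t _).
  by do 2!apply/funext=> ?; rewrite mul1r.
- by move=> s t u B _; do 2!apply/funext=> ?; rewrite DopD.
- by move=> a b B _; do 2!apply/funext=> ?; rewrite mulrDl.
- by move=> a b B _; do 2!apply/funext=> ?; rewrite mulrA.
- by move=> a t B _; do 2!apply/funext=> ?; rewrite DopZ.
Qed.

Definition Dact (x : qmat) : wform2 -> wform2 := Dop (repr x).

Lemma Dact_pclass t B : kills_rel2 B -> Dact (pclass qmat_rel t) B = Dop t B.
Proof. by move=> hB; apply: (Dop_cong (repr_pclass _ _)). Qed.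

Lemma DactM x y B : kills_rel2 B -> Dact (x * y) B = Dact x (Dact y B).
Proof.
move=> hB; rewrite -[x in LHS]pclassK -[y in LHS]pclassK -pclassM.
by rewrite Dact_pclass.
Qed.

Lemma DactD x y B w w' : kills_rel2 B ->
  Dact (x + y) B w w' = Dact x B w w' + Dact y B w w'.
Proof.
move=> hB; rewrite -[x in LHS]pclassK -[y in LHS]pclassK -pclassD.
by rewrite Dact_pclass.
Qed.

Lemma Dact_cst (a : R) B w w' : kills_rel2 B -> Dact a%:S B w w' = a * B w w'.
Proof. by move=> hB; rewrite Dact_pclass. Qed.

Lemma sum_tuple_cons d (F : d.+1.-tuple 'I_n -> R) :
  \sum_T F T = \sum_k \sum_(T : d.-tuple 'I_n) F [tuple of k :: T].
Proof.
rewrite pair_big /=.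
rewrite (reindex (fun p : 'I_n * d.-tuple 'I_n => [tuple of p.1 :: p.2])) //.
exists (fun T : d.+1.-tuple 'I_n => (thead T, [tuple of behead T])) => T _ /=.
  by case: T => k T /=; congr (_, _); apply: val_inj.
by rewrite -tuple_eta.
Qed.

Lemma Dact_word d (I J : d.-tuple 'I_n) B w w' : kills_rel2 B ->
  Dact (cword (zip I J)) B w w' =
  \sum_(T : d.-tuple 'I_n) B (w ++ zip I T) (w' ++ zip T J).
Proof.
move=> hB; elim: d I J w w' => [|d IHd] I J w w'.
  rewrite (tuple0 I) (tuple0 J) /cword big_nil -(rmorph1 (@cst R qmat)).
  rewrite Dact_cst // mul1r (big_pred1 [tuple]) /= ?cats0 //.
  by move=> T; apply/esym/eqP; rewrite [T]tuple0 [RHS]tuple0.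
case: (tupleP I) => i {}I; case: (tupleP J) => j {}J.
rewrite /cword /= big_cons -/(cword _) DactM // sum_tuple_cons /=.
rewrite Dact_pclass /=; last exact: Dop_kills.
by apply: eq_bigr => k _; rewrite IHd; apply: eq_bigr => T _; rewrite !cat_rcons.
Qed.

Lemma qmat_deg_mon I J : qmat_deg (cmon I J).
Proof.
exists (fun I' J' => ((I' == I) && (J' == J))%:R).
rewrite (bigD1 I) //= (bigD1 J) //= !eqxx rmorph1 mul1r.
rewrite big1 => [|J' /negPf ->]; last by rewrite andbF rmorph0 mul0r.
rewrite addr0 big1 ?addr0 // => I' /negPf ->.
by rewrite big1 // => J' _; rewrite rmorph0 mul0r.
Qed.

Lemma qmat_deg_word s : size s = r -> qmat_deg (cword s).
Proof.
move=> ss; have s1 : size (unzip1 s) == r by rewrite size_map ss.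
have s2 : size (unzip2 s) == r by rewrite size_map ss.
by have := qmat_deg_mon (Tuple s1) (Tuple s2); rewrite /cmon /= zip_unzip.
Qed.

Lemma qmat_deg0 : qmat_deg 0.
Proof.
exists (fun _ _ => 0); rewrite big1 // => I _; rewrite big1 // => J _.
by rewrite rmorph0 mul0r.
Qed.

Section Represents.
Variables (f : qmat -> R) (phi : 'M[R]_#|{: word}|).
Hypothesis fphi : represents f phi.

Lemma representsD x y : qmat_deg x -> qmat_deg y -> f (x + y) = f x + f y.
Proof.
by move=> dx dy; have := fphi.1 1 x y dx dy; rewrite rmorph1 !mul1r.
Qed.

Lemma represents0 : f 0 = 0.
Proof.
have := representsD qmat_deg0 qmat_deg0; rewrite addr0 => /esym/eqP.
by rewrite -subr_eq0 addrK => /eqP.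
Qed.

Lemma representsZ (a : R) x : qmat_deg x -> f (a%:S * x) = a * f x.
Proof.
by move=> dx; have := fphi.1 a x 0 dx qmat_deg0; rewrite !addr0 represents0 addr0.
Qed.

Definition form_word : wform := fun w => if size w == r then f (cword w) else 0.

Lemma form_word_kills : kills_rel form_word.
Proof.
have cwcat u x y w :
    cword (u ++ x :: y :: w) = cword u * (cvar x.1 x.2 * cvar y.1 y.2 * cword w).
  by rewrite /cword big_cat !big_cons /= !mulrA.
rewrite /form_word; split=> [u w i j m|u w i j k s ki js|u w i j k s ki sj];
  rewrite !size_cat /=; case: eqP => [sz|_]; rewrite ?mulr0 ?addr0 //.
- by rewrite !cwcat /= cvar_row.
- rewrite -representsZ; last by apply: qmat_deg_word; rewrite size_cat.
  by rewrite !cwcat /= cvar_le // !mulrA (cst_central q (cword u)).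
- have d1 : qmat_deg (cword (u ++ (k, j) :: (i, s) :: w)).
    by apply: qmat_deg_word; rewrite size_cat.
  have d2 : qmat_deg (cword (u ++ (k, s) :: (i, j) :: w)).
    by apply: qmat_deg_word; rewrite size_cat.
  rewrite -(fphi.1 (q - 1) _ _ d1 d2) !cwcat /= cvar_gt //.
  by rewrite !(mulrDl, mulrDr) !mulrA (cst_central (q - 1) (cword u)).
Qed.

End Represents.

Lemma form_word_kills2 f g phi psi : represents f phi -> represents g psi ->
  kills_rel2 (fun w w' => form_word f w * form_word g w').
Proof.
move=> fphi gpsi; split=> w; last exact/kills_relZ/(form_word_kills gpsi).
under [X in kills_rel X]eq_fun do rewrite mulrC.
exact/kills_relZ/(form_word_kills fphi).
Qed.

Lemma qschur_mulmx_subproof phi psi :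
  phi \in qschur_pred -> psi \in qschur_pred -> phi *m psi \in qschur_pred.
Proof.
move=> /asboolP[f fphi] /asboolP[g gpsi]; apply/asboolP.
have hB := form_word_kills2 fphi gpsi.
exists (fun x => Dact x (fun w w' => form_word f w * form_word g w') [::] [::]).
split=> [a x y _ _|I J]; first by rewrite DactD // DactM // Dact_cst //; apply: Dop_kills.
rewrite /cmon Dact_word // mxE (reindex (@enum_rank _)) /=; last first.
  exact/onW_bij/enum_rank_bij.
apply: eq_bigr => T _; rewrite fphi.2 gpsi.2 /form_word.
by rewrite !size_zip !size_tuple !minnn eqxx.
Qed.

Lemma qschur_addmx_subproof phi psi :
  phi \in qschur_pred -> psi \in qschur_pred -> phi - psi \in qschur_pred.
Proof.
move=> /asboolP[f fphi] /asboolP[g gpsi]; apply/asboolP.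
exists (fun x => f x - g x); split=> [a x y dx dy|I J].
  by rewrite fphi.1 // gpsi.1 //; ring.
by rewrite !mxE fphi.2 gpsi.2.
Qed.

Lemma qschur_scalemx_subproof a phi :
  phi \in qschur_pred -> a *: phi \in qschur_pred.
Proof.
move=> /asboolP[f fphi]; apply/asboolP.
exists (fun x => a * f x); split=> [b x y dx dy|I J].
  by rewrite fphi.1 //; ring.
by rewrite !mxE fphi.2.
Qed.

Fixpoint counit_term (t : term R G) : R :=
  match t with
  | Var g => (g.1 == g.2)%:R
  | Cst a => a
  | Add s t => counit_term s + counit_term t
  | Mul s t => counit_term s * counit_term t
  end.

Lemma counit_term_rel s t : qmat_rel s t -> counit_term s = counit_term t.
Proof.
case=> [i j m|i j k p ki jp|i j k p ki pj] /=; first by rewrite mulrC.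
- rewrite -!natrM !mulnb.
  case: (i =P j) => [ij|_]; case: (k =P p) => [kp|_]; rewrite ?mulr0 //=.
  by move: ki; rewrite ij kp ltnNge jp.
- rewrite [RHS]addrC mulrC -[LHS]addr0; congr (_ + _).
  rewrite -natrM mulnb.
  case: (k =P j) => [kj|_]; case: (i =P p) => [ip|_]; rewrite ?mulr0 //=.
  by move: ki pj; rewrite kj ip => /ltn_trans h /h; rewrite ltnn.
Qed.

Lemma counit_term_cong s t :
  cong qmat_rel s t -> counit_term s = counit_term t.
Proof.
elim=> {s t} /=; try by move=> *; ring.
- exact: counit_term_rel.
- by move=> s t _ ->.
- by move=> s t u _ -> _ ->.
- by move=> s s' t t' _ -> _ ->.
- by move=> s s' t t' _ -> _ ->.
Qed.

Lemma qschur_one_subproof : 1%:M \in qschur_pred.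
Proof.
apply/asboolP; exists (fun x => counit_term (repr x)).
have E t : counit_term (repr (pclass qmat_rel t)) = counit_term t.
  exact/counit_term_cong/repr_pclass.
have EM (x y : qmat) : counit_term (repr (x * y)) =
    counit_term (repr x) * counit_term (repr y).
  by rewrite -[x in LHS]pclassK -[y in LHS]pclassK -pclassM E.
have ED (x y : qmat) : counit_term (repr (x + y)) =
    counit_term (repr x) + counit_term (repr y).
  by rewrite -[x in LHS]pclassK -[y in LHS]pclassK -pclassD E.
split=> [a x y _ _|I J]; first by rewrite ED EM E.
rewrite mxE (inj_eq enum_rank_inj) /cmon.
elim: r I J => [|d IHd] I J.
  by rewrite (tuple0 I) (tuple0 J) eqxx /cword big_nil E.
case: (tupleP I) => i {}I; case: (tupleP J) => j {}J.
rewrite /cword /= big_cons -/(cword _) EM E -IHd /= -natrM mulnb.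
by congr (_%:R); rewrite -!val_eqE /= eqseq_cons.
Qed.

(* The q-Schur algebra A_q(n,r)^*, a linear form f being identified with the
   matrix of its values f(c_{IJ}) on the monomials.  As
   Delta(c_{IJ}) = \sum_T c_{IT} (x) c_{TJ}, the convolution product of A_q(n,r)^*
   is the product of matrices; the counit is the identity matrix. *)
Record qschur := QSchur { qschur_val : 'M[R]_#|{: word}|;
                          _ : qschur_val \in qschur_pred }.

Lemma qschur_subring : subring_closed qschur_pred.
Proof.
split; [exact: qschur_one_subproof|exact: qschur_addmx_subproof|].
exact: qschur_mulmx_subproof.
Qed.

HB.instance Definition _ :=
  GRing.isSubringClosed.Build 'M[R]_#|{: word}| qschur_pred qschur_subring.

HB.instance Definition _ := [isSub for qschur_val].
HB.instance Definition _ := [Choice of qschur by <:].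
HB.instance Definition _ := [SubChoice_isSubZmodule of qschur by <:].
HB.instance Definition _ := GRing.SubZmodule_isSubPzRing.Build
  'M[R]_#|{: word}| qschur_pred qschur qschur_subring.

Lemma qschur_cst_subproof (a : R) : a%:M \in qschur_pred.
Proof.
by rewrite -scalemx1; apply/qschur_scalemx_subproof/qschur_one_subproof.
Qed.

Definition qschur_cst (a : R) : qschur := QSchur (qschur_cst_subproof a).

Lemma qschur_cstB : zmod_morphism qschur_cst.
Proof. by move=> a b; apply: val_inj; rewrite rmorphB /= raddfB. Qed.

Lemma qschur_cstM : monoid_morphism qschur_cst.
Proof.
by split=> [|a b]; apply: val_inj; [|exact: scalar_mxM].
Qed.

Lemma qschur_cstC a x : qschur_cst a * x = x * qschur_cst a.
Proof. exact/val_inj/esym/scalar_mxC. Qed.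

HB.instance Definition _ := isAlgebraOver.Build R qschur
  qschur_cstB qschur_cstM qschur_cstC.

End QuantumMatrices.

Section Basis.
Variables (R : comUnitRingType) (v : R) (n r : nat).
Local Notation q := (v ^+ 2).

Definition msum (A : 'M[nat]_n) : nat := (\sum_i \sum_j A i j)%N.

Definition mono (A : 'M[nat]_n) : qmat q n :=
  \prod_(j < n) \prod_(i < n) cvar q i j ^+ A i j.

(* The element of the basis dual to the monomials c^B, for A with msum A = r. *)
Definition xi (A : 'M[nat]_n) : qschur q n r :=
  xget 0 [set x | exists2 f, represents f (val x) &
    forall B : 'M[nat]_n, msum B = r -> f (mono B) = (A == B)%:R].

Definition dexp (A : 'M[nat]_n) : int :=
  (\sum_i \sum_(j < n) \sum_(t < n | (t < j)%N) A i j * A i t)%N%:Z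
  - (\sum_(i < n) \sum_(s < n | (i < s)%N)
       \sum_(j < n) \sum_(t < n | (t < j)%N) A i j * A s t)%N%:Z.

(* [A] = q^{- d_A / 2} xi_A, with q^{1/2} = v *)
Definition br (A : 'M[nat]_n) : qschur q n r := (v ^ (- dexp A))%:S * xi A.

(* A(j, r), for A with zero diagonal.  In A + D of entry sum r, all entries are
   at most r, so that finitely many D are involved. *)
Definition brA (A : 'M[nat]_n) (j : 'rV[int]_n) : qschur q n r :=
  \sum_(d : 'rV['I_r.+1]_n | msum (A + diag_mx (map_mx val d)) == r)
     (v ^ (\sum_i (val (d 0 i))%:Z * j 0 i))%:S
     * br (A + diag_mx (map_mx val d)).

End Basis.

Notation Qv := {fraction {poly rat}}.

Definition vv : Qv := tofrac 'X.

(* The Laurent polynomial v^{-m} P(v) and its image under v |-> eps. *)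
Definition laurent (m : nat) (P : {poly int}) : Qv :=
  tofrac (map_poly intr P : {poly rat}) / vv ^+ m.

Definition laurent_at (k : fieldType) (eps : k) (m : nat) (P : {poly int}) : k :=
  (map_poly intr P).[eps] / eps ^+ m.

Definition is_laurent (a : Qv) : Prop := exists m P, a = laurent m P.

Definition specializes (k : fieldType) (eps : k) (a : Qv) (b : k) : Prop :=
  exists m P, a = laurent m P /\ b = laurent_at eps m P.

Definition qint (m : nat) : Qv := (vv ^+ m - vv ^- m) / (vv - vv^-1).
Definition qfact (m : nat) : Qv := \prod_(1 <= s < m.+1) qint s.

Inductive gl2_gen : Type := gE | gF | gK of 'I_2 | gKinv of 'I_2.

Section QuantumGL2.
Local Notation E := (Var gE : term Qv gl2_gen).
Local Notation F := (Var gF : term Qv gl2_gen).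
Local Notation K i := (Var (gK i) : term Qv gl2_gen).
Local Notation K' i := (Var (gKinv i) : term Qv gl2_gen).

(* the exponent delta_{i,1} - delta_{i,2} *)
Definition rootexp (i : 'I_2) : int := (i == 0 :> 'I_2)%:Z - (i == 1 :> 'I_2)%:Z.

Inductive gl2_rel : term Qv gl2_gen -> term Qv gl2_gen -> Prop :=
| gl2_KK i j : gl2_rel (K i * K j) (K j * K i)
| gl2_KK' i : gl2_rel (K i * K' i) (Cst 1)
| gl2_K'K i : gl2_rel (K' i * K i) (Cst 1)
| gl2_KE i : gl2_rel (K i * E) (vv ^ rootexp i *: (E * K i))
| gl2_KF i : gl2_rel (K i * F) (vv ^ (- rootexp i) *: (F * K i))
| gl2_EF : gl2_rel (E * F - F * E)
             ((vv - vv^-1)^-1 *: (K 0%R * K' 1%R - K 1%R * K' 0%R)).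

End QuantumGL2.

Definition UQ : Type := palg gl2_rel.
HB.instance Definition _ := AlgebraOver.on UQ.

Definition Ugen (g : gl2_gen) : UQ := pgen gl2_rel g.

Definition divpow (g : gl2_gen) (m : nat) : UQ := (qfact m)^-1%:S * Ugen g ^+ m.

Definition Kbin (j : 'I_2) (t : nat) : UQ :=
  \prod_(1 <= s < t.+1)
    ((vv ^+ s - vv ^- s)^-1%:S
     * ((vv ^ (1 - s%:Z))%:S * Ugen (gK j)
        - (vv ^ (s%:Z - 1))%:S * Ugen (gKinv j))).

Definition Kpow (i : 'I_2) (z : int) : UQ :=
  match z with
  | Posz m => Ugen (gK i) ^+ m
  | Negz m => Ugen (gKinv i) ^+ m.+1
  end.

(* membership in U_Z(2), the subalgebra over the Laurent polynomials *)
Inductive Zform : UQ -> Prop :=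
| Zform_E m : Zform (divpow gE m)
| Zform_F m : Zform (divpow gF m)
| Zform_K j : Zform (Ugen (gK j))
| Zform_Kinv j : Zform (Ugen (gKinv j))
| Zform_bin j t : Zform (Kbin j t)
| Zform_laurent a : is_laurent a -> Zform a%:S
| Zform_add x y : Zform x -> Zform y -> Zform (x + y)
| Zform_mul x y : Zform x -> Zform y -> Zform (x * y).

Definition UZ : Type := {x : UQ | Zform x}.

Section BaseChange.
Variables (k : fieldType) (eps : k).

(* Presentation of the k-algebra U_Z(2) (x) k: its algebra morphisms to a
   k-algebra B are the ring morphisms U_Z(2) -> B that are semilinear along
   v |-> eps.  The generator x stands for x (x) 1. *)
Inductive Uk_rel : term k UZ -> term k UZ -> Prop :=
| Uk_one (x : UZ) : sval x = 1 -> Uk_rel (Var x) (Cst 1)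
| Uk_add (x y z : UZ) : sval z = sval x + sval y ->
    Uk_rel (Var z) (Var x + Var y)
| Uk_mul (x y z : UZ) : sval z = sval x * sval y ->
    Uk_rel (Var z) (Var x * Var y)
| Uk_scale a b (x z : UZ) : specializes eps a b ->
    sval z = a%:S * sval x -> Uk_rel (Var z) (b *: Var x).

Definition Uk : Type := palg Uk_rel.
HB.instance Definition _ := AlgebraOver.on Uk.

(* x (x) 1, for x in U_Z(2) *)
Definition tens1 (x : UQ) : Uk :=
  match pselect (Zform x) with
  | left hx => pgen Uk_rel (exist _ x hx)
  | right _ => 0
  end.

(* tilde u_k(2) *)
Definition uk : Type := galg (fun g : gl2_gen => tens1 (Ugen g)).
HB.instance Definition _ := AlgebraOver.on uk.

Definition ukgen (g : gl2_gen) : uk := ggen (fun g => tens1 (Ugen g)) g.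

Variable r : nat.

Definition UQr : Type := qschur (vv ^+ 2) 2 r.
HB.instance Definition _ := AlgebraOver.on UQr.

Definition Ukr : Type := qschur (eps ^+ 2) 2 r.
HB.instance Definition _ := AlgebraOver.on Ukr.

(* The morphism zeta_r over Q(v), by definite description. *)
Definition zeta : UQ -> UQr :=
  xget (fun=> 0) [set f : UQ -> UQr |
    [/\ is_alghom f,
        f (Ugen gE) = brA vv r (delta_mx 0 1) 0,
        f (Ugen gF) = brA vv r (delta_mx 1 0) 0 &
        forall j : 'rV[int]_2,
          f (\prod_i Kpow i (j 0 i)) = brA vv r 0 j]].

(* x is in U_Z(2,r), and y is its image x (x) 1 in U_k(2,r), which is identified
   with U_Z(2,r) (x) k by means of the bases [A]. *)
Definition schur_specializes (x : UQr) (y : Ukr) : Prop :=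
  exists (a : 'M[nat]_2 -> Qv) (b : 'M[nat]_2 -> k),
    [/\ forall A, specializes eps (a A) (b A),
        x = \sum_(A : 'M['I_r.+1]_2 | msum (map_mx val A) == r)
              (a (map_mx val A))%:S * br vv r (map_mx val A) &
        y = \sum_(A : 'M['I_r.+1]_2 | msum (map_mx val A) == r)
              (b (map_mx val A))%:S * br eps r (map_mx val A)].

(* The base change of zeta_r, by definite description. *)
Definition zetak : Uk -> Ukr :=
  xget (fun=> 0) [set f : Uk -> Ukr |
    is_alghom f /\
    forall x, Zform x -> schur_specializes (zeta x) (f (tens1 x))].

(* The little q-Schur algebra zeta_r(tilde u_k(2)).  The image of a subalgebra
   is a subalgebra; "generated by" serves only to have a ring structure without
   a proof that zetak is a morphism. *)
Definition ukr : Type := galg (fun x : uk => zetak (val x)).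
HB.instance Definition _ := AlgebraOver.on ukr.

(* zeta_r : tilde u_k(2) -> tilde u_k(2,r) *)
Definition zeta_little (x : uk) : ukr := ggen (fun x : uk => zetak (val x)) x.

Definition zeta_div (g : gl2_gen) (m : nat) : Ukr := zetak (tens1 (divpow g m)).

Definition zeta_bin (j : 'I_2) (t : nat) : Ukr := zetak (tens1 (Kbin j t)).

Inductive inf_gen : Type := iE | iF | iK of 'I_2 | iKbin of 'I_2 & nat.

Definition inf_genval (g : inf_gen) : Ukr :=
  match g with
  | iE => zetak (tens1 (Ugen gE))
  | iF => zetak (tens1 (Ugen gF))
  | iK j => zetak (tens1 (Ugen (gK j)))
  | iKbin j t => zeta_bin j t
  end.

(* the infinitesimal q-Schur algebra s_k(2,r) *)
Definition skr : Type := galg inf_genval.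
HB.instance Definition _ := AlgebraOver.on skr.

Definition skgen (g : inf_gen) : skr := ggen inf_genval g.

End BaseChange.

Section Modules.
Variables (k : fieldType) (A : algebraType k).

Definition fin_dim (V : lmodType A) : Prop :=
  exists s : seq V, forall w : V, exists c : nat -> k,
    w = \sum_(i < size s) (c i)%:S *: s`_i.

Definition submodule (V : lmodType A) (N : set V) : Prop :=
  N 0 /\ forall (a : A) x y, N x -> N y -> N (a *: x + y).

Definition simple_module (V : lmodType A) : Prop :=
  [/\ fin_dim V, exists w : V, w != 0 &
      forall N : set V, submodule N -> N = [set 0] \/ N = setT].

Definition generates (V : lmodType A) (w : V) : Prop :=
  forall x : V, exists a : A, x = a *: w.

Definition central_idempotent (e : A) : Prop :=
  e * e = e /\ forall x, e * x = x * e.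

Definition block_idempotent (e : A) : Prop :=
  [/\ central_idempotent e, e != 0 &
      forall f, central_idempotent f -> e * f = f -> f = 0 \/ f = e].

Definition same_block (V W : lmodType A) : Prop :=
  exists e : A, [/\ block_idempotent e,
    forall x : V, e *: x = x & forall y : W, e *: y = y].

End Modules.

(* Lambda^+(2,r), as a set of vectors of integers *)
Definition dominant (r : nat) : set 'rV[int]_2 :=
  [set la | [/\ 0 <= la 0 1, la 0 1 <= la 0 0 & la 0 0 + la 0 1 = r%:Z]].

Definition X1 (l : nat) : set 'rV[int]_2 :=
  [set la | (0 <= la 0 0 - la 0 1 <= l%:Z - 1) /\ (0 <= la 0 1 <= l%:Z - 1)].

Definition X1r (l r : nat) : set 'rV[int]_2 :=
  [set la | (exists mu (nu : 'rV[nat]_2),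
               X1 l mu /\ la = mu + map_mx (fun m => l%:Z * m%:Z) nu)
            /\ la 0 0 + la 0 1 = r%:Z].

Definition redl (l : nat) (la : 'rV[int]_2) : 'rV['Z_l]_2 := map_mx intr la.

Definition rho : 'rV[int]_2 := \row_i (if i == 0 then 1 else 0).

Definition dot_orbit (la : 'rV[int]_2) : set 'rV[int]_2 :=
  [set mu | exists w : {perm 'I_2}, mu = col_perm w (la + rho) - rho].

Section Simples.
Variables (k : fieldType) (eps : k) (l r : nat).

(* In klambda_U and klambda_s, la has nonnegative entries. *)
Definition klambda_U (la : 'rV[int]_2) : Ukr eps r :=
  \prod_i zeta_bin eps r i (absz (la 0 i)).

Definition klambda_s (la : 'rV[int]_2) : skr eps r :=
  \prod_i skgen eps r (iKbin i (absz (la 0 i))).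

(* V is isomorphic to L_k(la). *)
Definition is_L (la : 'rV[int]_2) (V : lmodType (Ukr eps r)) : Prop :=
  simple_module V /\
  exists w : V, [/\ w != 0, generates w, klambda_U la *: w = w &
    forall m, (0 < m)%N -> zeta_div eps r gE m *: w = 0].

(* V is isomorphic to hat L_1(la). *)
Definition is_Lhat (la : 'rV[int]_2) (V : lmodType (skr eps r)) : Prop :=
  simple_module V /\
  exists w : V, [/\ w != 0, generates w, klambda_s la *: w = w &
    skgen eps r iE *: w = 0].

(* The left ideal of tilde u_k(2) attached to a residue class nu modulo l; nu
   is represented by integers in [0, l-1], and eps ^+ l = 1. *)
Definition verma_ideal (nu : 'rV['Z_l]_2) : set (uk eps) :=
  [set x | exists (a : uk eps) (b : 'I_2 -> uk eps),
     x = a * ukgen eps gE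
         + \sum_j b j * (ukgen eps (gK j) - (eps ^+ (nu 0 j : nat))%:S)].

(* V, viewed as a tilde u_k(2)-module by means of zeta_r, is a simple quotient
   of tilde u_k(2) / verma_ideal nu, i.e. is isomorphic to frak L_k(nu). *)
Definition is_frakL (nu : 'rV['Z_l]_2) (V : lmodType (ukr eps r)) : Prop :=
  simple_module V /\
  exists w : V, (forall x : V, exists a : uk eps, x = zeta_little r a *: w) /\
    forall a, verma_ideal nu a -> zeta_little r a *: w = 0.

Definition little_block (nu : 'rV['Z_l]_2) : set 'rV['Z_l]_2 :=
  [set mu | (redl l @` X1r l r) mu /\
    exists V W, [/\ is_frakL nu V, is_frakL mu W & same_block V W]].

Definition schur_block (la : 'rV[int]_2) : set 'rV[int]_2 :=
  [set mu | dominant r mu /\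
    exists V W, [/\ is_L la V, is_L mu W & same_block V W]].

Definition inf_block (la : 'rV[int]_2) : set 'rV[int]_2 :=
  [set mu | X1r l r mu /\
    exists V W, [/\ is_Lhat la V, is_Lhat mu W & same_block V W]].

End Simples.

(* Main.v *)
From HB Require Import structures.
Require Import Defs.
From mathcomp Require Import all_boot all_order perm all_algebra.
From mathcomp Require Import ring zify.
From mathcomp Require Import boolp classical_sets.

Set Implicit Arguments.
Unset Strict Implicit.
Unset Printing Implicit Defensive.

Import Order.TTheory GRing.Theory Num.Theory.

Local Open Scope classical_set_scope.
Local Open Scope ring_scope.

(* The algebra U_k(2,r) acts faithfully on tensor space, where it is spanned by
   the products E^(b) F^(c) k_mu.  Tensor space contains copies of the Weyl
   modules; let y_0, ..., y_d be the standard basis of the one of highest weight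
   (s + d, s).  For b < l, f^b y_0 is a nonzero multiple of y_b, so a central
   idempotent that fixes y_0 also fixes y_b.  If moreover l divides d - b + 1,
   then y_b is killed by all E^(m), and the simple modules of highest weights
   (s + d, s) and (s + d - b, s + b), obtained as heads of the submodules that
   y_0 and y_b generate, are in the same block.  This applies to the two small
   algebras as well: y_0, ..., y_(l-1) span a stable subspace, since f y_(l-1)
   is a multiple of [l] = 0, and the projections onto its lines are polynomials
   in k_2.

   Conversely, k_j^l = 1 on the small algebras and on U_k(2,r), so the quantum
   Casimir element belongs to all three algebras.  It acts on a simple module of
   highest weight la by x + x^-1 with x = eps ^ (la_1 - la_2 + 1), which
   determines la up to the dot action, modulo l. *)

(** The elements [xi] and the maps [zeta], [zetak] are given by description, and [A_q(2)] by a bare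
    presentation, so nothing can be computed before the descriptions are shown to be satisfiable.
    Tensor space settles this: a form of degree r is the matrix of its values on pairs of words, an
    operator commuting with the Hecke algebra yields such a form, and E^(m), F^(m) and the torus are
    given by explicit operators whose entries are Laurent polynomials in v, to be specialised entry
    by entry.

    The condition on b comes from the dot action. If b is the residue of d + 1 modulo l, then (s + d
    - b, s + b) is congruent to (s - 1, s + d + 1), the dot reflection of (s + d, s). When 0 < d + 1
    < l this b exceeds d and y_b = 0; then the given weight has to be the lower one of a longer
    string, and a dominant weight in the reflected class is what guarantees that this string fits
    into degree r.

    Oddness of l enters twice: q = eps^2 must still have order l, and the Casimir congruence, which
    determines weights of sum r only up to a factor 2, has to be halved. *)

Lemma ord2P (i j : 'I_2) : j = i \/ j = rev_ord i.
Proof.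
by case: i j => [[|[|//]] hi] [[|[|//]] hj];
  [left|right|right|left]; apply: val_inj.
Qed.

Lemma rev_ord2_neq (i : 'I_2) : (rev_ord i == i) = false.
Proof. by case: i => [[|[|]]]. Qed.

Lemma rev_ord20 : rev_ord 0 = 1 :> 'I_2. Proof. exact: val_inj. Qed.
Lemma rev_ord21 : rev_ord 1 = 0 :> 'I_2. Proof. exact: val_inj. Qed.

Lemma ord2_ind (P : 'I_2 -> Prop) : P 0 -> P 1 -> forall i, P i.
Proof. by move=> P0 P1 i; case: (ord2P 0 i) => ->; rewrite ?rev_ord20. Qed.

Lemma size_count2 (I : seq 'I_2) :
  (count_mem (0%R : 'I_2) I + count_mem (1%R : 'I_2) I = size I)%N.
Proof. by elim: I => //= i I; elim/ord2_ind: i => /= <-; lia. Qed.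

(** * Divided powers on tensor space *)

Section WordOperators.
Variable R : fieldType.

Definition wvec := seq 'I_2 -> R.
Implicit Types (x y : wvec) (I J K : seq 'I_2) (i j : 'I_2) (t : R).

Definition tlv j x : wvec := fun K => x (j :: K).
Definition wdelta J : wvec := fun K => (K == J)%:R.

(* q-divided powers on tensor space: [divop i t m] is the sum over all the ways
   of changing m letters into i, the weight of a change being t to the power the
   number of pairs of a letter left different from i and a changed letter to its
   right. *)
Fixpoint divop i t m x I {struct I} : R :=
  if I is j :: I' then
    if j == i then
      divop i t m (tlv i x) I'
      + (if m is m'.+1 then divop i t m' (tlv (rev_ord i) x) I' else 0)
    else t ^+ m * divop i t m (tlv j x) I'
  else if m is 0 then x [::] else 0.

Lemma divop_self i t m x I :
  divop i t m x (i :: I) = divop i t m (tlv i x) I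
    + (if m is m'.+1 then divop i t m' (tlv (rev_ord i) x) I else 0).
Proof. by rewrite /= eqxx. Qed.

Lemma divop_other i t m x I :
  divop i t m x (rev_ord i :: I) = t ^+ m * divop i t m (tlv (rev_ord i) x) I.
Proof. by rewrite /= rev_ord2_neq. Qed.

(** The words read at [I] are those from which [I] arises by changing [m] letters into [i], so they
    have [m] letters [i] fewer. This weight count is what moves diagonal operators past [divop]. *)
Lemma divop_eq i t m x y I :
  (forall K, size K = size I -> (count_mem i K + m)%N = count_mem i I ->
     x K = y K) ->
  divop i t m x I = divop i t m y I.
Proof.
elim: I m x y => [|j I IHI] m x y h; first by case: m h => //= h; apply: h.
case: (ord2P i j) => {j} -> in h *.
  rewrite !divop_self; congr (_ + _).
    by apply: IHI => K sK cK; apply: h; rewrite /= ?sK // eqxx -cK addnA.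
  case: m h => [//|m] h; apply: IHI => K sK cK; apply: h; rewrite /= ?sK //.
  by rewrite rev_ord2_neq eqxx -cK addnS.
rewrite !divop_other; congr (_ * _); apply: IHI => K sK cK.
by apply: h; rewrite /= ?sK // rev_ord2_neq cK.
Qed.

Lemma tlv_lin j a x y :
  tlv j (fun K => a * x K + y K) = fun K => a * tlv j x K + tlv j y K.
Proof. by []. Qed.

Lemma divop_lin i t m a x y I :
  divop i t m (fun K => a * x K + y K) I
  = a * divop i t m x I + divop i t m y I.
Proof.
elim: I m x y => [|j I IHI] m x y; first by case: m => [//|m] /=; ring.
case: (ord2P i j) => {j} ->; last first.
  by rewrite !divop_other tlv_lin IHI; ring.
rewrite !divop_self !tlv_lin IHI; case: m => [|m]; first by rewrite !addr0.
by rewrite (IHI m); ring.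
Qed.

Lemma divop0v i t m I : divop i t m (fun=> 0) I = 0.
Proof.
have := divop_lin i t m (-1) (fun=> 0) (fun=> 0) I.
by under [X in divop _ _ _ X]eq_fun do rewrite mulr0 addr0; rewrite mulN1r addNr.
Qed.

Lemma divopZ i t m a x I :
  divop i t m (fun K => a * x K) I = a * divop i t m x I.
Proof.
by rewrite -[RHS]addr0 -(divop0v i t m I) -divop_lin; congr divop;
  apply/funext => K; rewrite addr0.
Qed.

Lemma divopD i t m x y I :
  divop i t m (fun K => x K + y K) I = divop i t m x I + divop i t m y I.
Proof.
by rewrite -[X in X + _]mul1r -divop_lin; congr divop;
  apply/funext => K; rewrite mul1r.
Qed.

Lemma divop_0 i t x : divop i t 0 x = x.
Proof.
apply/funext => I; elim: I x => // j I IHI x; case: (ord2P i j) => ->.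
  by rewrite divop_self IHI addr0.
by rewrite divop_other IHI mul1r.
Qed.

Lemma divop_gt i t m x I : (count_mem i I < m)%N -> divop i t m x I = 0.
Proof.
move=> lt; rewrite -(divop0v i t m I); apply: divop_eq => K _ eK.
by move: lt; rewrite -eK ltnNge leq_addl.
Qed.

(** A set of m + 1 changed letters arises from m + 1 choices of the letter changed last; such a
    choice has the extra weight t to the number of changed letters on its right, hence the factor 1
    + t + ... + t^m. This is the analogue of E E^(m) = [m+1] E^(m+1). *)
Lemma divop_comp i t m x I :
  divop i t 1 (divop i t m x) I
  = (\sum_(s < m.+1) t ^+ s) * divop i t m.+1 x I.
Proof.
have S n : \sum_(s < n.+1) t ^+ s = \sum_(s < n) t ^+ s + t ^+ n.
  by rewrite big_ord_recr.
elim: I m x => [|j I IHI] m x; first by rewrite mulr0.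
case: (ord2P i j) => ->.
  rewrite !divop_self divop_0.
  rewrite {2}/tlv divop_other.
  have -> : tlv i (divop i t m x) = fun K => divop i t m (tlv i x) K
      + (if m is m'.+1 then divop i t m' (tlv (rev_ord i) x) K else 0).
    by apply/funext => K; rewrite /tlv divop_self.
  rewrite divopD IHI mulrDr -!addrA; congr (_ + _).
  case: m => [|m]; last by rewrite IHI (S m.+1); ring.
  by rewrite divop0v add0r big_ord1.
rewrite !divop_other expr1 exprS mulrCA -mulrA -IHI.
have -> : tlv (rev_ord i) (divop i t m x) =
    fun K => t ^+ m * divop i t m (tlv (rev_ord i) x) K.
  by apply/funext => K; rewrite /tlv divop_other.
by rewrite divopZ.
Qed.

(* The generator T_{p+1} of the Hecke algebra, acting on the letters number p
   and p+1. *)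
Fixpoint hecke (q : R) p x I {struct p} : R :=
  if p is p'.+1 then if I is j :: I' then hecke q p' (tlv j x) I' else 0
  else if I is i :: j :: I' then
    if i == j then q * x I
    else if i == 0 then x [:: j, i & I']
    else q * x [:: j, i & I'] + (q - 1) * x I
  else 0.

Lemma hecke_lin q p a x y I :
  hecke q p (fun K => a * x K + y K) I = a * hecke q p x I + hecke q p y I.
Proof.
elim: p x y I => [|p IHp] x y [|i I] /=; try by ring.
  case: I => [|j I]; first by ring.
  by case: ifP => _; last case: ifP => _; ring.
by rewrite -IHp.
Qed.

Lemma hecke0v q p I : hecke q p (fun=> 0) I = 0.
Proof.
have := hecke_lin q p (-1) (fun=> 0) (fun=> 0) I.
by under [X in hecke _ _ X]eq_fun do rewrite mulr0 addr0; rewrite mulN1r addNr.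
Qed.

Lemma heckeZ q p a x I : hecke q p (fun K => a * x K) I = a * hecke q p x I.
Proof.
by rewrite -[RHS]addr0 -(hecke0v q p I) -hecke_lin; congr hecke;
  apply/funext => K; rewrite addr0.
Qed.

Lemma heckeD q p x y I :
  hecke q p (fun K => x K + y K) I = hecke q p x I + hecke q p y I.
Proof.
by rewrite -[X in X + _]mul1r -hecke_lin; congr hecke;
  apply/funext => K; rewrite mul1r.
Qed.

Definition hecke_comm q (D : wvec -> wvec) :=
  forall p x I, (p.+1 < size I)%N -> D (hecke q p x) I = hecke q p (D x) I.

(** Quantum Schur-Weyl duality for two letters. The letters before position [p] are stripped by the
    recursion that both operators share; on the two letters that remain at most two changes occur,
    so m = 0, m = 1 and m >= 2 exhaust the cases. *)
Lemma divop_hecke i t q m : t = (if i == 0 then q else q^-1) -> q != 0 ->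
  hecke_comm q (divop i t m).
Proof.
move=> ti q0 p; elim: p m => [|p IHp] m x I sI; last first.
  case: I sI => [|j I] //= sI.
  have E j' : tlv j' (hecke q p.+1 x) = hecke q p (tlv j' x) by [].
  case: eqP => [->|/eqP ji].
    have -> : tlv i (divop i t m x) = fun K => divop i t m (tlv i x) K
       + (if m is m'.+1 then divop i t m' (tlv (rev_ord i) x) K else 0).
      by apply/funext => K; rewrite /tlv divop_self.
    rewrite E heckeD IHp //; congr (_ + _).
    by case: m => [|m]; rewrite ?hecke0v // E IHp.
  have -> : tlv j (divop i t m x) = fun K => t ^+ m * divop i t m (tlv j x) K.
    by apply/funext => K; rewrite /tlv /= (negPf ji).
  by rewrite heckeZ E IHp.
case: I sI => [//|i1 [//|i2 I]] _ /=.
have hk2 (a b : 'I_2) y : tlv a (tlv b y) = fun K => y [:: b, a & K] by [].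
pose x2 a b : wvec := fun K => x [:: a, b & K].
have H00 : tlv 0 (tlv 0 (hecke q 0 x)) = fun K => q * x2 0 0 K by [].
have H11 : tlv 1 (tlv 1 (hecke q 0 x)) = fun K => q * x2 1 1 K by [].
have H01 : tlv 1 (tlv 0 (hecke q 0 x)) = x2 1 0 by [].
have H10 : tlv 0 (tlv 1 (hecke q 0 x)) = fun K => q * x2 0 1 K + (q - 1) * x2 1 0 K by [].
elim/ord2_ind: i ti => /= ->.
all: elim/ord2_ind: i1; elim/ord2_ind: i2 => /=.
all: rewrite ?rev_ord20 ?rev_ord21.
all: case: m => [|[|m]]; rewrite ?(H00, H01, H10, H11) ?(divopZ, divop_lin, divop0v).
all: rewrite ?exprS ?expr0; rewrite /x2 /tlv; by field.
Qed.

Definition n0 I : nat := count_mem 0 I.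
Definition n1 I : nat := count_mem 1 I.

Lemma tlv_divop_self i t m x :
  tlv i (divop i t m x) = fun K => divop i t m (tlv i x) K
    + (if m is m'.+1 then divop i t m' (tlv (rev_ord i) x) K else 0).
Proof. by apply/funext => K; rewrite /tlv divop_self. Qed.

Lemma tlv_divop_other i t m x :
  tlv (rev_ord i) (divop i t m x) =
    fun K => t ^+ m * divop i t m (tlv (rev_ord i) x) K.
Proof. by apply/funext => K; rewrite /tlv divop_other. Qed.

Lemma divop00 t m x I : divop 0 t m x (0 :: I) = divop 0 t m (tlv 0 x) I
    + (if m is m'.+1 then divop 0 t m' (tlv 1 x) I else 0).
Proof. by rewrite divop_self rev_ord20. Qed.

Lemma divop01 t m x I : divop 0 t m x (1 :: I) = t ^+ m * divop 0 t m (tlv 1 x) I.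
Proof. by have := divop_other 0 t m x I; rewrite rev_ord20. Qed.

Lemma divop11 t m x I : divop 1 t m x (1 :: I) = divop 1 t m (tlv 1 x) I
    + (if m is m'.+1 then divop 1 t m' (tlv 0 x) I else 0).
Proof. by rewrite divop_self rev_ord21. Qed.

Lemma divop10 t m x I : divop 1 t m x (0 :: I) = t ^+ m * divop 1 t m (tlv 0 x) I.
Proof. by have := divop_other 1 t m x I; rewrite rev_ord21. Qed.

Definition divopE := (divop00, divop01, divop10, divop11).

Lemma tlv_divop00 t m x : tlv 0 (divop 0 t m x) = fun K => divop 0 t m (tlv 0 x) K
    + (if m is m'.+1 then divop 0 t m' (tlv 1 x) K else 0).
Proof. by rewrite tlv_divop_self rev_ord20. Qed.

Lemma tlv_divop01 t m x :
  tlv 1 (divop 0 t m x) = fun K => t ^+ m * divop 0 t m (tlv 1 x) K.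
Proof. by have := tlv_divop_other 0 t m x; rewrite rev_ord20. Qed.

Lemma tlv_divop11 t m x : tlv 1 (divop 1 t m x) = fun K => divop 1 t m (tlv 1 x) K
    + (if m is m'.+1 then divop 1 t m' (tlv 0 x) K else 0).
Proof. by rewrite tlv_divop_self rev_ord21. Qed.

Lemma tlv_divop10 t m x :
  tlv 0 (divop 1 t m x) = fun K => t ^+ m * divop 1 t m (tlv 0 x) K.
Proof. by have := tlv_divop_other 1 t m x; rewrite rev_ord21. Qed.

Definition tlv_divopE := (tlv_divop00, tlv_divop01, tlv_divop10, tlv_divop11).

Lemma tlv_delta j j' J :
  tlv j (wdelta (j' :: J)) = if j == j' then wdelta J else fun=> 0.
Proof.
apply/funext => K; rewrite /tlv /wdelta eqseq_cons.
by case: eqP => // _.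
Qed.

(** The commutator of E and F before the powers of [v] in [Eop] and [Fop] are attached. Those powers
    differ by v^2 between the two products, which absorbs the factor [q] of the second one. *)
Lemma divop_commutator (q : R) x I : q != 0 -> q != 1 ->
  divop 0 q 1 (divop 1 q^-1 1 x) I - q * divop 1 q^-1 1 (divop 0 q 1 x) I
  = q * (1 - q ^+ n1 I / q ^+ n0 I) / (q - 1) * x I.
Proof.
move=> q0 q1; have q1' : q - 1 != 0 by rewrite subr_eq0.
elim: I x => [|i I IHI] x.
  by rewrite /n0 /n1 /= !expr0 divr1 subrr !mulr0 mul0r mul0r subrr.
have qn n : q ^+ n != 0 by rewrite expf_neq0.
elim/ord2_ind: i; rewrite !divopE !divop_0 !tlv_divopE !(divopZ, divopD) !divop_0 !expr1.
  have := IHI (tlv 0 x); rewrite /n0 /n1 /= => /(canRL (subrK _)) ->.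
  by rewrite add0n add1n exprS /tlv; field; rewrite ?qn ?q0 ?q1'.
have := IHI (tlv 1 x); rewrite /n0 /n1 /= => /(canRL (subrK _)) ->.
by rewrite add0n add1n exprS /tlv; field; rewrite ?qn ?q0 ?q1'.
Qed.

Definition ups (w : seq ('I_2 * 'I_2)) : nat := count_mem (1, 0) w.
Definition downs (w : seq ('I_2 * 'I_2)) : nat := count_mem (0, 1) w.

(** On the way from the word [unzip2 w] to the word [unzip1 w], each of the [ups w] pairs needs a
    change into 1. With fewer changes the value is 0; with exactly [ups w] and [downs w] changes
    there is only one way to place them, and it contributes a product of powers of [q] and [t]. *)
Lemma divop2_up (q t : R) b c w : q != 0 -> t != 0 ->
  let X := divop 0 q b (divop 1 t c (wdelta (unzip2 w))) (unzip1 w) in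
  ((c < ups w)%N -> X = 0) /\
  (ups w = c -> downs w = b -> X != 0).
Proof.
move=> q0 t0 /=.
elim: w b c => [|[i j] w IHw] b c.
  by split=> [//|<- <- /=]; rewrite oner_neq0.
have Z a u m : divop a u m (fun=> 0) = fun=> 0 by apply/funext=> I; exact: divop0v.
have q' n : q ^+ n != 0 by rewrite expf_neq0.
have t' n : t ^+ n != 0 by rewrite expf_neq0.
rewrite [unzip1 _]/= [unzip2 _]/=.
elim/ord2_ind: i; elim/ord2_ind: j; rewrite !(divopE, tlv_divopE) !tlv_delta /ups /downs /= ?add0n -/(ups w) -/(downs w).
- have E : (fun K => divop 1 t c (fun=> 0) K + match c with 0%N => 0
       | c'.+1 => divop 1 t c' (wdelta (unzip2 w)) K end) =
      if c is c'.+1 then divop 1 t c' (wdelta (unzip2 w)) else fun=> 0.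
    by case: c => [|c]; apply/funext => K; rewrite Z add0r.
  rewrite E divopZ; split=> [lt|e1 e2].
    rewrite (IHw b c).1 // mulr0 add0r.
    case: b => [//|b]; case: c lt {E} => [|c] lt; first by rewrite Z.
    by rewrite (IHw b c).1 // ltnW.
  case: b e2 => [|b] e2; first by rewrite addr0 mulf_neq0 // (IHw 0 c).2.
  case: c e1 {E} => [|c] e1; first by rewrite Z addr0 mulf_neq0 // (IHw b.+1 0).2.
  by rewrite (IHw b c).1 ?e1 // addr0 mulf_neq0 // (IHw b.+1 c.+1).2.
- have E : (fun K => divop 1 t c (wdelta (unzip2 w)) K + match c with 0%N => 0
       | c'.+1 => divop 1 t c' (fun=> 0) K end) = divop 1 t c (wdelta (unzip2 w)).
    by apply/funext => K; case: c => [|c]; rewrite ?Z addr0.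
  have E' : (fun K : seq 'I_2 => t ^+ c * divop 1 t c (fun=> 0) K) = fun=> 0.
    by apply/funext => K; rewrite Z mulr0.
  split=> [lt|e1 e2].
    rewrite E' Z add0r; case: b => [//|b].
    by rewrite E (IHw b c).1.
  case: b e2 => [//|b] [e2]; rewrite E' Z add0r.
  by rewrite E (IHw b c).2.
- case: c => [|c].
    have E : (fun K => divop 1 t 0 (fun=> 0) K + 0) = fun=> 0.
      by apply/funext => K; rewrite Z addr0.
    by rewrite E Z mulr0; split.
  have E : (fun K => divop 1 t c.+1 (fun=> 0) K + divop 1 t c (wdelta (unzip2 w)) K) =
      divop 1 t c (wdelta (unzip2 w)) by apply/funext => K; rewrite Z add0r.
  rewrite E; split=> [lt|[e1] e2]; first by rewrite (IHw b c).1 // mulr0.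
  by rewrite mulf_neq0 // (IHw b c).2.
- have E : (fun K => divop 1 t c (wdelta (unzip2 w)) K + match c with 0%N => 0
       | c'.+1 => divop 1 t c' (fun=> 0) K end) = divop 1 t c (wdelta (unzip2 w)).
    by apply/funext => K; case: c => [|c]; rewrite ?Z addr0.
  rewrite E; split=> [lt|e1 e2]; first by rewrite (IHw b c).1 // mulr0.
  by rewrite mulf_neq0 // (IHw b c).2.
Qed.

End WordOperators.

(** * Commutation with the Hecke algebra and membership in the q-Schur algebra *)

Section WordMatrices.
Variables (R : fieldType) (r : nat).
Local Notation N := #|{: r.-tuple 'I_2}|.
Implicit Types (x y : wvec R) (I J K : seq 'I_2) (D : wvec R -> wvec R).

Definition rk I : 'I_N := enum_rank (insubd (nseq_tuple r 0) I).
Definition wd (a : 'I_N) : seq 'I_2 := val (enum_val a : r.-tuple 'I_2).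

Lemma size_wd a : size (wd a) = r. Proof. exact: size_tuple. Qed.

Lemma rkK I : size I = r -> wd (rk I) = I.
Proof. by move=> sI; rewrite /wd /rk enum_rankK val_insubd sI eqxx. Qed.

Lemma wdK : cancel wd rk.
Proof.
move=> a; rewrite /rk -[RHS]enum_valK; congr enum_rank; apply: val_inj.
by rewrite val_insubd size_wd eqxx.
Qed.

Lemma rk_tuple (I : r.-tuple 'I_2) : rk I = enum_rank I.
Proof. by rewrite /rk; congr enum_rank; apply: val_inj; rewrite val_insubd size_tuple eqxx. Qed.

Definition vecw x : 'cV[R]_N := \col_a x (wd a).

Definition mxop D : 'M[R]_N := \matrix_(a, b) D (wdelta R (wd b)) (wd a).

(** Vectors are functions on words of all lengths. The second clause makes the restriction of an
    operator to words of length [r] meaningful, so that composition becomes the product of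
    matrices. *)
Definition lop D :=
  (forall a x y I, D (fun K => a * x K + y K) I = a * D x I + D y I) /\
  (forall x y I, (forall K, size K = size I -> x K = y K) -> D x I = D y I).

Lemma lop0 D I : lop D -> D (fun=> 0) I = 0.
Proof.
move=> lD; have := lD.1 (-1) (fun=> 0) (fun=> 0) I.
by under [X in D X]eq_fun do rewrite mulr0 addr0; rewrite mulN1r addNr.
Qed.

Lemma lop_sum D (T : Type) (s : seq T) (a : T -> R) (f : T -> wvec R) I :
  lop D -> D (fun K => \sum_(i <- s) a i * f i K) I = \sum_(i <- s) a i * D (f i) I.
Proof.
move=> lD; elim: s => [|i s IHs].
  rewrite big_nil -[RHS](lop0 I lD); congr (D _ I).
  by apply/funext => K; rewrite big_nil.
rewrite big_cons -IHs -lD.1; congr (D _ I).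
by apply/funext => K; rewrite big_cons.
Qed.

Lemma lop_expand D x I : lop D -> size I = r ->
  D x I = \sum_b x (wd b) * D (wdelta R (wd b)) I.
Proof.
move=> lD sI; rewrite -(lop_sum _ _ _ _ lD); apply: lD.2 => K sK.
rewrite (bigD1 (rk K)) //= rkK ?sK // /wdelta eqxx mulr1 big1 ?addr0 // => b bK.
case: eqP => [eK|_]; last by rewrite mulr0.
by move: bK; rewrite eK wdK eqxx.
Qed.

Lemma lop_comp D D' : lop D -> lop D' -> lop (D \o D').
Proof.
move=> [l1 c1] [l2 c2]; split=> [a x y I|x y I h] /=; last first.
  by apply: c1 => K sK; apply: c2 => K' sK'; apply: h; rewrite sK'.
by rewrite -l1; congr (D _ I); apply/funext => K; rewrite l2.
Qed.

Lemma lop_divop i t m : lop (@divop R i t m).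
Proof.
split=> [*|x y I h]; first exact: divop_lin.
by apply: divop_eq => K sK _; apply: h.
Qed.

Lemma mxop_vec D x : lop D -> mxop D *m vecw x = vecw (D x).
Proof.
move=> lD; apply/matrixP => a b; rewrite !mxE (lop_expand x lD) ?size_wd //.
by apply: eq_bigr => c _; rewrite !mxE mulrC.
Qed.

Lemma mxopM D D' : lop D -> mxop D *m mxop D' = mxop (D \o D').
Proof.
move=> lD; apply/matrixP => a b; rewrite !mxE /= (lop_expand _ lD) ?size_wd //.
by apply: eq_bigr => c _; rewrite !mxE mulrC.
Qed.

Lemma mxop_ext D D' : (forall x I, size I = r -> D x I = D' x I) -> mxop D = mxop D'.
Proof. by move=> h; apply/matrixP => a b; rewrite !mxE h ?size_wd. Qed.

Lemma mxop_id : mxop id = 1%:M.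
Proof.
apply/matrixP => a b; rewrite !mxE /wdelta; congr (_%:R); congr nat_of_bool.
by apply/eqP/eqP => [h|->//]; rewrite -(wdK a) h wdK.
Qed.

Definition ent (phi : 'M[R]_N) (w : seq ('I_2 * 'I_2)) : R :=
  phi (rk (unzip1 w)) (rk (unzip2 w)).

Lemma ent_mxop D w : size w = r -> ent (mxop D) w = D (wdelta R (unzip2 w)) (unzip1 w).
Proof. by move=> sw; rewrite /ent !mxE !rkK ?size_map. Qed.

Lemma kills_counit (q : R) :
  @kills_rel R q 2 (fun w => (all (fun g : 'I_2 * 'I_2 => g.1 == g.2) w)%:R).
Proof.
split=> [u w i j m|u w i j k s ki js|u w i j k s ki js]; rewrite !all_cat /=.
- by rewrite (andbCA (i == j)).
- case: (i =P j) => [ij|_]; case: (k =P s) => [ks|_];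
    rewrite ?andbF ?mulr0 //=.
  by move: ki; rewrite ij ks ltnNge js.
- rewrite (andbCA (i == j)); set b := (k == j) && _.
  have -> : b = false.
    rewrite /b; case: (k =P j) => //= kj; case: (i =P s) => //= is_.
    by move: ki js; rewrite is_ kj => /ltn_trans h /h; rewrite ltnn.
  by rewrite andbF mulr0 add0r.
Qed.

Lemma zip_diag (s t : seq 'I_2) : size s = size t ->
  all (fun g : 'I_2 * 'I_2 => g.1 == g.2) (zip s t) -> s = t.
Proof.
elim: s t => [|a s IHs] [|b t] //= /eqP; rewrite eqSS => /eqP st.
by case/andP=> /eqP -> /IHs ->.
Qed.

(** A function F on words has to be turned into a linear form on the quotient by the relations. The
    action [Dact] descends to that quotient, and applied to F (x) counit it returns (F (x)
    counit)(Delta x) = F(x). *)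
Lemma kills_qschur (q : R) (phi : 'M[R]_N) :
  @kills_rel R q 2 (fun w => if size w == r then ent phi w else 0) ->
  phi \in @qschur_pred R q 2 r.
Proof.
move=> hF; set F := (fun w => _) in hF; apply/asboolP.
pose e (w : seq ('I_2 * 'I_2)) : R := (all (fun g => g.1 == g.2) w)%:R.
pose B := fun w w' => F w * e w'.
have hB : kills_rel2 q B.
  split=> w; last exact/kills_relZ/kills_counit.
  by under [X in kills_rel _ X]eq_fun do rewrite /B mulrC; apply: kills_relZ.
exists (fun z => Dact z B [::] [::]); split=> [a x y _ _|I J].
  by rewrite DactD // DactM // Dact_cst //; apply: Dop_kills.
rewrite /cmon Dact_word // (bigD1 J) //= big1 ?addr0 => [|T TJ].
  rewrite /B /F /e /= size_zip !size_tuple minnn eqxx.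
  have -> : all (fun g : 'I_2 * 'I_2 => g.1 == g.2) (zip J J).
    by elim: (val J) => //= j s ->; rewrite eqxx.
  by rewrite mulr1 /ent unzip1_zip ?unzip2_zip ?size_tuple // !rk_tuple.
rewrite /B /e; suff -> : all (fun g : 'I_2 * 'I_2 => g.1 == g.2) (zip T J) = false.
  by rewrite mulr0.
apply: contraNF TJ => TJ; apply/eqP/val_inj/zip_diag => //.
by rewrite !size_tuple.
Qed.

Lemma hecke_cat (q : R) (u I : seq 'I_2) x :
  hecke q (size u) x (u ++ I) = hecke q 0 (fun K => x (u ++ K)) I.
Proof. by elim: u x => [|j u IHu] x //=; rewrite IHu. Qed.

Lemma hecke_delta (q : R) (u J K : seq 'I_2) i j :
  size K = size (u ++ [:: i, j & J]) ->
  hecke q (size u) (wdelta R (u ++ [:: i, j & J])) K =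
  (if i == 0 then q else 1) * wdelta R (u ++ [:: j, i & J]) K
  + (if (i == 1) && (j == 0) then (q - 1) * wdelta R (u ++ [:: i, j & J]) K else 0)
  + (if (i == 1) && (j == 1) then (q - 1) * wdelta R (u ++ [:: j, i & J]) K else 0).
Proof.
elim: u K => [|a u IHu] [|b K] //=; last first.
  case=> sK; rewrite /wdelta; have := IHu K sK; rewrite /wdelta.
  have E I : ([:: b & K] == a :: I) = (b == a) && (K == I) by rewrite eqseq_cons.
  rewrite !E => IH; case: (eqVneq b a) => [->|ba] /=.
    rewrite -IH; congr hecke; apply/funext => L; rewrite /tlv /=.
    by rewrite eqseq_cons eqxx.
  rewrite !mulr0; do 2!case: ifP => _; rewrite !addr0;
  rewrite -[RHS](hecke0v q (size u) K); congr hecke; apply/funext => L;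
  by rewrite /tlv /= eqseq_cons (negPf ba).
case: K => [//|c K] _; rewrite /wdelta !eqseq_cons.
by elim/ord2_ind: i; elim/ord2_ind: j; elim/ord2_ind: b; elim/ord2_ind: c => /=;
 rewrite ?mulr0 ?addr0 ?add0r ?mul1r; case: (K == J) => /=; ring.
Qed.

(** Evaluated on basis words at two adjacent positions, commutation with a Hecke generator gives the
    defining relations of [A_q(2)] for the matrix coefficients. *)
Lemma hecke_comm_qschur (q : R) D :
  q != 0 -> lop D -> hecke_comm q D -> mxop D \in @qschur_pred R q 2 r.
Proof.
move=> q0 lD cD; apply: kills_qschur.
have key u w (i k j s : 'I_2) : size (u ++ [:: (i, j), (k, s) & w]) = r ->
    let c a b j s := D (wdelta R (unzip2 u ++ [:: j, s & unzip2 w]))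
                       (unzip1 u ++ [:: a, b & unzip1 w]) in
  (if j == 0 then q else 1) * c i k s j
  + (if (j == 1) && (s == 0) then (q - 1) * c i k j s else 0)
  + (if (j == 1) && (s == 1) then (q - 1) * c i k s j else 0)
  = if i == k then q * c i k j s else
    if i == 0 then c k i j s else q * c k i j s + (q - 1) * c i k j s.
  move=> sz c; pose I := unzip1 u ++ [:: i, k & unzip1 w].
  have sI : size I = size (unzip2 u ++ [:: j, s & unzip2 w]).
    by rewrite !size_cat /= !size_map.
  have := cD (size (unzip1 u)) (wdelta R (unzip2 u ++ [:: j, s & unzip2 w])) I.
  rewrite hecke_cat /= => <-; last by rewrite size_cat /= !addnS !ltnS leq_addr.
  have -> : size (unzip1 u) = size (unzip2 u) by rewrite !size_map.
  rewrite (@lD.2 _ (fun K => (if j == 0 then q else 1) *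
      wdelta R (unzip2 u ++ [:: s, j & unzip2 w]) K
      + ((if (j == 1) && (s == 0) then q - 1 else 0) *
         wdelta R (unzip2 u ++ [:: j, s & unzip2 w]) K
      + (if (j == 1) && (s == 1) then q - 1 else 0) *
         wdelta R (unzip2 u ++ [:: s, j & unzip2 w]) K))) => [|K sK].
    rewrite lD.1 lD.1.
    rewrite (_ : (fun K => _ * wdelta _ _ K) = fun K =>
      (if (j == 1) && (s == 1) then q - 1 else 0) *
         wdelta R (unzip2 u ++ [:: s, j & unzip2 w]) K + (fun=> 0) K); last first.
      by apply/funext => K; rewrite addr0.
    by rewrite lD.1 lop0 // addr0 addrA; congr (_ + _ + _); case: ifP; rewrite ?mul0r.
  rewrite hecke_delta ?sK // addrA.
  by congr (_ + _ + _); case: ifP; rewrite ?mul0r.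
have E u w (i k j s : 'I_2) : size (u ++ [:: (i, j), (k, s) & w]) = r ->
    ent (mxop D) (u ++ [:: (i, j), (k, s) & w]) =
    D (wdelta R (unzip2 u ++ [:: j, s & unzip2 w]))
                       (unzip1 u ++ [:: i, k & unzip1 w]).
  by move=> sz; rewrite ent_mxop // /unzip1 /unzip2 !map_cat.
have S u w (g h g' h' : 'I_2 * 'I_2) :
  size (u ++ [:: g, h & w]) = size (u ++ [:: g', h' & w]).
  by rewrite !size_cat.
split=> [u w i j m|u w i j k s ki js|u w i j k s ki sj].
- have [sz|] := eqP; last first.
    by rewrite (S u w (i, j) (i, m) (i, m) (i, j)); case: eqP.
  have sz' := sz; rewrite (S u w (i, j) (i, m) (i, m) (i, j)) in sz'.
  rewrite sz' eqxx !E // {E S}.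
  move: (key u w i i j m sz) (key u w i i m j sz'); rewrite eqxx {key sz sz'} /=.
  by elim/ord2_ind: j; elim/ord2_ind: m => //=; rewrite !addr0 !mul1r => h1 h2;
    apply: (mulfI q0); rewrite ?h1 ?h2.
- have [sz|] := eqP; last first.
    by rewrite (S u w (i, j) (k, s) (k, s) (i, j)); case: eqP; rewrite ?mulr0.
  have sz' := sz; rewrite (S u w (i, j) (k, s) (k, s) (i, j)) in sz'.
  rewrite sz' eqxx !E //.
  have sz2 := sz; rewrite (S u w (i, j) (k, s) (k, j) (i, s)) in sz2.
  move: (key u w k i j s sz2) js => {key E S sz sz' sz2}.
  elim/ord2_ind: i ki; elim/ord2_ind: k => //= _; elim/ord2_ind: j;
  elim/ord2_ind: s => //= <- _; rewrite ?addr0; ring.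
- have [sz|] := eqP; last first.
    rewrite (S u w (i, j) (k, s) (k, s) (i, j)) (S u w (k, s) (i, j) (k, j) (i, s)).
    by case: eqP; rewrite ?mulr0 ?addr0.
  have sz' := sz; rewrite (S u w (i, j) (k, s) (k, s) (i, j)) in sz'.
  have sz2 := sz; rewrite (S u w (i, j) (k, s) (k, j) (i, s)) in sz2.
  rewrite sz' sz2 eqxx !E //.
  move: (key u w k i j s sz2) sj => {key E S sz sz' sz2}.
  elim/ord2_ind: i ki; elim/ord2_ind: k => //= _; elim/ord2_ind: j;
  elim/ord2_ind: s => //= <- _; rewrite ?addr0; ring.
Qed.

End WordMatrices.

(** * Quantum matrices *)

Section PBW.
Variables (R : fieldType) (q : R).
Hypothesis q0 : q != 0.
Local Notation G := ('I_2 * 'I_2)%type.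
Local Notation c00 := (cvar q (0 : 'I_2) (0 : 'I_2)).
Local Notation c01 := (cvar q (0 : 'I_2) (1 : 'I_2)).
Local Notation c10 := (cvar q (1 : 'I_2) (0 : 'I_2)).
Local Notation c11 := (cvar q (1 : 'I_2) (1 : 'I_2)).

(* The word of the monomial c00^a c10^c c01^b c11^d. *)
Definition bw a c b d : seq G :=
  nseq a (0, 0) ++ nseq c (1, 0) ++ nseq b (0, 1) ++ nseq d (1, 1).

Definition mono2 a c b d : qmat q 2 :=
  c00 ^+ a * c10 ^+ c * (c01 ^+ b * c11 ^+ d).

Lemma cword_cat (u w : seq G) : cword q (u ++ w) = cword q u * cword q w.
Proof. by rewrite /cword big_cat. Qed.

Lemma cword_nseq a (g : G) : cword q (nseq a g) = cvar q g.1 g.2 ^+ a.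
Proof.
by rewrite /cword; elim: a => [|a IHa]; rewrite ?big_nil // big_cons IHa exprS.
Qed.

Lemma cword_bw a c b d : cword q (bw a c b d) = mono2 a c b d.
Proof. by rewrite /bw !cword_cat !cword_nseq /mono2 !mulrA. Qed.

Lemma size_bw a c b d : size (bw a c b d) = (a + c + b + d)%N.
Proof. by rewrite /bw !size_cat !size_nseq !addnA. Qed.

Lemma c00_mono2 a c b d : c00 * mono2 a c b d = mono2 a.+1 c b d.
Proof. by rewrite /mono2 exprS !mulrA. Qed.

Lemma cstCA (a : R) (x y : qmat q 2) : x * (a%:S * y) = a%:S * (x * y).
Proof. by rewrite mulrA -cst_central -mulrA. Qed.

Lemma comm_expr (x y : qmat q 2) (s : R) a :
  x * y = s%:S * (y * x) -> x * y ^+ a = (s ^+ a)%:S * (y ^+ a * x).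
Proof.
move=> h; elim: a => [|a IHa]; first by rewrite !expr0 mulr1 !rmorph1 !mul1r.
rewrite exprSr mulrA IHa -!mulrA h cstCA !mulrA -rmorphM /=.
by rewrite -exprSr.
Qed.

Lemma c10_mono2 a c b d : c10 * mono2 a c b d = (q ^+ a)%:S * mono2 a c.+1 b d.
Proof.
rewrite /mono2 !mulrA (comm_expr (x := c10) (y := c00) (s := q)); last exact: cvar_le.
by rewrite exprS !mulrA.
Qed.

Lemma c01_mono2 a c b d :
  c01 * mono2 a c b d = (q^-1 ^+ c)%:S * mono2 a c b.+1 d.
Proof.
rewrite /mono2 !mulrA (comm_expr (x := c01) (y := c00) (s := 1)); last first.
  by rewrite rmorph1 mul1r cvar_row.
rewrite expr1n rmorph1 mul1r -(mulrA _ c01) (comm_expr (x := c01) (y := c10) (s := q^-1)); last first.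
  have := @cvar_le R q 2 1 0 0 1 isT isT => ->.
  by rewrite !mulrA -rmorphM mulVf // rmorph1 mul1r.
by rewrite cstCA exprS !mulrA.
Qed.

(** Each passage of [c11] over a factor [c00] leaves a term (q - 1) c01 c10. Moving these terms past
    the remaining [c00] costs successive powers of q, and the geometric sum telescopes to q^(a+1) -
    1. *)
Lemma c11_expr a : c11 * c00 ^+ a.+1 =
  c00 ^+ a.+1 * c11 + (q ^+ a.+1 - 1)%:S * (c00 ^+ a * (c01 * c10)).
Proof.
have E : c11 * c00 = (q - 1)%:S * (c01 * c10) + c00 * c11 by apply: cvar_gt.
elim: a => [|a IHa]; first by rewrite !expr1 expr0 mul1r E addrC.
rewrite exprSr mulrA IHa mulrDl -[X in X + _]mulrA E mulrDr cstCA.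
have E1 : c10 * c00 = q%:S * (c00 * c10) by apply: cvar_le.
have E2 : c01 * c00 = c00 * c01 by apply: cvar_row.
have -> : (q ^+ a.+1 - 1)%:S * (c00 ^+ a * (c01 * c10)) * c00 =
    (q * (q ^+ a.+1 - 1))%:S * (c00 ^+ a.+1 * (c01 * c10)).
  rewrite -(mulrA _ _ c00) -(mulrA _ _ c00) -(mulrA c01) E1 (cstCA _ c01).
  rewrite (cstCA _ (c00 ^+ a)) (mulrA c01) E2 -(mulrA c00) (mulrA (c00 ^+ a)).
  by rewrite -exprSr [LHS]mulrA -rmorphM /= (mulrC q).
rewrite addrAC -mulrDl -rmorphD addrC (mulrA _ c00 c11); congr (_ + _%:S * _).
by rewrite (exprS q a.+1); ring.
Qed.

(** For a = 0 the coefficient q^0 - 1 vanishes, so the truncated [a.-1] is harmless; the transposed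
    action [pbw] relies on the same convention. *)
Lemma c11_mono2 a c b d : c11 * mono2 a c b d =
  (q ^+ b)%:S * mono2 a c b d.+1
  + ((q ^+ a - 1) * q^-1 ^+ c.+1)%:S * mono2 a.-1 c.+1 b.+1 d.
Proof.
have H : c11 * (c10 ^+ c * (c01 ^+ b * c11 ^+ d)) =
    (q ^+ b)%:S * (c10 ^+ c * (c01 ^+ b * c11 ^+ d.+1)).
  rewrite mulrA (comm_expr (x := c11) (y := c10) (s := 1)); last by rewrite rmorph1 mul1r cvar_row.
  rewrite expr1n rmorph1 mul1r -mulrA (mulrA c11) (comm_expr (x := c11) (y := c01) (s := q)); last first.
    exact: cvar_le.
  by rewrite -(mulrA _%:S) cstCA -(mulrA _ c11) exprS.
case: a => [|a].
  by rewrite /mono2 !expr0 !mul1r H subrr mul0r rmorph0 mul0r addr0.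
rewrite {1}/mono2 -[_ * _ * (_ * _)]mulrA mulrA c11_expr mulrDl -!mulrA H cstCA.
congr (_ + _); first by rewrite /mono2 !mulrA.
rewrite rmorphM -[in RHS]mulrA; congr (_ * _).
rewrite (mulrA c10) -exprS (mulrA c01) (comm_expr (x := c01) (y := c10) (s := q^-1)); last first.
  have := @cvar_le R q 2 1 0 0 1 isT isT => ->.
  by rewrite !mulrA -rmorphM mulVf // rmorph1 mul1r.
by rewrite -mulrA cstCA /mono2 (exprS c01 b) !mulrA.
Qed.

Variable r : nat.
Local Notation N := #|{: r.-tuple 'I_2}|.

Lemma represents_ent f (phi : 'M[R]_N) (w : seq G) : @represents R q 2 r f phi ->
  size w = r -> ent phi w = f (cword q w).
Proof.
move=> [_ h] sw; have sz1 : size (unzip1 w) == r by rewrite size_map sw.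
have sz2 : size (unzip2 w) == r by rewrite size_map sw.
have := h (Tuple sz1) (Tuple sz2); rewrite /cmon /= zip_unzip => <-.
by rewrite /ent -!rk_tuple.
Qed.

(** Spanning half of the PBW theorem. A generator times an ordered monomial is a combination of
    ordered monomials, so a form vanishing on these vanishes on every word, whose letters are
    absorbed from right to left. *)
Lemma ent_bw_inj (phi : 'M[R]_N) : phi \in @qschur_pred R q 2 r ->
  (forall a c b d, (a + c + b + d)%N = r -> ent phi (bw a c b d) = 0) -> phi = 0.
Proof.
move=> /asboolP[f hf] h0.
have key u a c b d : (size u + (a + c + b + d))%N = r ->
    f (cword q u * mono2 a c b d) = 0.
  have dg u' a' c' b' d' : (size u' + (a' + c' + b' + d'))%N = r ->
      @qmat_deg R q 2 r (cword q u' * mono2 a' c' b' d').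
    move=> sz; rewrite -cword_bw -cword_cat; apply: qmat_deg_word.
    by rewrite size_cat size_bw.
  elim/last_ind: u a c b d => [|u g IHu] a c b d.
    move=> /= sz; rewrite /cword big_nil mul1r -cword_bw.
    by rewrite -(represents_ent hf) ?size_bw // h0.
  rewrite size_rcons => sz; rewrite -cats1 cword_cat [cword q [:: g]]/cword.
  rewrite big_seq1 -mulrA; case: g => i j /=.
  elim/ord2_ind: i; elim/ord2_ind: j.
  - by rewrite c00_mono2 IHu //; lia.
  - rewrite c01_mono2 cstCA (representsZ hf) ?IHu ?mulr0 //; [lia|apply: dg; lia].
  - rewrite c10_mono2 cstCA (representsZ hf) ?IHu ?mulr0 //; [lia|apply: dg; lia].
  rewrite c11_mono2 mulrDr !cstCA; case: a sz => [|a] sz.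
    rewrite subrr mul0r rmorph0 mul0r addr0 (representsZ hf) ?IHu ?mulr0 //; [lia|apply: dg; lia].
  rewrite hf.1 ?IHu ?mulr0 ?add0r //; try (by lia); try (by apply: dg; lia).
    rewrite (representsZ hf) ?IHu ?mulr0 //; [lia|apply: dg; lia].
  have : @qmat_deg R q 2 r (cword q u * mono2 a c.+1 b.+1 d) by apply: dg; lia.
  case=> al ->; exists (fun I J => (q ^+ a.+1 - 1) * q^-1 ^+ c.+1 * al I J).
  rewrite mulr_sumr; apply: eq_bigr => I _; rewrite mulr_sumr; apply: eq_bigr => J _.
  by rewrite mulrA -rmorphM.
apply/matrixP => a b; rewrite mxE -(wdK a) -(wdK b).
have sz : size (zip (wd a) (wd b)) = r by rewrite size_zip !size_wd minnn.
have /= := represents_ent hf sz; rewrite /ent unzip1_zip ?unzip2_zip ?size_wd // => ->.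
have := @key (zip (wd a) (wd b)) 0 0 0 0; rewrite /mono2 !expr0 !mulr1; apply.
by rewrite sz !addn0.
Qed.

Local Notation form4 := (nat -> nat -> nat -> nat -> R).

(* The transpose of left multiplication on the basis c00^a c10^c c01^b c11^d. *)
Fixpoint pbw (t : term R G) (phi : form4) : form4 :=
  match t with
  | Var (i, j) => fun a c b d =>
      if i == 0 then if j == 0 then phi a.+1 c b d else q^-1 ^+ c * phi a c b.+1 d
      else if j == 0 then q ^+ a * phi a c.+1 b d
      else q ^+ b * phi a c b d.+1
           + (q ^+ a - 1) * q^-1 ^+ c.+1 * phi a.-1 c.+1 b.+1 d
  | Cst x => fun a c b d => x * phi a c b d
  | Add s t => fun a c b d => pbw s phi a c b d + pbw t phi a c b d
  | Mul s t => pbw t (pbw s phi)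
  end.

Lemma pbw_lin t x phi psi a c b d :
  pbw t (fun a c b d => x * phi a c b d + psi a c b d) a c b d =
  x * pbw t phi a c b d + pbw t psi a c b d.
Proof.
elim: t phi psi a c b d => [[i j]|y|s IHs t IHt|s IHs t IHt] phi psi a c b d /=.
- by elim/ord2_ind: i; elim/ord2_ind: j => /=; ring.
- by ring.
- by rewrite IHs IHt; ring.
- rewrite -IHt; congr (pbw t _ a c b d).
  by do 4!apply/funext => ?; rewrite IHs.
Qed.

Lemma pbw_rel s t phi : qmat_rel q s t -> pbw s phi = pbw t phi.
Proof.
move=> st; apply/funext => a; do 3!apply/funext => ?.
case: st => [i j m|i j k s' + +|i j k s' + +].
- elim/ord2_ind: i; elim/ord2_ind: j; elim/ord2_ind: m => //=;
    by case: a => [|a] /=; rewrite ?exprS ?expr0; field.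
- elim/ord2_ind: i; elim/ord2_ind: k => //= _; elim/ord2_ind: j;
    elim/ord2_ind: s' => //= _;
    by case: a => [|a] /=; rewrite ?exprS ?expr0; field.
- elim/ord2_ind: i; elim/ord2_ind: k => //= _; elim/ord2_ind: j;
    elim/ord2_ind: s' => //= _;
    by case: a => [|a] /=; rewrite ?exprS ?expr0; field.
Qed.

Lemma pbwD t phi psi a c b d :
  pbw t (fun a c b d => phi a c b d + psi a c b d) a c b d =
  pbw t phi a c b d + pbw t psi a c b d.
Proof.
rewrite -[X in X + _]mul1r -pbw_lin; congr (pbw t _ _ _ _ _).
by do 4!apply/funext => ?; rewrite mul1r.
Qed.

Lemma pbwZ t x phi a c b d :
  pbw t (fun a c b d => x * phi a c b d) a c b d = x * pbw t phi a c b d.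
Proof.
have E : (fun a c b d => x * phi a c b d) =
    fun a c b d => x * phi a c b d + (fun _ _ _ _ => 0) a c b d.
  by do 4!apply/funext => ?; rewrite addr0.
rewrite E pbw_lin -[RHS]addr0; congr (_ + _).
have e := pbw_lin t (-1) (fun _ _ _ _ => 0) (fun _ _ _ _ => 0) a c b d.
rewrite [RHS](_ : _ = 0) in e; last by ring.
rewrite -[RHS]e; congr (pbw t _ _ _ _ _).
by do 4!apply/funext => ?; rewrite mulr0 addr0.
Qed.

Lemma pbw_cong s t : cong (@qmat_rel R q 2) s t -> forall phi, pbw s phi = pbw t phi.
Proof.
elim=> {s t} //=.
- by move=> s t st phi; apply: pbw_rel.
- by move=> t s u _ IH1 _ IH2 phi; rewrite IH1 IH2.
- by move=> s s' t t' _ IH1 _ IH2 phi; rewrite IH1 IH2.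
- by move=> s s' t t' _ IH1 _ IH2 phi; rewrite IH1 IH2.
- by move=> s t u phi; do 4!apply/funext => ?; rewrite addrA.
- by move=> s t phi; do 4!apply/funext => ?; rewrite addrC.
- by move=> t phi; do 4!apply/funext => ?; rewrite mul0r add0r.
- by move=> t phi; do 4!apply/funext => ?; rewrite pbwZ mulN1r addNr mul0r.
- by move=> t phi; do 4!apply/funext => ?; rewrite pbwZ mul1r.
- by move=> t phi; do 4!apply/funext => ?; rewrite mul1r.
- by move=> s t u phi; do 4!apply/funext => ?; rewrite pbwD.
- by move=> a b phi; do 4!apply/funext => ?; rewrite mulrDl.
- by move=> a b phi; do 4!apply/funext => ?; rewrite -mulrA mulrCA.
- by move=> x t phi; do 4!apply/funext => ?; rewrite pbwZ.
Qed.

(** Independence half of the PBW theorem: the delta function at (a, c, b, d), moved by [x] and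
    evaluated at the empty monomial, is the coefficient of that ordered monomial in [x]. *)
Definition dual_form (a c b d : nat) (x : qmat q 2) : R :=
  pbw (repr x) (fun a' c' b' d' => ((a', c', b', d') == (a, c, b, d))%:R) 0 0 0 0.

Lemma pbw_pclass t phi : pbw (repr (pclass (@qmat_rel R q 2) t)) phi = pbw t phi.
Proof. exact/pbw_cong/repr_pclass. Qed.

Lemma pbw_mul (x y : qmat q 2) phi :
  pbw (repr (x * y)) phi = pbw (repr y) (pbw (repr x) phi).
Proof.
by rewrite -[x in LHS]pclassK -[y in LHS]pclassK -pclassM pbw_pclass.
Qed.

Lemma pbw_exp00 n phi a c b d : pbw (repr (c00 ^+ n)) phi a c b d = phi (a + n)%N c b d.
Proof.
elim: n phi a => [|n IHn] phi a.
  by rewrite expr0 -(rmorph1 cst) pbw_pclass /= mul1r addn0.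
by rewrite exprS pbw_mul IHn pbw_pclass /= addnS.
Qed.

Lemma pbw_exp10 n phi c b d : pbw (repr (c10 ^+ n)) phi 0 c b d = phi 0%N (c + n)%N b d.
Proof.
elim: n phi c => [|n IHn] phi c.
  by rewrite expr0 -(rmorph1 cst) pbw_pclass /= mul1r addn0.
by rewrite exprS pbw_mul IHn pbw_pclass /= mul1r addnS.
Qed.

Lemma pbw_exp01 n phi b d : pbw (repr (c01 ^+ n)) phi 0 0 b d = phi 0%N 0%N (b + n)%N d.
Proof.
elim: n phi b => [|n IHn] phi b.
  by rewrite expr0 -(rmorph1 cst) pbw_pclass /= mul1r addn0.
by rewrite exprS pbw_mul IHn pbw_pclass /= mul1r addnS.
Qed.

Lemma pbw_exp11 n phi d : pbw (repr (c11 ^+ n)) phi 0 0 0 d = phi 0%N 0%N 0%N (d + n)%N.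
Proof.
elim: n phi d => [|n IHn] phi d.
  by rewrite expr0 -(rmorph1 cst) pbw_pclass /= mul1r addn0.
by rewrite exprS pbw_mul IHn pbw_pclass /= mul1r subrr !mul0r addr0 addnS.
Qed.

Lemma dual_form_mono2 a c b d a' c' b' d' :
  dual_form a c b d (mono2 a' c' b' d') = ((a', c', b', d') == (a, c, b, d))%:R.
Proof.
by rewrite /dual_form /mono2 !pbw_mul pbw_exp11 pbw_exp01 pbw_exp10 pbw_exp00.
Qed.

Lemma dual_form_represents a c b d : exists phi : 'M[R]_N,
  @represents R q 2 r (dual_form a c b d) phi.
Proof.
exists (\matrix_(i, j) dual_form a c b d (cmon q (enum_val i) (enum_val j))).
split=> [x y z _ _|I J]; last by rewrite mxE !enum_rankK.
rewrite /dual_form -[y in LHS]pclassK -[z in LHS]pclassK -pclassM -pclassD.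
by rewrite pbw_pclass /= pbwZ.
Qed.

End PBW.

Lemma bw_n0J a c b d : n0 (unzip2 (bw a c b d)) = (a + c)%N.
Proof.
by rewrite /n0 /bw /unzip2 !map_cat !map_nseq !count_cat !count_nseq /=; lia.
Qed.

Lemma bw_n0I a c b d : n0 (unzip1 (bw a c b d)) = (a + b)%N.
Proof.
by rewrite /n0 /bw /unzip1 !map_cat !map_nseq !count_cat !count_nseq /=; lia.
Qed.
Lemma bw_n1I a c b d : n1 (unzip1 (bw a c b d)) = (c + d)%N.
Proof.
by rewrite /n1 /bw /unzip1 !map_cat !map_nseq !count_cat !count_nseq /=; lia.
Qed.
Lemma bw_ups a c b d : ups (bw a c b d) = c.
Proof. by rewrite /ups /bw !count_cat !count_nseq /=; lia. Qed.
Lemma bw_downs a c b d : downs (bw a c b d) = b.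
Proof. by rewrite /downs /bw !count_cat !count_nseq /=; lia. Qed.

(** * The operators of E^(m), F^(m) and the torus *)

Section Operators.
Variables (R : fieldType) (v : R).
Local Notation q := (v ^+ 2).
Implicit Types (x y : wvec R) (I J K : seq 'I_2).

Definition dop (w : nat -> nat -> R) x : wvec R := fun I => w (n0 I) (n1 I) * x I.
(* The actions of E^(m) and F^(m) on tensor space. *)
Definition Eop m x : wvec R :=
  fun I => v ^+ (m * m) / v ^+ (m * n0 I) * divop 0 q m x I.
Definition Fop m x : wvec R :=
  fun I => v ^+ (m * m + 2 * m * n0 I) / v ^+ (m * n1 I) * divop 1 q^-1 m x I.

Lemma divop0_dop t m w x I :
  divop 0 t m (dop w x) I = w (n0 I - m)%N (n1 I + m)%N * divop 0 t m x I.
Proof.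
rewrite -divopZ; apply: divop_eq => K sK; rewrite -/(n0 K) -/(n0 I) => cK.
rewrite /dop -cK addnK; congr (w _ _ * _).
by have := size_count2 K; have := size_count2 I; rewrite -/(n0 _) -/(n1 _) -/(n0 _) -/(n1 _); lia.
Qed.

Lemma divop1_dop t m w x I :
  divop 1 t m (dop w x) I = w (n0 I + m)%N (n1 I - m)%N * divop 1 t m x I.
Proof.
rewrite -divopZ; apply: divop_eq => K sK; rewrite -/(n1 K) -/(n1 I) => cK.
rewrite /dop -cK addnK; congr (w _ _ * _).
by have := size_count2 K; have := size_count2 I; rewrite -/(n0 _) -/(n1 _) -/(n0 _) -/(n1 _); lia.
Qed.

Lemma divop0_gt t m x I : (n0 I < m)%N -> divop 0 t m x I = 0.
Proof. exact: divop_gt. Qed.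
Lemma divop1_gt t m x I : (n1 I < m)%N -> divop 1 t m x I = 0.
Proof. exact: divop_gt. Qed.

Lemma Eop_dop m w x I :
  Eop m (dop w x) I = w (n0 I - m)%N (n1 I + m)%N * Eop m x I.
Proof. by rewrite /Eop divop0_dop mulrCA. Qed.

Lemma Fop_dop m w x I :
  Fop m (dop w x) I = w (n0 I + m)%N (n1 I - m)%N * Fop m x I.
Proof. by rewrite /Fop divop1_dop mulrCA. Qed.

Lemma lop_dop w : lop (dop w).
Proof.
split=> [a x y I|x y I h]; first by rewrite /dop; ring.
by rewrite /dop h.
Qed.

Lemma lop_Eop m : lop (Eop m).
Proof. exact: (lop_comp (lop_dop (fun a b => v ^+ (m * m) / v ^+ (m * a))) (lop_divop _ _ _)). Qed.

Lemma lop_Fop m : lop (Fop m).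
Proof.
exact: (lop_comp (lop_dop (fun a b => v ^+ (m * m + 2 * m * a) / v ^+ (m * b)))
  (lop_divop _ _ _)).
Qed.

Lemma hecke_dop p w x I : hecke q p (dop w x) I = dop w (hecke q p x) I.
Proof.
elim: p w x I => [|p IHp] w x [|i I] /=; rewrite /dop ?mulr0 //.
  case: I => [|j I]; first by rewrite mulr0.
  have E : (n0 [:: j, i & I] = n0 [:: i, j & I]) * (n1 [:: j, i & I] = n1 [:: i, j & I]).
    by rewrite /n0 /n1 /= !addnA (addnC (j == 0%R)) (addnC (j == 1%R)).
  by rewrite !E; case: ifP => _; last case: ifP => _; ring.
rewrite -[RHS](IHp (fun a b => w ((i == 0%R) + a)%N ((i == 1%R) + b)%N)) //.
Qed.

Lemma hecke_comm_dop w : hecke_comm q (dop w).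
Proof. by move=> p x I _; rewrite hecke_dop. Qed.

Lemma hecke_comm_comp (D D' : wvec R -> wvec R) : lop D ->
  (forall x y I, (forall K, size K = size I -> x K = y K) -> D x I = D y I) ->
  hecke_comm q D -> hecke_comm q D' -> hecke_comm q (D \o D').
Proof.
move=> lD _ cD cD' p x I sI /=; rewrite -cD //; apply: lD.2 => K sK.
by rewrite cD' // sK.
Qed.

Hypothesis v0 : v != 0.

Lemma v0X n : v ^+ n != 0. Proof. by rewrite expf_neq0. Qed.
Hint Resolve v0X : core.

Lemma Eop_qschur r m : mxop r (Eop m) \in @qschur_pred R q 2 r.
Proof.
apply: hecke_comm_qschur => //; first exact: lop_Eop.
apply: (@hecke_comm_comp (dop (fun a b => v ^+ (m * m) / v ^+ (m * a)))).
- exact: lop_dop.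
- by have [_] := lop_dop (fun a b => v ^+ (m * m) / v ^+ (m * a)).
- exact: hecke_comm_dop.
- exact: divop_hecke.
Qed.

Lemma Fop_qschur r m : mxop r (Fop m) \in @qschur_pred R q 2 r.
Proof.
apply: hecke_comm_qschur => //; first exact: lop_Fop.
apply: (@hecke_comm_comp (dop (fun a b => v ^+ (m * m + 2 * m * a) / v ^+ (m * b)))).
- exact: lop_dop.
- by have [_] := lop_dop (fun a b => v ^+ (m * m + 2 * m * a) / v ^+ (m * b)).
- exact: hecke_comm_dop.
- exact: divop_hecke.
Qed.

Lemma dop_qschur r w : mxop r (dop w) \in @qschur_pred R q 2 r.
Proof.
by apply: hecke_comm_qschur => //; [exact: lop_dop | exact: hecke_comm_dop].
Qed.

Lemma divop0_bw t m a c b d : let w := bw a c b d in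
  divop 0 t m (wdelta R (unzip2 w)) (unzip1 w) = ((c == 0%N) && (b == m))%:R.
Proof.
rewrite /= /bw.
have Z a' u m' : divop a' u m' (fun=> 0 : R) = fun=> 0.
  by apply/funext=> I; exact: divop0v.
elim: a => [|a IHa]; last first.
  by rewrite /= !tlv_delta /=; case: m IHa => [|m] -> ; rewrite ?Z addr0.
case: c => [|c]; last by rewrite /= !tlv_delta /= Z mulr0.
rewrite /=; elim: b m => [|b IHb] m /=.
  case: m => [|m]; elim: d => [|d IHd] //=; rewrite !tlv_delta /= IHd ?mulr0 //.
  by rewrite expr0 mul1r.
by rewrite !tlv_delta /= Z add0r; case: m.
Qed.

Lemma divop1_bw t m a c b d : let w := bw a c b d in
  divop 1 t m (wdelta R (unzip2 w)) (unzip1 w)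
  = ((b == 0%N) && (c == m))%:R * t ^+ (m * a).
Proof.
rewrite /= /bw.
have Z a' u m' : divop a' u m' (fun=> 0 : R) = fun=> 0.
  by apply/funext=> I; exact: divop0v.
elim: a => [|a IHa]; last first.
  by rewrite /= !tlv_delta /= IHa mulrCA mulnS exprD.
rewrite muln0 expr0 mulr1 /=; elim: c m => [|c IHc] m /=; last first.
  by rewrite !tlv_delta /= Z add0r; case: m => [|m]; rewrite ?andbF //= IHc eqSS.
case: b => [|b]; last by rewrite /= !tlv_delta /= Z mulr0.
rewrite /=; elim: d => [|d IHd] /=; first by case: m.
rewrite !tlv_delta /= IHd; case: m {IHd} => [|m]; first by rewrite addr0.
by rewrite Z addr0.
Qed.

(** This value explains the powers of [v] in [Eop]: for m = 1 it is the coefficient [v ^ (- dexp A)]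
    with which [[A]] enters E_{12}(0, r). [Fop] is normalised in the same way. *)
Lemma ent_Eop r m a c b d : (a + c + b + d)%N = r ->
  ent (mxop r (Eop m)) (bw a c b d) = ((c == 0%N) && (b == m))%:R / v ^+ (m * a).
Proof.
move=> sr; rewrite ent_mxop ?size_bw // /Eop divop0_bw bw_n0I.
case: eqP => [_|_]; last by rewrite mulr0 mul0r.
case: eqP => [->|_]; last by rewrite mulr0 mul0r.
by rewrite mulnDr exprD; field; rewrite !v0X.
Qed.

Lemma ent_Fop r m a c b d : (a + c + b + d)%N = r ->
  ent (mxop r (Fop m)) (bw a c b d) = ((b == 0%N) && (c == m))%:R / v ^+ (m * d).
Proof.
move=> sr; rewrite ent_mxop ?size_bw // /Fop divop1_bw bw_n0I bw_n1I.
case: eqP => [->|_]; last by rewrite mul0r mulr0 mul0r.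
case: eqP => [->|_]; last by rewrite mul0r mulr0 mul0r.
by rewrite exprVn -exprM addn0 mulnDr -!mulnA !exprD; field; rewrite !v0X.
Qed.

Lemma ent_dop r w a c b d : (a + c + b + d)%N = r ->
  ent (mxop r (dop w)) (bw a c b d) = ((c == 0%N) && (b == 0%N))%:R * w a d.
Proof.
move=> sr; rewrite ent_mxop ?size_bw // /dop bw_n0I bw_n1I.
rewrite -(divop_0 0 1 (wdelta R _)) divop0_bw mulrC.
case: eqP => [->|]; last by rewrite !mul0r.
by case: eqP => [->|]; rewrite ?mul0r // addn0.
Qed.

End Operators.

Definition bwM (B : 'M[nat]_2) := bw (B 0 0) (B 1 0) (B 0 1) (B 1 1).

Definition M4 (a c b d : nat) : 'M[nat]_2 :=
  \matrix_(i, j) if i == 0 then if j == 0 then a else b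
                 else if j == 0 then c else d.

Lemma bwM_M4 a c b d : bwM (M4 a c b d) = bw a c b d.
Proof. by rewrite /bwM !mxE. Qed.

Lemma M4_eta (B : 'M[nat]_2) : M4 (B 0 0) (B 1 0) (B 0 1) (B 1 1) = B.
Proof.
by apply/matrixP => i j; rewrite mxE; elim/ord2_ind: i; elim/ord2_ind: j.
Qed.

Lemma M4_inj a c b d a' c' b' d' :
  (M4 a c b d == M4 a' c' b' d') = ((a, c, b, d) == (a', c', b', d')).
Proof.
apply/eqP/eqP => [/matrixP h|[-> -> -> ->] //].
by move: (h 0 0) (h 0 1) (h 1 0) (h 1 1); rewrite !mxE /= => -> -> -> ->.
Qed.

Lemma big_ord2 (T : Type) (idx : T) (op : Monoid.law idx) (F : 'I_2 -> T) :
  \big[op/idx]_i F i = op (F 0) (F 1).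
Proof.
rewrite !big_ord_recl big_ord0 Monoid.mulm1; congr (op (F _) (F _)).
exact: val_inj.
Qed.

Lemma msum_M4 a c b d : msum (M4 a c b d) = (a + c + b + d)%N.
Proof. by rewrite /msum !big_ord2 !mxE /=; lia. Qed.

Lemma dexp_M4 a c b d :
  dexp (M4 a c b d) = ((a * b + d * c)%N)%:Z - ((b * c)%N)%:Z.
Proof.
rewrite /dexp !big_ord2; congr (Posz _ - Posz _).
  rewrite !(big_mkcond (fun t : 'I_2 => (t < _)%N)) /= !big_ord2 /= !mxE /=.
  by lia.
rewrite !(big_mkcond (fun t : 'I_2 => (_ < t)%N)) /= !big_ord2 /=.
rewrite !(big_mkcond (fun t : 'I_2 => (t < _)%N)) /= !big_ord2 /= !mxE /=.
by lia.
Qed.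

(** * The dual basis and a spanning set of the q-Schur algebra *)

Section DualBasis.
Variables (R : fieldType) (v : R).
Hypothesis v0 : v != 0.
Local Notation q := (v ^+ 2).
Variable r : nat.
Local Notation N := #|{: r.-tuple 'I_2}|.
Local Notation S := (qschur q 2 r).

Lemma q0 : q != 0. Proof. exact: v0X. Qed.

Lemma qV0 : q^-1 != 0. Proof. by rewrite invr_neq0 // q0. Qed.

Lemma monoE B : mono v B = cword q (bwM B).
Proof. by rewrite cword_bw /mono !big_ord2. Qed.

Lemma val_mul (x y : S) : val (x * y) = val x *m val y.
Proof. by []. Qed.

Lemma val_cst (a : R) : val (a%:S : S) = a%:M. Proof. by []. Qed.

Lemma val_scale (a : R) (x : S) : val (a%:S * x) = a *: val x.
Proof. by rewrite val_mul val_cst mul_scalar_mx. Qed.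

(** The set from which [xi] is chosen contains the dual form of [A] provided by the PBW theorem, and
    every member of it has these entries. *)
Lemma xi_ent A B : msum A = r -> msum B = r ->
  ent (val (xi v r A : S)) (bwM B) = (A == B)%:R.
Proof.
move=> sA sB; have szB : size (bwM B) = r.
  by rewrite size_bw -sB -[B in RHS]M4_eta msum_M4.
have [f hf hm] : [set x : S | exists2 f, represents f (val x) &
    forall B : 'M[nat]_2, msum B = r -> f (mono v B) = (A == B)%:R]%classic (xi v r A).
  apply: xgetPex; have [phi hphi] := @dual_form_represents R q q0 r
    (A 0 0) (A 1 0) (A 0 1) (A 1 1).
  have qphi : phi \in @qschur_pred R q 2 r by apply/asboolP; exists (dual_form (A 0 0) (A 1 0) (A 0 1) (A 1 1)).
  exists (QSchur qphi); exists (dual_form (A 0 0) (A 1 0) (A 0 1) (A 1 1)) => // C _.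
  have E := M4_inj (C 0 0) (C 1 0) (C 0 1) (C 1 1) (A 0 0) (A 1 0) (A 0 1) (A 1 1).
  by rewrite monoE cword_bw dual_form_mono2 ?q0 // -E !M4_eta eq_sym.
by rewrite (represents_ent hf) // -monoE hm.
Qed.

Lemma br_ent A B : msum A = r -> msum B = r ->
  ent (val (br v r A : S)) (bwM B) = v ^ (- dexp B) * (A == B)%:R.
Proof.
move=> sA sB; rewrite /br val_scale /ent mxE -/(ent _ _) xi_ent //.
by case: eqP => [->|_] //; rewrite !mulr0.
Qed.

Lemma ent_sum (I : finType) (P : pred I) (F : I -> S) w :
  ent (val (\sum_(i | P i) F i)) w = \sum_(i | P i) ent (val (F i)) w.
Proof. by rewrite raddf_sum /ent summxE. Qed.

Lemma ent_scale a (x : S) w : ent (val (a%:S * x)) w = a * ent (val x) w.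
Proof. by rewrite val_scale /ent mxE. Qed.

Lemma ent_qschur_inj (x y : S) :
  (forall a c b d, (a + c + b + d)%N = r ->
     ent (val x) (bw a c b d) = ent (val y) (bw a c b d)) -> x = y.
Proof.
move=> h; apply/eqP; rewrite -subr_eq0; apply/eqP/val_inj.
rewrite raddf0; apply: (ent_bw_inj q0) => [|a c b d sr]; first exact: valP.
by rewrite raddfB /ent !mxE -!/(ent _ _) h // subrr.
Qed.

Lemma brA_ent (A : 'M[nat]_2) (j : 'rV[int]_2) a c b d :
  A 0 0 = 0%N -> A 1 1 = 0%N -> (a + c + b + d)%N = r ->
  ent (val (brA v r A j : S)) (bw a c b d) =
  ((c == A 1 0) && (b == A 0 1))%:R * (v ^ (a%:Z * j 0 0 + d%:Z * j 0 1))
  * v ^ (- dexp (M4 a c b d)).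
Proof.
move=> A0 A1 sr; have sB : msum (M4 a c b d) = r by rewrite msum_M4.
rewrite /brA ent_sum.
have E (e : 'rV['I_r.+1]_2) : A + diag_mx (map_mx val e) =
    M4 (e 0 0) (A 1 0) (A 0 1) (e 0 1).
  apply/matrixP => i k; rewrite !mxE.
  by elim/ord2_ind: i; elim/ord2_ind: k; rewrite /= ?A0 ?A1 ?addr0 ?add0r.
under eq_bigr => e se.
  rewrite ent_scale -bwM_M4 br_ent ?(eqP se) // E M4_inj !big_ord2 /=.
  over.
case: (boolP ((c == A 1 0) && (b == A 0 1))) => [/andP[/eqP ec /eqP eb]|h]; last first.
  rewrite !mul0r big1 // => e _; rewrite !xpair_eqE.
  rewrite (eq_sym (A 1 0)) (eq_sym (A 0 1)).
  by case: eqP h => [->|]; case: eqP => [->|]; rewrite ?andbF ?andFb ?mulr0 //= !mulr0.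
have la : (a < r.+1)%N by lia.
have ld : (d < r.+1)%N by lia.
pose e0 : 'rV['I_r.+1]_2 := \row_i if i == 0 then Ordinal la else Ordinal ld.
have sum0 : msum (A + diag_mx (map_mx val e0)) == r.
  by rewrite E !mxE /= msum_M4 -ec -eb sr.
rewrite (bigD1 e0) //= big1 => [|e /andP[_ ne]]; last first.
  case: eqP => [[ha _ _ hd]|_]; last by rewrite !mulr0.
  case/eqP: ne; apply/rowP => i; rewrite mxE; apply: val_inj.
  by elim/ord2_ind: i; rewrite /= ?ha ?hd.
by rewrite !mxE /= ec eb eqxx addr0 mulr1 mul1r.
Qed.

Lemma brA_E : val (brA v r (delta_mx 0 1) 0 : S) = mxop r (Eop v 1).
Proof.
have -> : mxop r (Eop v 1) = val (QSchur (Eop_qschur v0 r 1)) by [].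
congr val; apply: ent_qschur_inj => a c b d sr.
rewrite brA_ent ?mxE // ent_Eop // dexp_M4 /= !mulr0 addr0 expr0z mulr1 mul1n.
case: eqP => [->|_]; last by rewrite !mul0r.
case: eqP => [->|_]; last by rewrite !mul0r.
by rewrite muln0 muln1 muln0 addn0 subr0 -exprnN mul1r.
Qed.

Lemma brA_F : val (brA v r (delta_mx 1 0) 0 : S) = mxop r (Fop v 1).
Proof.
have -> : mxop r (Fop v 1) = val (QSchur (Fop_qschur v0 r 1)) by [].
congr val; apply: ent_qschur_inj => a c b d sr.
rewrite brA_ent ?mxE // ent_Fop // dexp_M4 /= !mulr0 addr0 expr0z mulr1 mul1n.
rewrite andbC; case: eqP => [->|_]; last by rewrite !mul0r.
case: eqP => [->|_]; last by rewrite !mul0r.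
by rewrite muln0 muln1 add0n subr0 -exprnN mul1r.
Qed.

Definition wK (j0 j1 : int) (a b : nat) : R := v ^ (a%:Z * j0 + b%:Z * j1).

Lemma brA_K (j : 'rV[int]_2) :
  val (brA v r 0 j : S) = mxop r (dop (wK (j 0 0) (j 0 1))).
Proof.
have -> : mxop r (dop (wK (j 0 0) (j 0 1)))
  = val (QSchur (dop_qschur v0 r (wK (j 0 0) (j 0 1)))) by [].
congr val; apply: ent_qschur_inj => a c b d sr.
rewrite brA_ent ?mxE // ent_dop // dexp_M4 /=.
case: eqP => [->|_]; last by rewrite !mul0r.
case: eqP => [->|_]; last by rewrite !mul0r.
by rewrite !muln0 subr0 oppr0 expr0z mulr1.
Qed.

Definition Xop (b c n : nat) : wvec R -> wvec R :=
  Eop v b \o Fop v c \o dop (fun a _ => (a == n)%:R).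

Lemma mxop_Xop b c n : mxop r (Xop b c n) =
  mxop r (Eop v b) *m mxop r (Fop v c) *m mxop r (dop (fun a _ => (a == n)%:R)).
Proof.
rewrite mxopM; last exact: lop_Eop.
by rewrite mxopM; last exact: lop_comp (lop_Eop v b) (lop_Fop v c).
Qed.

Lemma Xop_qschur b c n : mxop r (Xop b c n) \in @qschur_pred R q 2 r.
Proof.
rewrite mxop_Xop; apply: qschur_mulmx_subproof; last exact: dop_qschur.
by apply: qschur_mulmx_subproof; [exact: Eop_qschur|exact: Fop_qschur].
Qed.

Lemma EFop_divop b c x I : exists2 s : R, s != 0 &
  Eop v b (Fop v c x) I = s * divop 0 q b (divop 1 q^-1 c x) I.
Proof.
have -> : Fop v c x = dop (fun a d => v ^+ (c * c + 2 * c * a) / v ^+ (c * d))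
    (divop 1 q^-1 c x) by [].
rewrite Eop_dop mulrA; eexists; last by [].
by rewrite !mulf_neq0 // ?invr_neq0 // v0X.
Qed.

Lemma divop2_support b c x I :
  (forall K, size K = size I -> (n0 K + b = n0 I + c)%N -> x K = 0) ->
  divop 0 q b (divop 1 q^-1 c x) I = 0.
Proof.
move=> h; rewrite -[RHS](divop0v 0 q b I); apply: divop_eq => K sK.
rewrite -/(n0 K) -/(n0 I) => cK.
rewrite -[RHS](divop0v 1 q^-1 c K); apply: divop_eq => L sL.
rewrite -/(n1 K) -/(n1 L) => cL; apply: h; first by rewrite sL.
have := size_count2 K; have := size_count2 L; rewrite -/(n0 _) -/(n1 _) -/(n0 _) -/(n1 _).
by lia.
Qed.

Lemma lopZ (D : wvec R -> wvec R) a x I : lop D -> D (fun K => a * x K) I = a * D x I.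
Proof.
move=> lD; rewrite -[RHS]addr0 -(lop0 I lD) -lD.1; congr (D _ I).
by apply/funext => K; rewrite addr0.
Qed.

Lemma Xop_delta b c n J I : exists2 s : R, s != 0 & Xop b c n (wdelta R J) I =
  s * ((n0 J == n)%:R * divop 0 q b (divop 1 q^-1 c (wdelta R J)) I).
Proof.
have [s s0 e] := EFop_divop b c (wdelta R J) I; exists s => //.
rewrite mulrCA -e /Xop -(@lopZ (Eop v b \o Fop v c)) /=; last first.
  exact: lop_comp (lop_Eop v b) (lop_Fop v c).
congr (Eop v b (Fop v c _) I); apply/funext => K; rewrite /dop /wdelta /=.
by case: (K =P J) => [->|]; rewrite ?mulr0.
Qed.

Lemma ent_Xop_lt b c n a' c' b' d' : (a' + c' + b' + d')%N = r -> (c < c')%N ->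
  ent (mxop r (Xop b c n)) (bw a' c' b' d') = 0.
Proof.
move=> sr lt; rewrite ent_mxop ?size_bw //.
have [s _ ->] := Xop_delta b c n (unzip2 (bw a' c' b' d')) (unzip1 (bw a' c' b' d')).
have [E _] := divop2_up b c (bw a' c' b' d') q0 qV0.
by rewrite E ?mulr0 // bw_ups.
Qed.

Lemma ent_Xop_eq b c n a' b' d' : (a' + c + b' + d')%N = r ->
  (ent (mxop r (Xop b c n)) (bw a' c b' d') == 0) = ~~ ((b == b') && (n == a' + c)%N).
Proof.
move=> sr; rewrite ent_mxop ?size_bw //.
have [s s0 ->] := Xop_delta b c n (unzip2 (bw a' c b' d')) (unzip1 (bw a' c b' d')).
rewrite !mulf_eq0 (negPf s0) /= bw_n0J (eq_sym n).
case: (_ =P n) => [_|_]; last by rewrite andbF eqxx.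
rewrite /= oner_eq0 andbT /=; case: (b =P b') => [->|bb'].
  by apply/negbTE/(divop2_up _ _ _ q0 qV0).2; rewrite ?bw_ups ?bw_downs.
apply/eqP/divop2_support => K sK; rewrite bw_n0I => cK; rewrite /wdelta.
case: eqP => [eK|//]; move: cK; rewrite eK bw_n0J => cK.
by case: bb'; lia.
Qed.

(* The products E^(b) F^(c) k_mu span: on the words that index the basis of
   monomials they are triangular with respect to c. *)
Lemma qschur_span (P : 'M[R]_N -> Prop) :
  (forall a X Y, P X -> P Y -> P (a *: X + Y)) -> P 0 ->
  (forall b c n, P (mxop r (Xop b c n))) ->
  forall phi, phi \in @qschur_pred R q 2 r -> P phi.
Proof.
move=> Plin P0 PX.
(* Entries are cleared level by level, from the largest exponent of [c10] downwards. An ordered word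
   of length [r] never has exponent r + 1, so the start is free. *)
suff H c phi : phi \in @qschur_pred R q 2 r ->
    (forall a c' b d, (a + c' + b + d)%N = r -> (c <= c')%N ->
       ent phi (bw a c' b d) = 0) -> P phi.
  by move=> phi hphi; apply: (H r.+1) => // a c b d sr; lia.
elim: c phi => [|c IHc] phi hphi h0.
  by rewrite (ent_bw_inj q0 hphi) // => a c b d sr; apply: h0.
(* On level [c] the products are diagonal: [Xop b c (a + c)] has a nonzero entry only at the word
   with exponents a and b. Dividing by this entry clears level [c], and the higher levels stay zero
   by [ent_Xop_lt]. *)
pose co (ab : 'I_r.+1 * 'I_r.+1) : R :=
  if (ab.1 + c + ab.2 <= r)%N then
    ent phi (bw ab.1 c ab.2 (r - (ab.1 + c + ab.2)))
    / ent (mxop r (Xop ab.2 c (ab.1 + c))) (bw ab.1 c ab.2 (r - (ab.1 + c + ab.2)))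
  else 0.
pose Y := \sum_ab co ab *: mxop r (Xop ab.2 c (ab.1 + c)).
have PY : P Y.
  by rewrite /Y; elim/big_rec: _ => // ab X _ PX'; apply: Plin.
have QY : Y \in @qschur_pred R q 2 r.
  rewrite /Y; apply: rpred_sum => ab _.
  exact/qschur_scalemx_subproof/Xop_qschur.
have -> : phi = 1 *: (phi - Y) + Y by rewrite scale1r subrK.
apply: Plin => //; apply: IHc => [|a c' b d sr cc'].
  exact: qschur_addmx_subproof.
have -> : ent (phi - Y) (bw a c' b d) = ent phi (bw a c' b d) -
    \sum_ab co ab * ent (mxop r (Xop ab.2 c (ab.1 + c))) (bw a c' b d).
  by rewrite /ent !mxE summxE; congr (_ - _); apply: eq_bigr => ab _; rewrite mxE.
move: cc'; rewrite leq_eqVlt => /orP[/eqP cc'|lt]; last first.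
  rewrite h0 // big1 ?subr0 // => ab _; rewrite ent_Xop_lt ?mulr0 //.
have la : (a < r.+1)%N by lia.
have lb : (b < r.+1)%N by lia.
rewrite -cc' in sr *; rewrite (bigD1 (Ordinal la, Ordinal lb)) //= big1 => [|[a1 b1] ne].
  have ed : (r - (a + c + b) = d)%N by lia.
  have le : (a + c + b <= r)%N by lia.
  rewrite /co /= le ed addr0 divfK ?subrr //.
  by rewrite ent_Xop_eq // !eqxx.
rewrite /= (_ : ent _ _ = 0) ?mulr0 //; apply/eqP; rewrite ent_Xop_eq //.
apply: contra ne => /andP[/eqP e1 /eqP /addIn e2]; apply/eqP.
by congr pair; apply: val_inj.
Qed.

End DualBasis.

(** * The morphisms zeta_r *)

Section Lift.
Variables (R : comNzRingType) (G : Type) (rel : term R G -> term R G -> Prop).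
Variables (B : algebraType R) (g : G -> B).

Fixpoint teval (t : term R G) : B :=
  match t with
  | Var h => g h
  | Cst a => a%:S
  | Add s t => teval s + teval t
  | Mul s t => teval s * teval t
  end.

Hypothesis relP : forall s t, rel s t -> teval s = teval t.

Lemma teval_cong s t : cong rel s t -> teval s = teval t.
Proof.
elim=> {s t} //=.
- by move=> t s u _ -> _ ->.
- by move=> s s' t t' _ -> _ ->.
- by move=> s s' t t' _ -> _ ->.
- by move=> *; rewrite addrA.
- by move=> *; rewrite addrC.
- by move=> *; rewrite rmorph0 add0r.
- by move=> *; rewrite rmorphN rmorph1 mulN1r addNr rmorph0.
- by move=> *; rewrite mulrA.
- by move=> *; rewrite rmorph1 mul1r.
- by move=> *; rewrite rmorph1 mulr1.
- by move=> *; rewrite mulrDl.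
- by move=> *; rewrite mulrDr.
- by move=> *; rewrite rmorphD.
- by move=> *; rewrite rmorphM.
- by move=> *; rewrite cst_central.
Qed.

Definition plift (x : palg rel) : B := teval (repr x).

Lemma plift_pclass t : plift (pclass rel t) = teval t.
Proof. exact/teval_cong/repr_pclass. Qed.

Lemma plift_alghom : is_alghom plift.
Proof.
have pD x y : plift (x + y) = plift x + plift y.
  by rewrite -[x]pclassK -[y]pclassK -pclassD !plift_pclass.
split=> [x y||a].
- by apply: (canRL (addrK _)); rewrite -pD subrK.
- split=> [|x y]; first by rewrite -(rmorph1 cst) plift_pclass /= rmorph1.
  by rewrite -[x]pclassK -[y]pclassK -pclassM !plift_pclass.
- by rewrite plift_pclass.
Qed.

End Lift.

Section Relations.
Variables (R : fieldType) (v : R).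
Hypothesis v0 : v != 0.
Local Notation q := (v ^+ 2).
Variable r : nat.
Local Notation S := (qschur q 2 r).
Hint Resolve v0X : core.

Definition qE m : S := QSchur (Eop_qschur v0 r m).
Definition qF m : S := QSchur (Fop_qschur v0 r m).
Definition qD w : S := QSchur (dop_qschur v0 r w).

Lemma qD_mul w w' : qD w * qD w' = qD (fun a b => w a b * w' a b).
Proof.
apply: val_inj; rewrite [LHS]mxopM; last exact: lop_dop.
by apply: mxop_ext => x I _; rewrite /dop /= mulrA.
Qed.

Lemma qD_ext w w' : (forall a b, (a + b)%N = r -> w a b = w' a b) -> qD w = qD w'.
Proof.
move=> h; apply: val_inj; apply: mxop_ext => x I sI.
by rewrite /dop h // size_count2.
Qed.

Lemma qD1 : qD (fun _ _ => 1) = 1.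
Proof.
by apply: val_inj; rewrite -[RHS]mxop_id; apply: mxop_ext => x I _; rewrite /dop mul1r.
Qed.

Lemma qD_scale a w : a%:S * qD w = qD (fun b c => a * w b c).
Proof.
apply: val_inj; rewrite val_scale; apply/matrixP => i j.
by rewrite !mxE /dop mulrA.
Qed.

Lemma qD_sub w w' : qD w - qD w' = qD (fun b c => w b c - w' b c).
Proof. by apply: val_inj; apply/matrixP => i j; rewrite !mxE /dop mulrBl. Qed.

Lemma wK_mul i j i' j' : (fun a b => wK v i j a b * wK v i' j' a b) = wK v (i + i') (j + j').
Proof.
apply/funext => a; apply/funext => b; rewrite /wK -expfzDr //.
by congr (_ ^ _); ring.
Qed.

Definition wKi (i : 'I_2) (z : int) :=
  wK v (if i == 0 then z else 0) (if i == 0 then 0 else z).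

Lemma qK_E i z : qD (wKi i z) * qE 1 = (v ^ (rootexp i * z))%:S * (qE 1 * qD (wKi i z)).
Proof.
apply: val_inj; rewrite val_scale [LHS]mxopM; last exact: lop_dop.
rewrite [val (qE 1 * _)]mxopM; last exact: lop_Eop.
apply/matrixP => a b; rewrite !mxE /=; move: (wd a) (wdelta R (wd b)) => I x.
(* The truncated difference [n0 I - 1] is the right weight only if [I] contains the letter 0;
   otherwise E has value 0 at [I]. *)
rewrite Eop_dop mulrA {1}/dop; case: (ltnP 0 (n0 I)) => [lt|le]; last first.
  by rewrite /Eop divop0_gt ?mulr0.
congr (_ * _); rewrite -(subnK lt) addnK /wKi /wK -expfzDr //; congr (_ ^ _).
by rewrite /rootexp; elim/ord2_ind: i => /=; rewrite !PoszD; ring.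
Qed.

Lemma qK_F i z : qD (wKi i z) * qF 1 = (v ^ (- rootexp i * z))%:S * (qF 1 * qD (wKi i z)).
Proof.
apply: val_inj; rewrite val_scale [LHS]mxopM; last exact: lop_dop.
rewrite [val (qF 1 * _)]mxopM; last exact: lop_Fop.
apply/matrixP => a b; rewrite !mxE /=; move: (wd a) (wdelta R (wd b)) => I x.
rewrite Fop_dop mulrA {1}/dop; case: (ltnP 0 (n1 I)) => [lt|le]; last first.
  by rewrite /Fop divop1_gt ?mulr0.
congr (_ * _); rewrite -(subnK lt) addnK /wKi /wK -expfzDr //; congr (_ ^ _).
by rewrite /rootexp; elim/ord2_ind: i => /=; rewrite !PoszD; ring.
Qed.

Definition qi (n : nat) : R := (v ^+ n - v ^- n) / (v - v^-1).

Hypothesis vV : v - v^-1 != 0.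

Lemma q1 : q != 1.
Proof.
apply: contra vV => /eqP h; rewrite subr_eq0; apply/eqP.
by apply: (mulfI v0); rewrite divff // -expr2.
Qed.

Lemma sum_q n : \sum_(s < n.+1) q ^+ s = v ^+ n * qi n.+1.
Proof.
have v0n m : v ^+ m != 0 by exact: v0X.
have q1' : v * v - 1 != 0 by rewrite subr_eq0 -expr2 q1.
elim: n => [|n IHn]; first by rewrite big_ord1 /qi !expr0 expr1 mul1r divff.
rewrite big_ord_recr /= IHn /qi -exprM mulnC muln2 -addnn.
rewrite ?(exprS, exprD).
by field; rewrite v0n v0 /= q1'.
Qed.

Lemma sum_qV n : \sum_(s < n.+1) q^-1 ^+ s = qi n.+1 / v ^+ n.
Proof.
have v0n m : v ^+ m != 0 by exact: v0X.
have q1' : v * v - 1 != 0 by rewrite subr_eq0 -expr2 q1.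
elim: n => [|n IHn]; first by rewrite big_ord1 /qi !expr0 expr1 divr1 divff.
rewrite big_ord_recr /= IHn /qi exprVn -exprM mulnC muln2 -addnn.
rewrite ?(exprS, exprD).
by field; rewrite v0n v0 /= q1'.
Qed.

Lemma Eop_mul m x I : Eop v 1 (Eop v m x) I = qi m.+1 * Eop v m.+1 x I.
Proof.
have v0n n : v ^+ n != 0 by exact: v0X.
have -> : Eop v m x = dop (fun a _ => v ^+ (m * m) / v ^+ (m * a))
    (divop 0 q m x) by [].
rewrite Eop_dop /Eop divop_comp sum_q.
case: (ltnP m (n0 I)) => [lt|le]; last by rewrite divop0_gt ?mulr0.
have [k ->] : exists k, n0 I = k.+1 by exists (n0 I).-1; lia.
rewrite subn1 /= mulSn muln1 mul1n !mulnS !mulSn !exprD !exprS ?expr1.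
by field; rewrite !v0n v0.
Qed.

Lemma Fop_mul m x I : Fop v 1 (Fop v m x) I = qi m.+1 * Fop v m.+1 x I.
Proof.
have v0n n : v ^+ n != 0 by exact: v0X.
have -> : Fop v m x = dop (fun a b => v ^+ (m * m + 2 * m * a) / v ^+ (m * b))
    (divop 1 q^-1 m x) by [].
rewrite Fop_dop /Fop divop_comp sum_qV.
case: (ltnP m (n1 I)) => [lt|le]; last by rewrite divop1_gt ?mulr0.
have [k ->] : exists k, n1 I = k.+1 by exists (n1 I).-1; lia.
have -> : (m * m + 2 * m * (n0 I + 1) = m * m + m + m + 2 * m * n0 I)%N by lia.
have -> : (m.+1 * m.+1 + 2 * m.+1 * n0 I
   = m * m + m + m + 1 + 2 * m * n0 I + n0 I + n0 I)%N by lia.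
have -> : (1 * 1 + 2 * 1 * n0 I = 1 + n0 I + n0 I)%N by lia.
rewrite subn1 /= mul1n !mulnS !mulSn !exprD !exprS ?expr1.
by field; rewrite !v0n v0.
Qed.

Lemma qE_mul m : qE 1 * qE m = (qi m.+1)%:S * qE m.+1.
Proof.
apply: val_inj; rewrite val_scale [LHS]mxopM; last exact: lop_Eop.
by apply/matrixP => a b; rewrite !mxE /= Eop_mul.
Qed.

Lemma qF_mul m : qF 1 * qF m = (qi m.+1)%:S * qF m.+1.
Proof.
apply: val_inj; rewrite val_scale [LHS]mxopM; last exact: lop_Fop.
by apply/matrixP => a b; rewrite !mxE /= Fop_mul.
Qed.

Lemma qE0 : qE 0 = 1.
Proof.
apply: val_inj; rewrite -[RHS]mxop_id; apply: mxop_ext => x I _.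
by rewrite /Eop divop_0 !mul0n expr0 divr1 mul1r.
Qed.

Lemma qF0 : qF 0 = 1.
Proof.
apply: val_inj; rewrite -[RHS]mxop_id; apply: mxop_ext => x I _.
by rewrite /Fop divop_0 !mul0n add0n expr0 divr1 mul1r.
Qed.

Lemma qEF : qE 1 * qF 1 - qF 1 * qE 1 =
  ((v - v^-1)^-1)%:S * (qD (wKi 0 1) * qD (wKi 1 (-1)) - qD (wKi 1 1) * qD (wKi 0 (-1))).
Proof.
rewrite !qD_mul qD_sub qD_scale.
apply: val_inj; rewrite (_ : val (_ - _) = val (qE 1) *m val (qF 1) - val (qF 1) *m val (qE 1)) //.
rewrite [X in X - _]mxopM; last exact: lop_Eop.
rewrite [X in _ - X]mxopM; last exact: lop_Fop.
apply/matrixP => a b; rewrite !mxE /=; move: (wd a) (wdelta R (wd b)) => I x.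
have v0n n : v ^+ n != 0 by exact: v0X.
have := divop_commutator x I (q0 v0) q1 => /(canRL (subrK _)) E.
have -> : Fop v 1 x = dop (fun a b => v ^+ (1 + 2 * a) / v ^+ b)
    (divop 1 q^-1 1 x) by apply/funext => K; rewrite /Fop /dop !mul1n !muln1.
rewrite Eop_dop /Eop.
have -> : (fun I0 => v ^+ (1 * 1) / v ^+ (1 * n0 I0) * divop 0 q 1 x I0) =
   dop (fun a _ => v / v ^+ a) (divop 0 q 1 x).
  by apply/funext => K; rewrite /dop !mul1n expr1.
rewrite Fop_dop /Fop /dop.
have q1' : v * v - 1 != 0 by rewrite subr_eq0 -expr2 q1.
rewrite /wKi /wK /= !mulr0 !mulr1 !mulrN1 !addr0 !add0r.
rewrite -!exprnP -!exprnN !mul1n !muln1.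
case: (ltnP 0 (n0 I)) => [lt|le]; last first.
  have n00 : n0 I = 0%N by lia.
  rewrite divop0_gt // in E *.
  have E' : divop 1 (v ^- 2) 1 (divop 0 q 1 x) I =
      - (1 - q ^+ n1 I / q ^+ n0 I) / (q - 1) * x I.
    apply: (mulfI (q0 v0)); apply: (addrI (q * (1 - q ^+ n1 I / q ^+ n0 I) / (q - 1) * x I)).
    by rewrite -E; ring.
  rewrite E' n00 !muln0 !addn0 -exprM mulnC muln2 -addnn expr0 expr1 !exprD !exprS.
  by field; rewrite oner_neq0 v0n v0 /= q1'.
have [k nk] : exists k, n0 I = k.+1 by exists (n0 I).-1; lia.
rewrite E nk subn1 /= -!exprM ![(2 * _)%N]mulnC !muln2 -!addnn.
rewrite ?(addSn, addnS, addn0, add0n) ?(exprS, exprD).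
by field; rewrite !v0n v0 /= q1'.
Qed.

End Relations.

(** * Quantum binomial coefficients *)

Section QuantumBinomial.
Variables (R : fieldType) (v : R).
Hypothesis v0 : v != 0.

(** The balanced Gaussian binomial, by Pascal's rule: the product formula has denominators
    [v ^+ s - v ^- s] that vanish at a root of unity, whereas this recursion specialises. *)
Fixpoint qbin (n t : nat) : R :=
  match n, t with
  | _, 0%N => 1
  | 0%N, _ => 0
  | n'.+1, t'.+1 => v ^+ t * qbin n' t + v ^+ t' / v ^+ n' * qbin n' t'
  end.

Lemma qbin_gt n t : (n < t)%N -> qbin n t = 0.
Proof.
elim: n t => [|n IHn] [|t] //= lt.
by rewrite !IHn ?mulr0 ?addr0 // ltnW.
Qed.

Lemma qbinnn n : qbin n n = 1.
Proof.
elim: n => //= n IHn; rewrite qbin_gt // mulr0 add0r IHn mulr1 divff //.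
exact: v0X.
Qed.

Lemma qbinE n t : (forall s, (0 < s)%N -> v ^+ s - v ^- s != 0) ->
  \prod_(1 <= s < t.+1) ((v ^+ s - v ^- s)^-1 *
     (v ^ (n%:Z + 1 - s%:Z) - v ^ (s%:Z - 1 - n%:Z))) = qbin n t.
Proof.
move=> nz.
pose F n t := \prod_(1 <= s < t.+1) ((v ^+ s - v ^- s)^-1 *
     (v ^ (n%:Z + 1 - s%:Z) - v ^ (s%:Z - 1 - n%:Z))).
have F0 m : F m 0%N = 1 by rewrite /F big_geq.
have Fr m u : F m u.+1 = F m u * ((v ^+ u.+1 - v ^- u.+1)^-1 *
     (v ^ (m%:Z - u%:Z) - v ^ (u%:Z - m%:Z))).
  rewrite /F big_nat_recr //=; congr (_ * (_ * (v ^ _ - v ^ _))); lia.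
(* The absorption rule. Together with [Fr] it expresses all three terms of Pascal's rule through
   [F n t]. *)
have FS m u : F m.+1 u.+1 = F m u * ((v ^+ u.+1 - v ^- u.+1)^-1 *
     (v ^ (m.+1%:Z) - v ^ (- m.+1%:Z))).
  elim: u => [|u IHu]; last first.
    rewrite Fr IHu Fr.
    have -> : m.+1%:Z - u.+1%:Z = m%:Z - u%:Z by lia.
    have -> : u.+1%:Z - m.+1%:Z = u%:Z - m%:Z by lia.
    by ring.
  by rewrite Fr !F0 !mul1r; congr (_ * (v ^ _ - v ^ _)); lia.
rewrite -/(F n t); elim: n t => [|n IHn] [|t]; rewrite ?F0 //.
  rewrite /= Fr; elim: t => [|t IHt]; first by rewrite subrr mulr0 mulr0.
  by rewrite Fr IHt mul0r.
rewrite FS /= -!IHn Fr.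
have nt := nz t.+1 isT.
have -> : v ^+ t / v ^+ n = v ^ (t%:Z - n%:Z) by rewrite expfzDr // -exprnP -exprnN.
have -> : v ^ n.+1%:Z = v ^+ t.+1 * v ^ (n%:Z - t%:Z).
  by rewrite exprnP -expfzDr //; congr (_ ^ _); lia.
have -> : v ^ (- n.+1%:Z) = v ^- t.+1 * v ^ (t%:Z - n%:Z).
  by rewrite exprnN -expfzDr //; congr (_ ^ _); lia.
move: (v ^ (n%:Z - t%:Z)) (v ^ (t%:Z - n%:Z)) (v ^+ t.+1) nt => A B C nt.
have e : (C - C^-1)^-1 * (C * A - C^-1 * B) = C * ((C - C^-1)^-1 * (A - B)) + B.
  by apply: (mulfI nt); rewrite mulVKf // mulrDr mulrCA mulVKf //; ring.
by rewrite e; ring.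
Qed.

End QuantumBinomial.

(** * Specialisation at the root of unity *)

Section Specialization.
Variables (k : fieldType) (eps : k).
Hypothesis eps0 : eps != 0.

Lemma vv0 : vv != 0.
Proof. by rewrite tofrac_eq0 polyX_eq0. Qed.

(** Cross-multiplication turns an equality of fractions into one of integral polynomials, since Z[X]
    embeds into the field; that equality can be evaluated at [eps]. *)
Lemma laurent_inj m P m' P' : laurent m P = laurent m' P' ->
  laurent_at eps m P = laurent_at eps m' P'.
Proof.
rewrite /laurent /laurent_at => /eqP.
have vX n : vv ^+ n = tofrac ('X^n : {poly rat}) by rewrite rmorphXn.
rewrite eqr_div ?v0X ?vv0 // !vX -!rmorphM /= => /eqP/eqP; rewrite tofrac_eq => /eqP e.
have : P * 'X^m' = P' * 'X^m.
  apply: (@map_inj_poly _ _ (intr : int -> rat)) => //; first exact: intr_inj.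
  by rewrite !rmorphM /= !map_polyXn.
move/(congr1 (fun Q : {poly int} => (map_poly intr Q).[eps])).
rewrite !rmorphM /= !map_polyXn !hornerM !hornerXn => e'.
by apply/eqP; rewrite eqr_div ?v0X // e'.
Qed.

Lemma spec_unique a b b' : specializes eps a b -> specializes eps a b' -> b = b'.
Proof. by move=> [m [P [-> ->]]] [m' [P' [e ->]]]; apply: laurent_inj. Qed.

Lemma spec_laurent a : is_laurent a -> exists b, specializes eps a b.
Proof. by move=> [m [P ->]]; exists (laurent_at eps m P), m, P. Qed.

Lemma specD a b a' b' : specializes eps a b -> specializes eps a' b' ->
  specializes eps (a + a') (b + b').
Proof.
move=> [m [P [-> ->]]] [m' [P' [-> ->]]].
exists (m + m')%N, (P * 'X^m' + P' * 'X^m); rewrite /laurent /laurent_at.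
have vX n : tofrac ('X^n : {poly rat}) = vv ^+ n by rewrite rmorphXn.
rewrite !(rmorphD, rmorphM) /= !map_polyXn !vX.
rewrite hornerD !hornerM !hornerXn !exprD.
have e (F : fieldType) (x y z w : F) : z != 0 -> w != 0 ->
    x / z + y / w = (x * w + y * z) / (z * w).
  by move=> z0 w0; field; rewrite z0 w0.
by rewrite !e ?v0X ?vv0.
Qed.

Lemma specM a b a' b' : specializes eps a b -> specializes eps a' b' ->
  specializes eps (a * a') (b * b').
Proof.
move=> [m [P [-> ->]]] [m' [P' [-> ->]]].
exists (m + m')%N, (P * P'); rewrite /laurent /laurent_at.
by rewrite !rmorphM /= hornerM !exprD !mulf_div.
Qed.

Lemma spec_int (z : int) : specializes eps z%:~R z%:~R.
Proof.
exists 0%N, z%:P; rewrite /laurent /laurent_at !expr0 !divr1 !map_polyC /= hornerC.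
by split=> //; rewrite -(rmorph_int (@tofrac _)) -(rmorph_int (@polyC _)).
Qed.

Lemma spec1 : specializes eps 1 1. Proof. exact: (spec_int 1). Qed.
Lemma spec0 : specializes eps 0 0. Proof. exact: (spec_int 0). Qed.

Lemma specN a b : specializes eps a b -> specializes eps (- a) (- b).
Proof. by rewrite -(mulN1r a) -(mulN1r b); apply/specM/(spec_int (-1)). Qed.

Lemma specB a b a' b' : specializes eps a b -> specializes eps a' b' ->
  specializes eps (a - a') (b - b').
Proof. by move=> h h'; apply/specD/specN. Qed.

Lemma specX a b n : specializes eps a b -> specializes eps (a ^+ n) (b ^+ n).
Proof.
move=> h; elim: n => [|n IHn]; first by rewrite !expr0; apply: spec1.
by rewrite !exprS; apply: specM.
Qed.

Lemma spec_vv : specializes eps vv eps.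
Proof.
exists 0%N, 'X; rewrite /laurent /laurent_at !expr0 !divr1 !map_polyX hornerX.
by split.
Qed.

Lemma spec_vvV : specializes eps vv^-1 eps^-1.
Proof.
exists 1%N, 1; rewrite /laurent /laurent_at !expr1 !rmorph1 div1r.
by split=> //; rewrite -(polyC1 k) hornerC div1r.
Qed.

Lemma spec_vvXV n : specializes eps (vv ^+ n)^-1 (eps ^+ n)^-1.
Proof. by rewrite -!exprVn; apply/specX/spec_vvV. Qed.

Lemma spec_vvz z : specializes eps (vv ^ z) (eps ^ z).
Proof.
case: z => n; first exact/specX/spec_vv.
by rewrite NegzE -!exprnN; apply: spec_vvXV.
Qed.

Lemma spec_sum (I : finType) (P : pred I) F G :
  (forall i, specializes eps (F i) (G i)) ->
  specializes eps (\sum_(i | P i) F i) (\sum_(i | P i) G i).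
Proof.
move=> h; elim/big_rec2: _ => [|i b a _ hab]; first exact: spec0.
exact: specD.
Qed.

Lemma spec_qbin n t : specializes eps (qbin vv n t) (qbin eps n t).
Proof.
elim: n t => [|n IHn] [|t] /=; try exact: spec1; first exact: spec0.
by apply: specD; apply: specM => //; [exact/specX/spec_vv|apply: specM;
  [exact/specX/spec_vv|exact: spec_vvXV]].
Qed.

Lemma spec_divop i t t' m x x' I : specializes eps t t' ->
  (forall J, specializes eps (x J) (x' J)) ->
  specializes eps (divop i t m x I) (divop i t' m x' I).
Proof.
move=> ht; elim: I m x x' => [|j I IHI] m x x' hx /=.
  by case: m => [|m]; [exact: hx|exact: spec0].
case: eqP => _; last by apply: specM; [exact: specX|apply: IHI => J; exact: hx].
apply: specD; first by apply: IHI => J; exact: hx.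
by case: m => [|m]; [exact: spec0|apply: IHI => J; exact: hx].
Qed.

Lemma spec_wdelta J I : specializes eps (wdelta _ J I) (wdelta _ J I).
Proof. by rewrite /wdelta; case: eqP => _; [exact: spec1|exact: spec0]. Qed.

Variable r : nat.
Local Notation N := #|{: r.-tuple 'I_2}|.

(** Specialisation is checked on the matrix entries in tensor space, where it is visibly compatible
    with products; the coordinates in the basis [[A]] are among these entries up to a power of v,
    which leads back to [schur_specializes]. *)
Definition spec_mx (X : 'M[Qv]_N) (Y : 'M[k]_N) :=
  forall i j, specializes eps (X i j) (Y i j).

Lemma spec_mx_qE m : spec_mx (val (qE vv0 r m)) (val (qE eps0 r m)).
Proof.
move=> i j; rewrite !mxE; apply: specM.
  by apply: specM; [exact/specX/spec_vv|exact: spec_vvXV].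
by apply: spec_divop => [|J]; [exact/specX/spec_vv|exact: spec_wdelta].
Qed.

Lemma spec_mx_qF m : spec_mx (val (qF vv0 r m)) (val (qF eps0 r m)).
Proof.
move=> i j; rewrite !mxE; apply: specM.
  by apply: specM; [exact/specX/spec_vv|exact: spec_vvXV].
by apply: spec_divop => [|J]; [exact: spec_vvXV|exact: spec_wdelta].
Qed.

Lemma spec_mx_qD w w' : (forall a b, specializes eps (w a b) (w' a b)) ->
  spec_mx (val (qD vv0 r w)) (val (qD eps0 r w')).
Proof.
by move=> h i j; rewrite !mxE; apply: specM; [exact: h|exact: spec_wdelta].
Qed.

Lemma spec_mxM X X' Y Y' : spec_mx X Y -> spec_mx X' Y' -> spec_mx (X *m X') (Y *m Y').
Proof.
by move=> h h' i j; rewrite !mxE; apply: spec_sum => s; apply: specM.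
Qed.

Lemma spec_mxD X X' Y Y' : spec_mx X Y -> spec_mx X' Y' -> spec_mx (X + X') (Y + Y').
Proof. by move=> h h' i j; rewrite !mxE; apply: specD. Qed.

Lemma spec_mx_cst a b : specializes eps a b -> spec_mx a%:M b%:M.
Proof.
by move=> h i j; rewrite !mxE; case: eqP => _; [exact: h|exact: spec0].
Qed.

Lemma spec_mx_unique X Y Y' : spec_mx X Y -> spec_mx X Y' -> Y = Y'.
Proof. by move=> h h'; apply/matrixP => i j; apply: spec_unique. Qed.

End Specialization.

Section AlgHom.
Variables (R : comNzRingType) (A B : algebraType R) (f : A -> B).
Hypothesis hf : is_alghom f.

Lemma alghomB x y : f (x - y) = f x - f y. Proof. by case: hf. Qed.
Lemma alghom0 : f 0 = 0. Proof. by rewrite -(subrr 0) alghomB subrr. Qed.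
Lemma alghomN x : f (- x) = - f x. Proof. by rewrite -sub0r alghomB alghom0 sub0r. Qed.
Lemma alghomD x y : f (x + y) = f x + f y.
Proof. by rewrite -[y in LHS]opprK alghomB alghomN opprK. Qed.
Lemma alghom1 : f 1 = 1. Proof. by case: hf => _ []. Qed.
Lemma alghomM x y : f (x * y) = f x * f y. Proof. by case: hf => _ [_ ->]. Qed.
Lemma alghomS a : f a%:S = a%:S. Proof. by case: hf. Qed.
Lemma alghomX x n : f (x ^+ n) = f x ^+ n.
Proof. by elim: n => [|n IHn]; rewrite ?expr0 ?alghom1 // !exprS alghomM IHn. Qed.
End AlgHom.

Lemma vv_pow_sub s : (0 < s)%N -> vv ^+ s - vv ^- s != 0.
Proof.
move=> s0; rewrite subr_eq0; apply/eqP => h.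
have : vv ^+ (s + s) = 1 by rewrite exprD {1}h mulVf // v0X // vv0.
rewrite /vv -rmorphXn -(rmorph1 (@tofrac _)) => /eqP; rewrite tofrac_eq => /eqP.
move/(congr1 (fun p : {poly rat} => size p)).
by rewrite size_polyXn size_poly1; lia.
Qed.

Lemma vvV_neq0 : vv - vv^-1 != 0.
Proof. by have := vv_pow_sub (isT : (0 < 1)%N); rewrite expr1. Qed.

Lemma qint_neq0 m : qint m.+1 != 0.
Proof. by apply: mulf_neq0; [exact: vv_pow_sub|rewrite invr_eq0 vvV_neq0]. Qed.

Lemma qfactS m : qfact m.+1 = qfact m * qint m.+1.
Proof. exact: (@big_nat_recr _ _ _ m.+1 1 qint isT). Qed.

Lemma qfact0 : qfact 0 = 1.
Proof. exact: (@big_geq _ _ _ 1 1 xpredT qint isT). Qed.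

Lemma qfact_neq0 m : qfact m != 0.
Proof.
elim: m => [|m IHm]; first by rewrite qfact0 oner_neq0.
by rewrite qfactS; apply: mulf_neq0; [exact: IHm|exact: qint_neq0].
Qed.

Section Zeta.
Variable r : nat.

Definition zgen (g : gl2_gen) : UQr r :=
  match g with
  | gE => qE vv0 r 1
  | gF => qF vv0 r 1
  | gK i => qD vv0 r (wKi vv i 1)
  | gKinv i => qD vv0 r (wKi vv i (-1))
  end.

Lemma wKi_mul i z z' : (fun a b => wKi vv i z a b * wKi vv i z' a b) = wKi vv i (z + z').
Proof. by rewrite wK_mul ?vv0 // /wKi; case: eqP; rewrite addr0. Qed.

Lemma wKi0 i : wKi vv i 0 = fun _ _ => 1.
Proof.
by do 2!apply/funext => ?; rewrite /wKi /wK; case: eqP; rewrite !mulr0 addr0 expr0z.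
Qed.

Lemma zgen_rel s t : gl2_rel s t -> teval zgen s = teval zgen t.
Proof.
case=> [i j|i|i|i|i|] /=.
- rewrite [LHS]qD_mul [RHS]qD_mul; apply: qD_ext => a b _; exact: mulrC.
- by rewrite [LHS]qD_mul wKi_mul subrr wKi0 qD1 rmorph1.
- by rewrite [LHS]qD_mul wKi_mul addNr wKi0 qD1 rmorph1.
- by rewrite [LHS]qK_E mulr1.
- by rewrite [LHS]qK_F mulr1.
- by rewrite rmorphN rmorph1 !mulN1r [LHS]qEF // vvV_neq0.
Qed.

Lemma Kpow_alghom (f : UQ -> UQr r) i z : is_alghom f ->
  (forall g, f (Ugen g) = zgen g) -> f (Kpow i z) = qD vv0 r (wKi vv i z).
Proof.
move=> hf hg; have H g n : f (Ugen g ^+ n) = f (Ugen g) ^+ n by apply: alghomX.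
case: z => n; rewrite /Kpow H hg /=.
  elim: n => [|n IHn]; first by rewrite wKi0 qD1.
  by rewrite exprS IHn [LHS]qD_mul wKi_mul; congr (qD _ _ (wKi _ _ _)); lia.
elim: n => [|n IHn]; first by rewrite expr1.
by rewrite exprS IHn [LHS]qD_mul wKi_mul; congr (qD _ _ (wKi _ _ _)); lia.
Qed.

Lemma zeta_exists : exists f : UQ -> UQr r, is_alghom f /\ forall g, f (Ugen g) = zgen g.
Proof.
exists (plift zgen (rel := gl2_rel)); split; first exact: plift_alghom zgen_rel.
by move=> g; rewrite [LHS](plift_pclass zgen_rel).
Qed.

(** The presentation supplies a map satisfying the description of [zeta]. Conversely the description
    fixes the generators, a single K_i or its inverse being a product with one nonzero exponent. *)
Lemma zetaP : is_alghom (zeta r) /\ forall g, zeta r (Ugen g) = zgen g.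
Proof.
have [hf hE hF hK] : [set f : UQ -> UQr r |
    [/\ is_alghom f,
        f (Ugen gE) = brA vv r (delta_mx 0 1) 0,
        f (Ugen gF) = brA vv r (delta_mx 1 0) 0 &
        forall j : 'rV[int]_2,
          f (\prod_i Kpow i (j 0 i)) = brA vv r 0 j]]%classic (zeta r).
  apply: xgetPex; have [f [hf hg]] := zeta_exists; exists f; split=> //.
  - by rewrite hg; apply: val_inj; rewrite brA_E // vv0.
  - by rewrite hg; apply: val_inj; rewrite brA_F // vv0.
  - move=> j; rewrite big_ord2 alghomM // !Kpow_alghom //.
    rewrite [LHS]qD_mul wK_mul ?vv0 // /wKi /= addr0 add0r.
    by apply: val_inj; rewrite brA_K ?vv0.
have hKi i z : zeta r (Kpow i z) = qD vv0 r (wKi vv i z).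
  have := hK (\row_j if j == i then z else 0).
  rewrite big_ord2 !mxE => h.
  have -> : zeta r (Kpow i z) = brA vv r 0 (\row_j if j == i then z else 0).
    by rewrite -h; congr (zeta r _); elim/ord2_ind: i {h}; rewrite /= expr0 ?mulr1 ?mul1r.
  apply: val_inj; rewrite brA_K ?vv0 // !mxE /wKi; by elim/ord2_ind: i {h}.
split; first exact: hf.
case=> [||i|i]; [rewrite hE|rewrite hF| |].
- by apply: val_inj; rewrite brA_E ?vv0.
- by apply: val_inj; rewrite brA_F ?vv0.
- by rewrite -[RHS]/(qD vv0 r (wKi vv i 1)) -hKi -[Kpow i 1]/(Ugen (gK i) ^+ 1) expr1.
- by rewrite -[RHS]/(qD vv0 r (wKi vv i (-1))) -hKi -[Kpow i (-1)]/(Ugen (gKinv i) ^+ 1) expr1.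
Qed.

Definition zeta_hom : is_alghom (zeta r) := zetaP.1.

Lemma zeta_divE m : zeta r (divpow gE m) = qE vv0 r m.
Proof.
have hE : zeta r (Ugen gE) = qE vv0 r 1 by rewrite zetaP.2.
have E n : zeta r (Ugen gE) ^+ n = (qfact n)%:S * qE vv0 r n.
  rewrite hE; elim: n => [|n IHn]; first by rewrite expr0 qfact0 rmorph1 mul1r qE0.
  rewrite exprS IHn mulrA -cst_central -mulrA (qE_mul vv0 r vvV_neq0) mulrA -rmorphM.
  by rewrite qfactS.
rewrite /divpow (alghomM zeta_hom) (alghomS zeta_hom) (alghomX zeta_hom) E mulrA.
by rewrite -rmorphM mulVf ?rmorph1 ?mul1r // qfact_neq0.
Qed.

Lemma zeta_divF m : zeta r (divpow gF m) = qF vv0 r m.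
Proof.
have hF : zeta r (Ugen gF) = qF vv0 r 1 by rewrite zetaP.2.
have E n : zeta r (Ugen gF) ^+ n = (qfact n)%:S * qF vv0 r n.
  rewrite hF; elim: n => [|n IHn]; first by rewrite expr0 qfact0 rmorph1 mul1r qF0.
  rewrite exprS IHn mulrA -cst_central -mulrA (qF_mul vv0 r vvV_neq0) mulrA -rmorphM.
  by rewrite qfactS.
rewrite /divpow (alghomM zeta_hom) (alghomS zeta_hom) (alghomX zeta_hom) E mulrA.
by rewrite -rmorphM mulVf ?rmorph1 ?mul1r // qfact_neq0.
Qed.

Definition nsel (j : 'I_2) (a b : nat) : nat := if j == 0 then a else b.

Lemma zeta_Kbin j t : zeta r (Kbin j t) = qD vv0 r (fun a b => qbin vv (nsel j a b) t).
Proof.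
have e : zeta r (Kbin j t) = qD vv0 r (fun a b => \prod_(1 <= s < t.+1)
    ((vv ^+ s - vv ^- s)^-1 * (vv ^ ((nsel j a b)%:Z + 1 - s%:Z)
      - vv ^ (s%:Z - 1 - (nsel j a b)%:Z)))).
  rewrite /Kbin; elim: t => [|t IHt].
    rewrite big_geq // (alghom1 zeta_hom) -(qD1 vv0 r); apply: qD_ext => a b _.
    by rewrite big_geq.
  rewrite big_nat_recr // (alghomM zeta_hom) IHt.
  rewrite (alghomM zeta_hom) (alghomS zeta_hom) (alghomB zeta_hom) !(alghomM zeta_hom).
  rewrite !(alghomS zeta_hom) !zetaP.2 -[zgen (gK j)]/(qD vv0 r (wKi vv j 1)).
  rewrite -[zgen (gKinv j)]/(qD vv0 r (wKi vv j (-1))).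
  rewrite !qD_scale qD_sub qD_scale [LHS]qD_mul; apply: qD_ext => a b _.
  rewrite [RHS]big_nat_recr //; congr (_ * (_ * _)).
  rewrite /wKi /wK -!expfzDr ?vv0 //.
  by rewrite /nsel; case: eqP => _; congr (vv ^ _ - vv ^ _); ring.
rewrite e; apply: qD_ext => a b _; exact: (qbinE vv0 _ t vv_pow_sub).
Qed.

End Zeta.

(** Among the ordered words, only that of [A] gives [[A]] a nonzero entry, namely [v ^ (- dexp A)].
    The coordinates are therefore read off from entries. *)
Lemma br_expand (R : fieldType) (v : R) (v0 : v != 0) r (x : qschur (v ^+ 2) 2 r) :
  x = \sum_(A : 'M['I_r.+1]_2 | msum (map_mx val A) == r)
     (v ^ dexp (map_mx val A) * ent (val x) (bwM (map_mx val A)))%:S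
     * br v r (map_mx val A).
Proof.
apply: (ent_qschur_inj v0) => a c b d sr.
rewrite ent_sum -bwM_M4; set B := M4 a c b d.
have sB : msum B = r by rewrite msum_M4.
pose A0 : 'M['I_r.+1]_2 := \matrix_(i, j) inord (B i j).
have eA0 : map_mx val A0 = B.
  apply/matrixP => i j; rewrite !mxE; rewrite /= inordK //.
  by elim/ord2_ind: i; elim/ord2_ind: j => /=; lia.
rewrite (bigD1 A0); last by rewrite eA0 sB.
rewrite big1 ?addr0 => [|A /andP[/eqP sA nA]]; last first.
  rewrite ent_scale br_ent //; case: eqP => [eA|_]; last by rewrite !mulr0.
  case/eqP: nA; apply/matrixP => i j; apply: val_inj.
  by have := congr1 (fun M : 'M[nat]_2 => M i j) eA; rewrite -eA0 !mxE.
rewrite [ent _ _ in RHS]ent_scale br_ent ?eA0 // eqxx mulr1 mulrAC -expfzDr //.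
by rewrite subrr expr0z mul1r; exact: (esym (addr0 _)).
Qed.

(** * The base change of zeta_r *)

Section ZetaK.
Variables (k : fieldType) (eps : k).
Hypothesis eps0 : eps != 0.
Variable r : nat.

Lemma schur_spec_mx (x : UQr r) (y : Ukr eps r) :
  spec_mx eps (val x) (val y) -> schur_specializes x y.
Proof.
move=> h.
exists (fun A => vv ^ dexp A * ent (val x) (bwM A)).
exists (fun A => eps ^ dexp A * ent (val y) (bwM A)); split.
- by move=> A; apply: specM; [exact: spec_vvz|exact: h].
- exact: br_expand vv0 _ x.
- exact: br_expand eps0 _ y.
Qed.

Lemma schur_spec_unique (x : UQr r) (y y' : Ukr eps r) :
  schur_specializes x y -> schur_specializes x y' -> y = y'.
Proof.
have E (R : fieldType) (v : R) (v0 : v != 0) (z : qschur (v ^+ 2) 2 r) a :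
   z = \sum_(A : 'M['I_r.+1]_2 | msum (map_mx val A) == r)
              (a (map_mx val A))%:S * br v r (map_mx val A) ->
   forall B : 'M['I_r.+1]_2, msum (map_mx val B) = r ->
   v ^ dexp (map_mx val B) * ent (val z) (bwM (map_mx val B)) = a (map_mx val B).
  move=> -> B sB; rewrite ent_sum (bigD1 B); last by rewrite sB.
  rewrite big1 ?addr0 => [|A /andP[/eqP sA nA]]; last first.
    rewrite ent_scale br_ent //; case: eqP => [eA|_]; last by rewrite !mulr0.
    case/eqP: nA; apply/matrixP => i j; apply: val_inj.
    by have := congr1 (fun M : 'M[nat]_2 => M i j) eA; rewrite !mxE.
  rewrite ent_scale br_ent // eqxx mulr1 [X in _ * X]addr0 mulrCA -expfzDr //.
  by rewrite subrr expr0z mulr1.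
move=> [a [b [hab hx hy]]] [a' [b' [hab' hx' hy']]].
rewrite hy hy'; apply: eq_bigr => A /eqP sA; congr (_%:S * _).
apply: (spec_unique eps0 (hab _)).
by rewrite -(E _ _ vv0 _ _ hx A sA) (E _ _ vv0 _ _ hx' A sA).
Qed.

(** On the generators of the integral form [zeta] is known explicitly, with Laurent polynomial
    entries. The specialised matrices provide the values of the base change on the generators x (x)
    1 of [Uk]. *)
Lemma zform_spec x : Zform x -> exists y : Ukr eps r, spec_mx eps (val (zeta r x)) (val y).
Proof.
have wKi_spec i z a b : specializes eps (wKi vv i z a b) (wKi eps i z a b).
  exact: spec_vvz.
elim=> {x} [m|m|j|j|j t|a ha|x y _ [x' hx] _ [y' hy]|x y _ [x' hx] _ [y' hy]].
- by rewrite zeta_divE; exists (qE eps0 r m); apply: spec_mx_qE.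
- by rewrite zeta_divF; exists (qF eps0 r m); apply: spec_mx_qF.
- rewrite (zetaP r).2; exists (qD eps0 r (wKi eps j 1)).
  by apply: (@spec_mx_qD _ _ eps0 r (wKi vv j 1)) => a b; apply: wKi_spec.
- rewrite (zetaP r).2; exists (qD eps0 r (wKi eps j (-1))).
  by apply: (@spec_mx_qD _ _ eps0 r (wKi vv j (-1))) => a b; apply: wKi_spec.
- rewrite zeta_Kbin; exists (qD eps0 r (fun a b => qbin eps (nsel j a b) t)).
  by apply: spec_mx_qD => a b; apply: spec_qbin.
- have [b hb] := spec_laurent eps ha; rewrite (alghomS (zeta_hom r)).
  by exists b%:S; apply: spec_mx_cst.
- by rewrite (alghomD (zeta_hom r)); exists (x' + y'); apply: spec_mxD.
- by rewrite (alghomM (zeta_hom r)); exists (x' * y'); apply: spec_mxM.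
Qed.

Definition zk (x : UZ) : Ukr eps r := projT1 (cid (zform_spec (svalP x))).

Lemma zkP (x : UZ) : spec_mx eps (val (zeta r (sval x))) (val (zk x)).
Proof. exact: (projT2 (cid (zform_spec (svalP x)))). Qed.

Lemma zk_unique (x : UZ) (y : Ukr eps r) :
  spec_mx eps (val (zeta r (sval x))) (val y) -> zk x = y.
Proof. by move=> h; apply/val_inj/(spec_mx_unique eps0 (zkP x) h). Qed.

Lemma zk_rel s t : Uk_rel eps s t -> teval zk s = teval zk t.
Proof.
case=> [x e|x y z e|x y z e|a b x z hab e] /=; apply: zk_unique; rewrite e.
- rewrite (alghom1 (zeta_hom r)) rmorph1; apply: (@spec_mx_cst _ _ r 1 1); exact: spec1.
- by rewrite (alghomD (zeta_hom r)); exact: (spec_mxD eps0 (zkP x) (zkP y)).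
- by rewrite (alghomM (zeta_hom r)); exact: (spec_mxM eps0 (zkP x) (zkP y)).
- rewrite (alghomM (zeta_hom r)) (alghomS (zeta_hom r)); exact: (spec_mxM eps0 (@spec_mx_cst _ _ r _ _ hab) (zkP x)).
Qed.

Lemma zetakP : is_alghom (@zetak k eps r) /\ forall x, Zform x ->
  spec_mx eps (val (zeta r x)) (val (@zetak k eps r (tens1 eps x))).
Proof.
have [hf hs] : [set f : Uk eps -> Ukr eps r |
    is_alghom f /\
    forall x, Zform x -> schur_specializes (zeta r x) (f (tens1 eps x))]%classic
    (@zetak k eps r).
  apply: xgetPex; exists (plift zk (rel := Uk_rel eps)).
  split; first exact: plift_alghom zk_rel.
  move=> x hx; rewrite /tens1; case: pselect => // hx'.
  rewrite [plift _ _](plift_pclass zk_rel) /=; apply: schur_spec_mx.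
  exact: (zkP (exist _ x hx')).
split=> // x hx; have [y hy] := zform_spec hx.
by rewrite (schur_spec_unique (hs _ hx) (schur_spec_mx hy)).
Qed.

Definition zetak_hom : is_alghom (@zetak k eps r) := zetakP.1.

Definition zt (x : UQ) : Ukr eps r := @zetak k eps r (tens1 eps x).

Lemma zt_unique x (y : Ukr eps r) : Zform x ->
  spec_mx eps (val (zeta r x)) (val y) -> zt x = y.
Proof. by move=> hx h; apply/val_inj/(spec_mx_unique eps0 (zetakP.2 x hx) h). Qed.

Lemma zt_mul x y : Zform x -> Zform y -> zt (x * y) = zt x * zt y.
Proof.
move=> hx hy; apply: zt_unique; first exact: Zform_mul.
by rewrite (alghomM (zeta_hom r)); exact: (spec_mxM eps0 (zetakP.2 x hx) (zetakP.2 y hy)).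
Qed.

Lemma zt_add x y : Zform x -> Zform y -> zt (x + y) = zt x + zt y.
Proof.
move=> hx hy; apply: zt_unique; first exact: Zform_add.
by rewrite (alghomD (zeta_hom r)); exact: (spec_mxD eps0 (zetakP.2 x hx) (zetakP.2 y hy)).
Qed.

Lemma spec_is_laurent a b : specializes eps a b -> is_laurent a.
Proof. by case=> m [P [-> _]]; exists m, P. Qed.

Lemma zt_cst a b : specializes eps a b -> zt a%:S = b%:S.
Proof.
move=> h; apply: zt_unique; first exact/Zform_laurent/spec_is_laurent/h.
by rewrite (alghomS (zeta_hom r)); apply: spec_mx_cst.
Qed.

Lemma zt_divE m : zt (divpow gE m) = qE eps0 r m.
Proof.
by apply: zt_unique; [exact: Zform_E|rewrite zeta_divE; apply: spec_mx_qE].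
Qed.

Lemma zt_divF m : zt (divpow gF m) = qF eps0 r m.
Proof.
by apply: zt_unique; [exact: Zform_F|rewrite zeta_divF; apply: spec_mx_qF].
Qed.

Lemma zt_K j : zt (Ugen (gK j)) = qD eps0 r (wKi eps j 1).
Proof.
apply: zt_unique; [exact: Zform_K|rewrite (zetaP r).2].
by apply: (@spec_mx_qD _ _ eps0 r (wKi vv j 1)) => a b; apply: spec_vvz.
Qed.

Lemma zt_Kinv j : zt (Ugen (gKinv j)) = qD eps0 r (wKi eps j (-1)).
Proof.
apply: zt_unique; [exact: Zform_Kinv|rewrite (zetaP r).2].
by apply: (@spec_mx_qD _ _ eps0 r (wKi vv j (-1))) => a b; apply: spec_vvz.
Qed.

Lemma zt_Kbin j t : zt (Kbin j t) = qD eps0 r (fun a b => qbin eps (nsel j a b) t).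
Proof.
apply: zt_unique; [exact: Zform_bin|rewrite zeta_Kbin].
by apply: spec_mx_qD => a b; apply: spec_qbin.
Qed.

Lemma divpow1 g : divpow g 1 = Ugen g.
Proof.
rewrite /divpow expr1 qfactS qfact0 mul1r /qint !expr1 divff ?vvV_neq0 //.
by rewrite invr1 rmorph1 mul1r.
Qed.

Lemma zt_E : zt (Ugen gE) = qE eps0 r 1.
Proof. by rewrite -divpow1 zt_divE. Qed.

Lemma zt_F : zt (Ugen gF) = qF eps0 r 1.
Proof. by rewrite -divpow1 zt_divF. Qed.

End ZetaK.

(** * The Casimir element *)

Section CasimirAbstract.
Variables (K : fieldType) (v : K) (A : algebraType K).
Hypotheses (v0 : v != 0) (d0 : v - v^-1 != 0).
Implicit Types (x y E F L M : A) (a b : K).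

Lemma cst_CA a x y : x * (a%:S * y) = a%:S * (x * y).
Proof. by rewrite mulrA -cst_central -mulrA. Qed.

(** With L and M the two inverse elements K_1 K_2^-1 and K_2 K_1^-1, this is (v - v^-1)^2 times the
    usual Casimir element FE + (v L + v^-1 M) / (v - v^-1)^2; the denominator is cleared so that the
    element lies in the integral form. *)
Definition casimir E F L M : A :=
  ((v - v^-1) ^+ 2)%:S * (F * E) + v%:S * L + v^-1%:S * M.

Lemma casimirE E F L M :
  L * E = (v ^+ 2)%:S * (E * L) -> M * E = (v ^- 2)%:S * (E * M) ->
  E * F - F * E = (v - v^-1)^-1%:S * (L - M) ->
  casimir E F L M * E = E * casimir E F L M.
Proof.
move=> hL hM /(canRL (subrK _)) hEF.
have h1 : casimir E F L M * E = ((v - v^-1) ^+ 2)%:S * (F * E * E)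
    + (v * v ^+ 2)%:S * (E * L) + (v^-1 * v ^- 2)%:S * (E * M).
  by rewrite /casimir !mulrDl -!mulrA hL hM !rmorphM -!mulrA.
have h2 : E * F * E = F * E * E + ((v - v^-1)^-1 * v ^+ 2)%:S * (E * L)
    + (- ((v - v^-1)^-1 * v ^- 2))%:S * (E * M).
  rewrite hEF mulrDl -mulrA mulrBl hL hM mulrBr !mulrA -!rmorphM /= addrC addrA.
  by rewrite rmorphN !mulNr !mulrA.
have h3 : E * casimir E F L M = ((v - v^-1) ^+ 2)%:S * (F * E * E)
    + ((v - v^-1) ^+ 2 * ((v - v^-1)^-1 * v ^+ 2) + v)%:S * (E * L)
    + ((v - v^-1) ^+ 2 * (- ((v - v^-1)^-1 * v ^- 2)) + v^-1)%:S * (E * M).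
  rewrite /casimir !mulrDr !cst_CA (mulrA E F) h2 !mulrDr !mulrA -!rmorphM /=.
  rewrite !rmorphD !mulrDl -!addrA; congr (_ + (_ + _)); first by rewrite !mulrA.
  by rewrite addrCA.
rewrite h1 h3; congr (_ + _%:S * _ + _%:S * _).
  by rewrite expr2 -mulrA mulVKf // mulrBl; field.
by rewrite expr2 mulrN -mulrA mulVKf // mulrBl; field.
Qed.

(** The exchange of E with F and of L with M preserves the commutator relation and fixes the
    element, so commutation with F follows from commutation with E. *)
Lemma casimir_sym E F L M : E * F - F * E = (v - v^-1)^-1%:S * (L - M) ->
  casimir E F L M = casimir F E M L.
Proof.
move=> /(canRL (subrK _)) hEF.
have e : ((v - v^-1) ^+ 2)%:S * ((v - v^-1)^-1%:S * (L - M)) =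
    (v%:S * L - v^-1%:S * L) - (v%:S * M - v^-1%:S * M).
  rewrite mulrA -rmorphM expr2 mulfK // rmorphB mulrBl mulrBr mulrBr.
  by rewrite !opprB [X in _ + X]addrC addrACA [X in _ + X]addrC.
rewrite /casimir hEF mulrDr e.
move: (_ * (F * E)) (v%:S * L) (v^-1%:S * L) (v%:S * M) (v^-1%:S * M) => x y z u w.
rewrite opprB (addrC _ x) addrA -(addrA (x + _)) subrK [RHS]addrAC.
by rewrite -(addrA x (y - z)) subrK.
Qed.

Lemma casimirF E F L M :
  L * F = (v ^- 2)%:S * (F * L) -> M * F = (v ^+ 2)%:S * (F * M) ->
  E * F - F * E = (v - v^-1)^-1%:S * (L - M) ->
  casimir E F L M * F = F * casimir E F L M.
Proof.
move=> hL hM hEF; rewrite (casimir_sym hEF); apply: casimirE => //.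
by rewrite -opprB hEF -mulrN opprB.
Qed.

Lemma casimirK E F L M k a : k * E = a%:S * (E * k) -> k * F = a^-1%:S * (F * k) ->
  a != 0 -> k * L = L * k -> k * M = M * k ->
  casimir E F L M * k = k * casimir E F L M.
Proof.
move=> hE hF a0 hL hM; rewrite /casimir !mulrDl !mulrDr !cst_CA hL hM.
congr (_ + _ + _); rewrite -!mulrA //; congr (_ * _).
by rewrite [RHS]mulrA hF -!mulrA hE (cst_CA a F) [RHS]mulrA -rmorphM mulVf ?rmorph1 ?mul1r.
Qed.

End CasimirAbstract.

Section QuantumCasimir.

Local Notation E := (Ugen gE).
Local Notation F := (Ugen gF).
Local Notation K i := (Ugen (gK i)).
Local Notation K' i := (Ugen (gKinv i)).

Lemma UQ_cst (a : Qv) : (a%:S : UQ) = pclass gl2_rel (Cst a).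
Proof. by []. Qed.

Lemma UQ_KK i j : K i * K j = K j * K i.
Proof. by rewrite /Ugen /pgen -!pclassM; apply/pclassP/cong_rel/gl2_KK. Qed.

Lemma UQ_KK' i : K i * K' i = 1.
Proof. by rewrite /Ugen /pgen -!pclassM; apply/pclassP/cong_rel/gl2_KK'. Qed.

Lemma UQ_K'K i : K' i * K i = 1.
Proof. by rewrite /Ugen /pgen -!pclassM; apply/pclassP/cong_rel/gl2_K'K. Qed.

Lemma UQ_KE i : K i * E = (vv ^ rootexp i)%:S * (E * K i).
Proof.
rewrite /Ugen /pgen UQ_cst -(pclassM _ (Var gE)) -!pclassM.
exact/pclassP/cong_rel/gl2_KE.
Qed.

Lemma UQ_KF i : K i * F = (vv ^ (- rootexp i))%:S * (F * K i).
Proof.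
rewrite /Ugen /pgen UQ_cst -(pclassM _ (Var gF)) -!pclassM.
exact/pclassP/cong_rel/gl2_KF.
Qed.

Lemma UQ_EF : E * F - F * E = (vv - vv^-1)^-1%:S * (K 0 * K' 1 - K 1 * K' 0).
Proof.
have e : E * F + (-1)%:S * (F * E) =
    (vv - vv^-1)^-1%:S * (K 0 * K' 1 + (-1)%:S * (K 1 * K' 0)).
  rewrite /Ugen /pgen !UQ_cst -(pclassM _ (Var gE)) -(pclassM _ (Var gF)).
  rewrite -(pclassM _ (Var (gK 0))) -(pclassM _ (Var (gK 1))).
  rewrite -(pclassM _ (Cst (-1)) (Mul (Var gF) _)) -(pclassM _ (Cst (-1)) (Mul (Var (gK 1)) _)).
  rewrite -(pclassD _ (Mul (Var gE) _)) -(pclassD _ (Mul (Var (gK 0)) _)) -pclassM.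
  exact/pclassP/cong_rel/gl2_EF.
by move: e; rewrite rmorphN rmorph1 !mulN1r.
Qed.

Lemma inv_qcomm (x y z : UQ) (a : Qv) : x * y = 1 -> y * x = 1 -> a != 0 ->
  x * z = a%:S * (z * x) -> y * z = a^-1%:S * (z * y).
Proof.
move=> xy yx a0 xz.
rewrite -[y * z]mulr1 -xy mulrA -(mulrA y) .
have -> : z * x = a^-1%:S * (x * z) by rewrite xz mulrA -rmorphM mulVf // rmorph1 mul1r.
by rewrite cst_CA !mulrA -(mulrA _ y x) yx mulr1.
Qed.

Lemma UQ_K'E i : K' i * E = (vv ^ (- rootexp i))%:S * (E * K' i).
Proof.
rewrite -invr_expz; apply: (inv_qcomm (UQ_KK' i) (UQ_K'K i)) (UQ_KE i).
exact: expfz_neq0 vv0.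
Qed.

Lemma UQ_K'F i : K' i * F = (vv ^ rootexp i)%:S * (F * K' i).
Proof.
rewrite -[rootexp i]opprK -invr_expz; apply: (inv_qcomm (UQ_KK' i) (UQ_K'K i)) (UQ_KF i).
exact: expfz_neq0 vv0.
Qed.

Lemma UQ_K'z i (z : UQ) : K i * z = z * K i -> K' i * z = z * K' i.
Proof.
move=> h; have := @inv_qcomm _ _ z 1 (UQ_KK' i) (UQ_K'K i) (oner_neq0 _).
by rewrite invr1 rmorph1 !mul1r; apply.
Qed.

Lemma UQ_KK'c i j : K i * K' j = K' j * K i.
Proof. by apply/esym/UQ_K'z/esym/UQ_KK. Qed.

Lemma UQ_LE i j : rootexp i = - rootexp j ->
  K i * K' j * E = (vv ^ (rootexp i + rootexp i))%:S * (E * (K i * K' j)).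
Proof.
move=> ij; rewrite -mulrA UQ_K'E -ij cst_CA (mulrA (K i)) UQ_KE -(mulrA _ (E * _)).
by rewrite -(mulrA E) [LHS]mulrA -rmorphM (expfzDr (rootexp i) (rootexp i) vv0).
Qed.

Lemma UQ_LF i j : rootexp i = - rootexp j ->
  K i * K' j * F = (vv ^ (- (rootexp i + rootexp i)))%:S * (F * (K i * K' j)).
Proof.
move=> ij; have ji : rootexp j = - rootexp i by rewrite ij opprK.
rewrite -mulrA UQ_K'F ji cst_CA (mulrA (K i)) UQ_KF -(mulrA _ (F * _)).
by rewrite -(mulrA F) [LHS]mulrA -rmorphM (opprD (rootexp i) (rootexp i)) (expfzDr (- rootexp i) (- rootexp i) vv0).
Qed.

Definition UQ_cas : UQ := casimir vv E F (K 0 * K' 1) (K 1 * K' 0).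

Lemma UQ_casC x : UQ_cas * x = x * UQ_cas.
Proof.
have hK i : UQ_cas * K i = K i * UQ_cas.
  apply: (casimirK vv (UQ_KE i) _ (expfz_neq0 _ vv0)).
  - by rewrite invr_expz UQ_KF.
  - by rewrite mulrA (UQ_KK i) -mulrA (UQ_KK'c i) mulrA.
  - by rewrite mulrA (UQ_KK i) -mulrA (UQ_KK'c i) mulrA.
suff h t : UQ_cas * (pclass gl2_rel t : UQ) = (pclass gl2_rel t : UQ) * UQ_cas.
  by elim/pclass_ind: x.
elim: t => [g|a|s IHs t IHt|s IHs t IHt].
- case: g => [||i|i]; rewrite -/(Ugen _).
  + apply: casimirE; [exact: vv0|exact: vvV_neq0| | |exact: UQ_EF].
    * by rewrite UQ_LE.
    * by rewrite UQ_LE.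
  + apply: casimirF; [exact: vv0|exact: vvV_neq0| | |exact: UQ_EF].
    * by rewrite UQ_LF.
    * by rewrite UQ_LF.
  + exact: hK.
  + by apply/esym/UQ_K'z/esym/hK.
- exact/esym/cst_central.
- have -> : pclass gl2_rel (Add s t) = (pclass gl2_rel s : UQ) + (pclass gl2_rel t : UQ).
    exact: pclassD.
  by rewrite mulrDr [RHS]mulrDl IHs IHt.
- have -> : pclass gl2_rel (Mul s t) = (pclass gl2_rel s : UQ) * (pclass gl2_rel t : UQ).
    exact: pclassM.
  by rewrite mulrA IHs -mulrA IHt mulrA.
Qed.

Section CasimirK.
Variables (k : fieldType) (eps : k).
Hypothesis eps0 : eps != 0.
Variable r : nat.

Lemma Zform_E1 : Zform E. Proof. by rewrite -divpow1; apply: Zform_E. Qed.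
Lemma Zform_F1 : Zform F. Proof. by rewrite -divpow1; apply: Zform_F. Qed.

Lemma spec_d2 : specializes eps ((vv - vv^-1) ^+ 2) ((eps - eps^-1) ^+ 2).
Proof. by apply: specX => //; apply: specB => //; [exact: spec_vv|exact: spec_vvV]. Qed.

Lemma Zform_L i j : Zform (K i * K' j).
Proof. by apply: Zform_mul; [exact: Zform_K|exact: Zform_Kinv]. Qed.

Lemma Zform_spec a b : specializes eps a b -> Zform a%:S.
Proof. by move=> h; apply/Zform_laurent/(spec_is_laurent h). Qed.

Lemma Zform_cas : Zform UQ_cas.
Proof.
apply: Zform_add; [apply: Zform_add|]; apply: Zform_mul.
- exact: Zform_spec spec_d2.
- by apply: Zform_mul; [exact: Zform_F1|exact: Zform_E1].
- exact: Zform_spec (spec_vv eps).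
- exact: Zform_L.
- exact: Zform_spec (spec_vvV eps).
- exact: Zform_L.
Qed.

Definition cask : Ukr eps r := casimir eps (qE eps0 r 1) (qF eps0 r 1)
  (qD eps0 r (wKi eps 0 1) * qD eps0 r (wKi eps 1 (-1)))
  (qD eps0 r (wKi eps 1 1) * qD eps0 r (wKi eps 0 (-1))).

Lemma zt_cas : zt eps r UQ_cas = cask.
Proof.
have ZL i j : zt eps r (K i * K' j) = qD eps0 r (wKi eps i 1) * qD eps0 r (wKi eps j (-1)).
  by rewrite (zt_mul eps0) ?(zt_K eps0) ?(zt_Kinv eps0) //;
    [exact: Zform_K|exact: Zform_Kinv].
rewrite /UQ_cas /casimir (zt_add eps0); last first.
  - apply: Zform_mul; [exact: Zform_spec (spec_vvV eps)|exact: Zform_L].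
  - apply: Zform_add; apply: Zform_mul.
    + exact: Zform_spec spec_d2.
    + by apply: Zform_mul; [exact: Zform_F1|exact: Zform_E1].
    + exact: Zform_spec (spec_vv eps).
    + exact: Zform_L.
rewrite (zt_add eps0); last first.
  - apply: Zform_mul; [exact: Zform_spec (spec_vv eps)|exact: Zform_L].
  - apply: Zform_mul; first exact: Zform_spec spec_d2.
    by apply: Zform_mul; [exact: Zform_F1|exact: Zform_E1].
rewrite (zt_mul eps0 _ (Zform_spec spec_d2)); last first.
  by apply: Zform_mul; [exact: Zform_F1|exact: Zform_E1].
rewrite (zt_mul eps0 _ (Zform_spec (spec_vv eps)) (Zform_L _ _)).
rewrite (zt_mul eps0 _ (Zform_spec (spec_vvV eps)) (Zform_L _ _)).
rewrite (zt_mul eps0 _ Zform_F1 Zform_E1) !ZL (zt_E eps0) (zt_F eps0).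
by rewrite (zt_cst eps0 _ spec_d2) (zt_cst eps0 _ (spec_vv eps)) (zt_cst eps0 _ (spec_vvV eps)).
Qed.

Lemma zt_casC x : Zform x -> cask * zt eps r x = zt eps r x * cask.
Proof.
move=> hx; rewrite -zt_cas -!(zt_mul eps0) //; try exact: Zform_cas.
by rewrite UQ_casC.
Qed.

(** When a + b = r, either a < n, or b < r - n, or both are equalities: the product of the two
    binomials is the indicator of a single weight. *)
Lemma qD_proj n : (n <= r)%N ->
  zt eps r (Kbin 0 n * Kbin 1 (r - n)) = qD eps0 r (fun a _ => (a == n)%:R).
Proof.
move=> nr; rewrite (zt_mul eps0); [|exact: Zform_bin|exact: Zform_bin].
rewrite !(zt_Kbin eps0) [LHS]qD_mul; apply: qD_ext => a b abr; rewrite /nsel /=.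
case: (ltngtP a n) => [lt|lt|an].
- by rewrite qbin_gt // mul0r.
- have lb : (b < r - n)%N by rewrite ltn_subRL -abr ltn_add2r.
  by rewrite (qbin_gt _ lb) mulr0.
- have -> : (r - n)%N = b by rewrite -abr an addKn.
  by rewrite an !qbinnn ?mulr1.
Qed.

(** Centrality over Q(v) specialises to commutation with the images of the integral form, and
    products of such images span the q-Schur algebra by [qschur_span]. *)
Lemma caskC (x : Ukr eps r) : cask * x = x * cask.
Proof.
apply: val_inj; rewrite [LHS]val_mul [RHS]val_mul.
pose P X := val cask *m X = X *m val cask.
have PM X Y : P X -> P Y -> P (X *m Y).
  by rewrite /P => hX hY; rewrite mulmxA hX -!mulmxA hY.
have Pz y : Zform y -> P (val (zt eps r y)).
  by move=> /zt_casC h; rewrite /P -!val_mul h.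
apply: (@qschur_span k eps eps0 r P); last exact: valP.
- rewrite /P; move: (val cask) => C a X Y hX hY.
  by rewrite mulmxDr mulmxDl -scalemxAr hX hY -scalemxAl.
- by rewrite /P mulmx0 mul0mx.
move=> b c n; rewrite mxop_Xop; apply: (PM _ _); first apply: (PM _ _).
- by have := Pz _ (Zform_E b); rewrite (zt_divE eps0).
- by have := Pz _ (Zform_F c); rewrite (zt_divF eps0).
(* For n > r no word of length [r] has n letters 0, and the projection is zero. *)
case: (leqP n r) => nr.
  by have := Pz _ (Zform_mul (Zform_bin 0 n) (Zform_bin 1 (r - n))); rewrite qD_proj.
rewrite /P (_ : mxop r _ = 0) ?mulmx0 ?mul0mx //.
apply/matrixP => i j; rewrite !mxE /dop; case: eqP => [e|_]; last by rewrite mul0r.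
have : (n0 (wd i) <= size (wd i))%N by rewrite -size_count2 leq_addr.
rewrite size_wd.
by rewrite e leqNgt nr.
Qed.

End CasimirK.

End QuantumCasimir.

(* The simple head of a highest weight module A x, realised in the space of
   functions on A: the vector b x becomes the function a |-> psi (a b), where
   psi a is the coefficient of x in a x. *)
Section CoefficientModule.
Variables (k : fieldType) (A : algebraType k) (psi : A -> k).
Hypothesis psiB : zmod_morphism psi.

Let psi0 : psi 0 = 0. Proof. by rewrite -(subrr 0) psiB subrr. Qed.

Let psiN x : psi (- x) = - psi x.
Proof. by rewrite -sub0r psiB psi0 sub0r. Qed.

Let psiD x y : psi (x + y) = psi x + psi y.
Proof. by rewrite -[y in LHS]opprK psiB psiN opprK. Qed.

Record cmod := CMod { cmod_val : A -> k;
  _ : exists b, cmod_val = fun a => psi (a * b) }.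

Lemma cmodP (g : cmod) : exists b, cmod_val g = fun a => psi (a * b).
Proof. by case: g. Qed.

Lemma cmod_inj : injective cmod_val.
Proof. by move=> [g hg] [h hh] /= e; case: _ / e hh => hh; congr CMod; exact: Prop_irrelevance. Qed.

HB.instance Definition _ := gen_eqMixin cmod.
HB.instance Definition _ := gen_choiceMixin cmod.

Definition cvec (b : A) : cmod := @CMod (fun a => psi (a * b)) (ex_intro _ b erefl).

Lemma cvec_ind (P : cmod -> Prop) : (forall b, P (cvec b)) -> forall g, P g.
Proof.
move=> h g; have [b e] := cmodP g.
by rewrite (_ : g = cvec b) //; apply: cmod_inj.
Qed.

Lemma cmod_add_subproof (g h : cmod) :
  exists b, (fun a => cmod_val g a + cmod_val h a) = fun a => psi (a * b).
Proof.
have [b eb] := cmodP g; have [c ec] := cmodP h; exists (b + c).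
by apply/funext => a; rewrite eb ec mulrDr psiD.
Qed.

Lemma cmod_opp_subproof (g : cmod) :
  exists b, (fun a => - cmod_val g a) = fun a => psi (a * b).
Proof.
have [b eb] := cmodP g; exists (- b).
by apply/funext => a; rewrite eb mulrN psiN.
Qed.

Lemma cmod_scale_subproof (c : A) (g : cmod) :
  exists b, (fun a => cmod_val g (a * c)) = fun a => psi (a * b).
Proof.
by have [b eb] := cmodP g; exists (c * b); apply/funext => a; rewrite eb mulrA.
Qed.

Definition cmod_add g h := CMod (cmod_add_subproof g h).
Definition cmod_opp g := CMod (cmod_opp_subproof g).
Definition cmod_scale c g := CMod (cmod_scale_subproof c g).

Lemma cmod_addA : associative cmod_add.
Proof. by move=> f g h; apply/cmod_inj/funext => a; exact: addrA. Qed.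
Lemma cmod_addC : commutative cmod_add.
Proof. by move=> f g; apply/cmod_inj/funext => a; exact: addrC. Qed.
Lemma cmod_add0 : left_id (cvec 0) cmod_add.
Proof. by move=> f; apply/cmod_inj/funext => a /=; rewrite mulr0 psi0 add0r. Qed.
Lemma cmod_addN : left_inverse (cvec 0) cmod_opp cmod_add.
Proof. by move=> f; apply/cmod_inj/funext => a /=; rewrite mulr0 psi0 addNr. Qed.

HB.instance Definition _ := GRing.isZmodule.Build cmod cmod_addA cmod_addC cmod_add0 cmod_addN.

Lemma cmod_scaleA a b g : cmod_scale a (cmod_scale b g) = cmod_scale (a * b) g.
Proof. by apply/cmod_inj/funext => c /=; rewrite mulrA. Qed.
Lemma cmod_scale1 : left_id 1 cmod_scale.
Proof. by move=> g; apply/cmod_inj/funext => c /=; rewrite mulr1. Qed.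
Lemma cmod_scaleDr : right_distributive cmod_scale +%R.
Proof. by move=> a g h; apply/cmod_inj/funext. Qed.
Lemma cmod_scaleDl g : {morph cmod_scale^~ g : a b / a + b >-> a + b}.
Proof.
move=> a b; apply/cmod_inj/funext => c /=; have [d ->] := cmodP g.
by rewrite mulrDr mulrDl psiD.
Qed.

HB.instance Definition _ := GRing.Zmodule_isLmodule.Build A cmod
  cmod_scaleA cmod_scale1 cmod_scaleDr cmod_scaleDl.

Definition coef_module : lmodType A := cmod.

Lemma scale_cvec a b : a *: cvec b = cvec (a * b).
Proof. by apply/cmod_inj/funext => c /=; rewrite mulrA. Qed.

Lemma cvecE b a : cmod_val (cvec b) a = psi (a * b). Proof. by []. Qed.

Lemma cmod_val0 a : cmod_val 0 a = 0. Proof. by rewrite /= mulr0 psi0. Qed.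

Hypotheses (psiS : forall c a, psi (c%:S * a) = c * psi a) (psi1 : psi 1 = 1).
Variable pi : A.
Hypothesis psi_pi : forall a b, psi (a * pi * b) = psi a * psi b.

(** The hypothesis [psi_pi] says that [pi] projects onto the line of the generator x. If b x is
    nonzero, some coefficient psi (a b) is nonzero; then pi a sends b x to a nonzero multiple of x,
    and every d x is reached. *)
Lemma cmod_simple (N : set cmod) : submodule N -> N = [set 0] \/ N = setT.
Proof.
move=> [N0 NL]; have Nscale a g : N g -> N (a *: g).
  by move=> Ng; rewrite -[a *: g]addr0; apply: NL.
have [[g [Ng g0]]|hN] := pselect (exists g, N g /\ g <> 0); [right|left].
  elim/cvec_ind: g Ng g0 => b Nb b0.
  have [a ab] : exists a, psi (a * b) != 0.
    apply: contra_notP b0 => h; apply/cmod_inj/funext => a.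
    rewrite cmod_val0 cvecE; apply/eqP; apply: contra_notT h => h.
    by exists a.
  apply/seteqP; split=> // h _; elim/cvec_ind: h => d.
  suff -> : cvec d = (((psi (a * b))^-1)%:S * d * pi * a) *: cvec b by apply: Nscale.
  rewrite scale_cvec; apply/cmod_inj/funext => c; rewrite !cvecE.
  rewrite -(mulrA _ a b) (mulrA c) (mulrA c) psi_pi.
  by rewrite mulrA -cst_central -(mulrA _ c) psiS mulrAC mulVf // mul1r.
apply/seteqP; split=> g; last by move=> ->.
by move=> Ng /=; apply: contra_notP hN => g0; exists g.
Qed.

(** As [e] commutes with [pi], both sides are the value of psi at e pi b. Hence a central idempotent
    acts through the scalar psi e, which is 0 or 1. *)
Lemma psi_central e b : central_idempotent e -> psi (e * b) = psi e * psi b.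
Proof.
case=> _ eC; rewrite -psi_pi (eC pi) -[LHS]mul1r -psi1 -psi_pi mul1r.
by rewrite mulrA.
Qed.

Lemma central_act e (g : cmod) : central_idempotent e -> psi e = 1 -> e *: g = g.
Proof.
move=> eC e1; elim/cvec_ind: g => b; apply/cmod_inj/funext => a /=.
by rewrite -mulrA (mulrA a) -eC.2 -mulrA psi_central // e1 mul1r.
Qed.

Lemma psi_central01 e : central_idempotent e -> psi e = 0 \/ psi e = 1.
Proof.
move=> he; have := psi_central e he; rewrite he.1 => /eqP.
rewrite -subr_eq0 -{1}[psi e]mulr1 -mulrBr mulf_eq0 subr_eq0 => /orP[/eqP ->|/eqP <-].
  by left.
by right.
Qed.

Variables (N : nat) (io : A -> 'M[k]_N).
Hypotheses (io_inj : injective io) (ioB : zmod_morphism io)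
  (ioM : forall a b, io (a * b) = io a *m io b) (io1 : io 1 = 1%:M).

Lemma central_idemB (e f : A) : central_idempotent e -> central_idempotent f ->
  e * f = f -> central_idempotent (e - f).
Proof.
move=> [ee eC] [ff fC] ef; split=> [|x].
  by rewrite mulrBl !mulrBr ee ef fC ef ff subrr subr0.
by rewrite mulrBl mulrBr eC fC.
Qed.

(** Among the central idempotents with psi = 1, take one of minimal rank in the faithful
    representation. If f lies below e, then psi f = 1 forces f = e by minimality, while psi f = 0
    gives e - f the value 1, hence e - f = e. *)
Lemma block_exists : exists e : A, block_idempotent e /\ psi e = 1.
Proof.
pose Q n := `[< exists e : A, [/\ central_idempotent e, psi e = 1 & \rank (io e) = n] >].
have exQ : exists n, Q n.
  exists (\rank (io 1)); apply/asboolP; exists (1 : A); split=> //.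
  by split=> [|x]; rewrite ?mulr1 ?mul1r.
have [e [eC e1 _] emin] : exists2 e : A, [/\ central_idempotent e, psi e = 1 & true] &
   forall f : A, central_idempotent f -> psi f = 1 -> (\rank (io e) <= \rank (io f))%N.
  case: (ex_minnP exQ) => n /asboolP[e [eC e1 en]] nmin; exists e => //.
  by move=> f fC f1; rewrite en; apply: nmin; apply/asboolP; exists f.
have eq_min f : central_idempotent f -> e * f = f -> psi f = 1 -> f = e.
  move=> fC ef f1; apply: io_inj.
  have sub : (io f <= io e)%MS by rewrite -{1}ef -(fC.2 e) ioM submxMl.
  have : (io e <= io f)%MS by rewrite -(geq_leqif (mxrank_leqif_sup sub)) emin.
  case/submxP => D eD; rewrite -[RHS](_ : io e *m io f = _).
    by rewrite -ioM ef.
  by rewrite eD -mulmxA -ioM fC.1.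
exists e; split=> //; split=> //.
  by apply: contra_eq_neq e1 => ->; rewrite psi0 eq_sym oner_eq0.
move=> f fC ef; case: (psi_central01 fC) => [f0|f1]; last by right; apply: eq_min.
left; have : e - f = e.
  apply: eq_min; first exact: central_idemB.
    by rewrite mulrBr eC.1 ef.
  by rewrite psiB e1 f0 subr0.
by move=> h; rewrite -[f]opprK -[- f](addKr e) h addNr oppr0.
Qed.

End CoefficientModule.

(** * Blocks and central elements *)

Section FiniteDimension.
Variables (k : fieldType) (A : algebraType k) (N : nat) (io : A -> 'M[k]_N).
Hypotheses (io_inj : injective io) (ioB : zmod_morphism io)
  (ioM : forall a b, io (a * b) = io a *m io b) (ioS : forall c, io c%:S = c%:M).

Lemma io0 : io 0 = 0. Proof. by rewrite -(subrr 0) ioB subrr. Qed.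

Lemma ioD x y : io (x + y) = io x + io y.
Proof. by rewrite -[y in LHS]opprK ioB -(sub0r y) ioB io0 sub0r opprK. Qed.

Lemma io_scale c a : io (c%:S * a) = c *: io a.
Proof. by rewrite ioM ioS mul_scalar_mx. Qed.

Lemma io_sum (I : Type) (s : seq I) (F : I -> A) :
  io (\sum_(i <- s) F i) = \sum_(i <- s) io (F i).
Proof. by elim: s => [|i s IHs]; rewrite ?big_nil ?io0 // !big_cons ioD IHs. Qed.

Lemma algebra_fin_dim : exists s : seq A, forall b, exists c : nat -> k,
  b = \sum_(i < size s) (c i)%:S * s`_i.
Proof.
pose Q n := `[< exists s : seq A, free (map io s) /\ size s = n >].
have exQ : exists n, Q n by exists 0%N; apply/asboolP; exists [::]; rewrite nil_free.
have ubQ n : Q n -> (n <= \dim {: 'M[k]_N})%N.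
  move=> /asboolP[s [fs <-]]; rewrite -(size_map io s) -(eqP fs).
  exact: dimvS (subvf _).
case: (ex_maxnP exQ ubQ) => n /asboolP[s [fs sn]] nmax; exists s => b.
have : io b \in <<map io s>>%VS.
  apply: contraT => nb; have : Q n.+1.
    by apply/asboolP; exists (b :: s); rewrite /= free_cons nb fs sn.
  by move/nmax; rewrite ltnn.
move/(coord_span (X := in_tuple (map io s))) => e.
exists (fun i => if insub i is Some j then coord (in_tuple (map io s)) j (io b) else 0).
apply: io_inj; rewrite {1}e io_sum.
have sz : size (map io s) = size s by rewrite size_map.
rewrite -(big_mkord xpredT (fun i => io ((if insub i is Some j then _ else 0)%:S * s`_i))) -sz big_mkord.
apply: eq_bigr => i _; rewrite io_scale insubT ?ltn_ord //= => lti.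
congr (coord _ _ _ *: _); first exact: val_inj.
by rewrite /= (nth_map 0) // -sz.
Qed.

Lemma generated_fin_dim (V : lmodType A) (w : V) : generates w -> fin_dim V.
Proof.
move=> gw; have [s hs] := algebra_fin_dim.
exists (map (fun b => b *: w) s) => x; have [a ->] := gw x.
have [c {1}->] := hs a; exists c; rewrite scaler_suml size_map.
by apply: eq_bigr => i _; rewrite (nth_map 0) // scalerA.
Qed.

End FiniteDimension.

Section Separation.
Variables (k : fieldType) (A : algebraType k).

Definition peval (z : A) (p : {poly k}) : A := \sum_(i < size p) (p`_i)%:S * z ^+ i.

Lemma peval_scale (V : lmodType A) (z : A) (al : k) p (x : V) :
  (forall y : V, z *: y = al%:S *: y) -> peval z p *: x = (p.[al])%:S *: x.
Proof.
move=> hz; rewrite /peval horner_coef rmorph_sum !scaler_suml.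
apply: eq_bigr => i _; rewrite rmorphM -!scalerA; congr (_ *: _).
elim: (nat_of_ord i) => [|n IHn]; first by rewrite !expr0 rmorph1.
by rewrite !exprS -scalerA IHn hz scalerA -rmorphM.
Qed.

Lemma peval_central (z : A) p : (forall x, z * x = x * z) ->
  forall x, peval z p * x = x * peval z p.
Proof.
move=> hz x; rewrite /peval mulr_suml mulr_sumr; apply: eq_bigr => i _.
rewrite -mulrA [RHS]mulrA -[in RHS]cst_central -[in RHS]mulrA; congr (_ * _).
elim: (nat_of_ord i) => [|n IHn]; first by rewrite !expr0 mul1r mulr1.
by rewrite exprS -mulrA IHn mulrA hz -mulrA.
Qed.

Lemma scale_cst_eq0 (V : lmodType A) (a : k) (x : V) : a%:S *: x = 0 -> x != 0 -> a = 0.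
Proof.
move=> ax x0; apply/eqP; apply: contraNT x0 => a0.
by rewrite -[x]scale1r -(rmorph1 (@cst _ A)) -(mulVf a0) rmorphM -scalerA ax scaler0.
Qed.

Variables (N : nat) (io : A -> 'M[k]_N).
Hypotheses (io_inj : injective io) (ioB : zmod_morphism io)
  (ioM : forall a b, io (a * b) = io a *m io b) (io1 : io 1 = 1%:M)
  (ioS : forall c, io c%:S = c%:M).

(* An idempotent polynomial in z separates the eigenvalues of a central z. *)
Lemma same_block_eigen (V W : lmodType A) (z : A) (al be : k) :
  (forall x, z * x = x * z) -> (exists x : V, x != 0) -> (exists y : W, y != 0) ->
  (forall x : V, z *: x = al%:S *: x) -> (forall y : W, z *: y = be%:S *: y) ->
  same_block V W -> al = be.
Proof.
(* Evaluation of polynomials at a matrix asks for positive size. In size 0 the algebra is trivial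
   and has no nonzero module. *)
case: N io io_inj ioB ioM io1 ioS => [|n] f f_inj fB fM f1 fS.
  move=> zC [x x0]; have : (1 : A) = 0.
    by apply: f_inj; apply/matrixP; case.
  by move=> h; case/eqP: x0; rewrite -[x]scale1r h scale0r.
move=> zC [x x0] [y y0] hV hW [e [eB eV eW]].
have fX m : f (z ^+ m) = f z ^+ m.
  by elim: m => [|m IHm]; rewrite ?expr0 // !exprS fM IHm.
have fp p : f (peval z p) = horner_mx (f z) p.
  rewrite /peval (io_sum fB) -[p in RHS]coefK poly_def rmorph_sum.
  apply: eq_bigr => i _; rewrite (io_scale fM fS) fX.
by rewrite -mul_polyC rmorphM /= horner_mx_C rmorphXn /= horner_mx_X -mul_scalar_mx.
have pM p q : peval z (p * q) = peval z p * peval z q.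
  by apply: f_inj; rewrite fM !fp rmorphM.
have pB p q : peval z (p - q) = peval z p - peval z q.
  by apply: f_inj; rewrite fB !fp rmorphB.
pose P := char_poly (f z).
have P0 : P != 0 by rewrite -lead_coef_eq0 (monicP (char_poly_monic _)) oner_eq0.
have Pz p : peval z (P * p) = 0.
  apply: f_inj; rewrite fp rmorphM (io0 fB) /P.
  by have := Cayley_Hamilton (f z) => /= ->; rewrite mul0r.
have Pal : P.[al] = 0.
  by apply: (scale_cst_eq0 _ x0); rewrite -(peval_scale _ _ hV) -[P]mulr1 Pz scale0r.
have Pbe : P.[be] = 0.
  by apply: (scale_cst_eq0 _ y0); rewrite -(peval_scale _ _ hW) -[P]mulr1 Pz scale0r.
apply/eqP; apply: contraT => albe.
have [m [g ga eP]] := multiplicity_XsubC P al; rewrite P0 /= in ga.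
have m0 : (0 < m)%N.
  rewrite lt0n; apply: contraNneq ga => m0; rewrite -[g]mulr1 -(expr0 ('X - al%:P)) -m0 -eP.
  exact/rootP.
have gbe : g.[be] = 0.
  move/eqP: Pbe; rewrite eP hornerM horner_exp hornerXsubC mulf_eq0 expf_eq0 m0 /=.
  by rewrite subr_eq0 [be == al]eq_sym (negPf albe) orbF => /eqP.
have [[u w] uw] : exists u, u.1 * g + u.2 * ('X - al%:P) ^+ m = 1.
  apply/Bezout_eq1_coprimepP; rewrite coprimep_expr //.
  by rewrite coprimep_XsubC.
rewrite /= in uw.
(* The factors g and (X - al)^m of the characteristic polynomial P are coprime. By the Bezout
   relation, u g is idempotent modulo P, with value 1 at [al], and it vanishes at [be] because g
   does. *)
pose h := peval z (u * g).
have hC : central_idempotent h.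
  split; last exact: peval_central.
  rewrite -pM -[RHS]subr0 -(Pz (u * w)) -pB; congr (peval z _).
  by rewrite -[X in _ = X - _]mulr1 -uw eP; ring.
have [[ee eC] e0 emin] := eB.
have ehC : central_idempotent (e * h).
  split=> [|a]; last by rewrite -mulrA hC.2 mulrA eC mulrA.
  by rewrite -mulrA (mulrA h) hC.2 -(mulrA e h h) hC.1 mulrA ee.
have hx : h *: x = x.
  rewrite (peval_scale _ _ hV); have := congr1 (fun p => p.[al]) uw.
  rewrite hornerD [X in _ + X]hornerM horner_exp hornerXsubC subrr expr0n -[m == 0%N]negbK -lt0n m0.
  by rewrite mulr0 addr0 hornerC => ->; rewrite rmorph1 scale1r.
have hy : h *: y = 0.
  by rewrite (peval_scale _ _ hW) hornerM gbe mulr0 rmorph0 scale0r.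
case: (emin (e * h) ehC); first by rewrite mulrA ee.
- move=> eh; case/eqP: x0; by rewrite -hx -(eV (h *: x)) scalerA eh scale0r.
- move=> eh; case/eqP: y0; by rewrite -(eW y) -eh -scalerA hy scaler0.
Qed.

End Separation.

(** * Weyl modules in tensor space *)

Section Weyl.
Variables (R : fieldType).
Implicit Types (x y : wvec R) (I J K : seq 'I_2) (t : R).

(* [gbin t m i] is the Gaussian binomial coefficient of m + i over m. *)
Fixpoint gbin t m : nat -> R :=
  match m with
  | 0%N => fun=> 1
  | m'.+1 => fix g i := match i with
      | 0%N => 1
      | i'.+1 => g i' + t ^+ i'.+1 * gbin t m' i'.+1
      end
  end.

Lemma gbinm0 t m : gbin t m 0 = 1. Proof. by case: m. Qed.

Lemma gbinSS t m i : gbin t m.+1 i.+1 = gbin t m.+1 i + t ^+ i.+1 * gbin t m i.+1.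
Proof. by []. Qed.

Lemma gbin1 t i : gbin t 1 i = \sum_(s < i.+1) t ^+ s.
Proof.
elim: i => [|i IHi]; first by rewrite gbinm0 big_ord1.
by rewrite gbinSS IHi [RHS]big_ord_recr [gbin t 0 _]/1 mulr1.
Qed.

Lemma gbinn1 t n : gbin t n 1 = \sum_(s < n.+1) t ^+ s.
Proof.
elim: n => [|n IHn]; first by rewrite big_ord1.
rewrite gbinSS gbinm0 IHn [RHS]big_ord_recl expr0 mulr_sumr; congr (_ + _).
by apply: eq_bigr => i _; rewrite expr1 exprS.
Qed.

(** The Gaussian binomial is the weighted count of the ways to split the m + n changed letters into
    those changed by each operator. *)
Lemma divop_divop i t m n x I :
  divop i t m (divop i t n x) I = gbin t m n * divop i t (m + n) x I.
Proof.
elim: I m n x => [|j I IHI] m n x.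
  by case: m n => [|m] [|n] //=; rewrite ?mul1r ?mulr0.
case: (ord2P i j) => ->.
  rewrite !divop_self tlv_divop_self tlv_divop_other divopD IHI.
  case: m => [|m]; case: n => [|n]; rewrite ?add0n ?addn0 ?gbinm0.
  - by rewrite divop0v !addr0.
  - by rewrite divop_0 !mul1r addr0.
  - by rewrite divop0v addr0 expr0 divopZ IHI gbinm0 addn0 !mul1r.
  rewrite IHI divopZ IHI addSn addnS gbinSS -addrA mulrDr; congr (_ + _).
  by rewrite addSn mulrDl mulrA.
by rewrite !divop_other tlv_divop_other divopZ IHI exprD; ring.
Qed.

(** Up to powers of v this is F^(i) applied to the word 0...0, so these vectors form the standard
    basis of the Weyl module of highest weight (d, 0). *)
Definition symv t d i : wvec R := divop 1 t i (wdelta R (nseq d 0)).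

Lemma tlv0_sym t d i : tlv 0 (symv t d.+1 i) = fun K => t ^+ i * symv t d i K.
Proof. by rewrite /symv tlv_divop10 tlv_delta. Qed.

Lemma tlv1_sym t d i : tlv 1 (symv t d.+1 i) =
  fun K => if i is i'.+1 then symv t d i' K else 0.
Proof.
rewrite /symv tlv_divop11 !tlv_delta /=; apply/funext => K.
by rewrite divop0v add0r.
Qed.

Lemma symv_gt t d i I : (d < i)%N -> symv t d i I = 0.
Proof.
elim: I d i => [|j I IHI] d i lt; first by case: i lt => [|i].
case: d lt => [|d] lt.
  rewrite /symv -(divop0v 1 t i (j :: I)); apply: divop_eq => K sK cK.
  by rewrite /wdelta; case: K sK cK.
elim/ord2_ind: j; rewrite -/(tlv _ _ I).
  by rewrite -[LHS]/(tlv 0 (symv t d.+1 i) I) tlv0_sym IHI ?mulr0 // ltnW.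
rewrite -[LHS]/(tlv 1 (symv t d.+1 i) I) tlv1_sym.
by case: i lt => // i lt; rewrite IHI.
Qed.

Lemma symv_up t d i m I :
  divop 1 t m (symv t d i) I = gbin t m i * symv t d (m + i) I.
Proof. exact: divop_divop. Qed.

Lemma symv_nil t i j I : symv t 0 i (j :: I) = 0.
Proof.
rewrite /symv -(divop0v 1 t i (j :: I)); apply: divop_eq => K sK _.
by rewrite /wdelta; case: K sK.
Qed.

(** The rule that E^(m) F^(i) y is F^(i-m) y times the Gaussian binomial of d - i + m over m, in
    unbalanced normalisation. The induction removes the first letter; for a letter 0 it reduces to
    Pascal's rule. *)
Lemma symv_down q d i m I : q != 0 ->
  divop 0 q m (symv q^-1 d i) I =
  if (m <= i <= d)%N then q ^+ (m * i) / q ^+ (m * m) * gbin q^-1 (d - i) m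
     * symv q^-1 d (i - m) I else 0.
Proof.
move=> q0; have qn n : q ^+ n != 0 by rewrite expf_neq0.
case: m => [|m].
  rewrite divop_0 leq0n /= mul0n subn0 expr0 gbinm0 divr1 !mul1r.
  by case: leqP => // lt; exact: symv_gt.
elim: I d i m => [|j I IHI] d i m.
  rewrite /=; case: ifP => // /andP[mi id]; rewrite /symv /=.
  case e: (i - m.+1)%N => [|k]; last by rewrite mulr0.
  by rewrite /wdelta; case: d id => [|d] id; [lia|rewrite mulr0].
case: d => [|d].
  rewrite symv_nil mulr0 if_same -(divop0v 0 q m.+1 (j :: I)).
  by apply: divop_eq => K sK cK; case: K sK cK => // a K _ _; rewrite symv_nil.
have E n : (if n is n'.+1 then divop 0 q n' (fun K => if i is i'.+1
      then symv q^-1 d i' K else 0) I else 0) = if (0 < n <= i)%N && (i <= d.+1)%N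
    then q ^+ (n.-1 * i.-1) / q ^+ (n.-1 * n.-1) * gbin q^-1 (d - i.-1) n.-1
    * symv q^-1 d (i - n) I else 0.
  case: n => [|[|n]] //; case: i => [|i] //; rewrite ?divop0v ?andbF //.
    rewrite divop_0 /= mul0n expr0 gbinm0 divr1 !mul1r subSS subn0.
    by rewrite ltnS; case: leqP => // lt; rewrite symv_gt.
  by rewrite IHI !ltnS /= subSS.
elim/ord2_ind: j.
  rewrite divop00 tlv0_sym tlv1_sym divopZ IHI (E m.+1).
  rewrite -[symv q^-1 d.+1 _ _]/(tlv 0 (symv q^-1 d.+1 (i - m.+1)) I) tlv0_sym.
  case: i {E} => [|i] /=; first by rewrite mulr0 addr0.
  rewrite !subSS !ltnS; case: (leqP m i) => mi /=; last by rewrite mulr0 addr0.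
  case: (ltngtP i d) => id /=; last 2 first.
  - by rewrite mulr0 addr0.
  - rewrite id subnn /= mulr0 add0r -id !mulr1 exprVn.
    rewrite -(subnK mi); move: (i - m)%N => e; rewrite addnK mulrA; congr (_ * _).
    by rewrite !mulSn !mulnS !mulnDr ?(addSn, addnS) ?(exprS, exprD); field; rewrite ?qn ?q0.
  have -> : (d - i)%N = (d - i.+1).+1 by lia.
  rewrite gbinSS !mulrA -!mulrDl; congr (_ * _).
  rewrite -(subnK mi); move: (i - m)%N (d - _)%N => e n; rewrite addnK.
  rewrite !exprVn !mulSn !mulnS !mulnDr ?(addSn, addnS, exprS, exprD) //.
  move: (gbin _ _ _) (gbin _ _ _) => g g'.
  by field; rewrite !qn q0.
rewrite divop01 tlv1_sym.
rewrite -[symv q^-1 d.+1 _ _]/(tlv 1 (symv q^-1 d.+1 (i - m.+1)) I) tlv1_sym.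
have := E m.+2; case: i {E} => [|i]; first by move=> _; rewrite divop0v mulr0.
move=> ->; rewrite !subSS !ltnS /=.
case: (ltngtP m i) => mi /=; last 2 first.
- by rewrite mulr0.
- by rewrite mi subnn mulr0 mulr0 if_same.
case: (i <= d)%N; last by rewrite mulr0.
rewrite (_ : (i - m)%N = (i - m.+1).+1); last by lia.
by rewrite (mulnS m.+1 i) exprD; ring.
Qed.

Definition consv j x : wvec R :=
  fun K => if K is i :: J then if i == j then x J else 0 else 0.

Lemma tlv_consv i j x : tlv i (consv j x) = if i == j then x else fun=> 0.
Proof. by apply/funext => K; rewrite /tlv /consv; case: eqP. Qed.

Lemma consvZ j a x : consv j (fun K => a * x K) = fun K => a * consv j x K.
Proof.
apply/funext => -[|i K] /=; first by rewrite mulr0.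
by case: eqP; rewrite ?mulr0.
Qed.

Lemma divop_consv_self i t m x :
  divop i t m (consv i x) = consv i (divop i t m x).
Proof.
apply/funext => -[|j I]; first by case: m.
case: (ord2P i j) => ->.
  rewrite divop_self !tlv_consv eqxx rev_ord2_neq /= eqxx.
  by case: m => [|m]; rewrite ?divop0v addr0.
by rewrite divop_other tlv_consv rev_ord2_neq divop0v mulr0 /= rev_ord2_neq.
Qed.

Lemma divop_consv_other i t m x : divop i t m (consv (rev_ord i) x) =
  fun K => t ^+ m * consv (rev_ord i) (divop i t m x) K
    + (if m is m'.+1 then consv i (divop i t m' x) K else 0).
Proof.
apply/funext => -[|j I]; first by case: m => [|m] /=; rewrite mulr0 addr0.
case: (ord2P i j) => ->.
  rewrite divop_self !tlv_consv eqxx (eq_sym i) rev_ord2_neq divop0v /=.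
  by rewrite eq_sym rev_ord2_neq mulr0 eqxx.
rewrite divop_other tlv_consv eqxx /= eqxx rev_ord2_neq.
by case: m => [|m]; rewrite addr0.
Qed.

(** Tensoring on the left with 01 - 10, a vector of weight (1, 1) spanning a copy of the quantum
    determinant: this passes from highest weight (s + d, s) to (s + d + 1, s + 1). *)
Definition detv x : wvec R :=
  fun K => consv 0 (consv 1 x) K - consv 1 (consv 0 x) K.

(** A change inside 01 or 10 produces the prefix ii from both, and the two contributions cancel. The
    changes inside [x] remain, and each of them has one more letter different from [i] on its left,
    whence t^m. *)
Lemma divop_detv i t m x I :
  divop i t m (detv x) I = t ^+ m * detv (divop i t m x) I.
Proof.
have E : divop i t m (detv x) I = divop i t m (consv 0 (consv 1 x)) I
    - divop i t m (consv 1 (consv 0 x)) I.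
  rewrite addrC -mulN1r -divop_lin; congr divop; apply/funext => K.
  by rewrite /detv mulN1r addrC.
have S0 u := divop_consv_self 0 t u; have S1 u := divop_consv_self 1 t u.
have O0 u y := divop_consv_other 0 t u y; have O1 u y := divop_consv_other 1 t u y.
rewrite E {E} /detv; elim/ord2_ind: i.
  rewrite rev_ord20 in O0; rewrite S0 !O0 S0.
  have -> : (fun K => t ^+ m * consv 1 (divop 0 t m x) K + match m with
     | 0%N => 0 | m'.+1 => consv 0 (divop 0 t m' x) K end) = fun K =>
     t ^+ m * consv 1 (divop 0 t m x) K + (if m is m'.+1 then consv 0 (divop 0 t m' x) else fun=> 0) K.
    by apply/funext => K; case: (m).
  rewrite (_ : consv 0 (fun K => _ + _) I = t ^+ m * consv 0 (consv 1 (divop 0 t m x)) I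
     + (if m is m'.+1 then consv 0 (divop 0 t m' (consv 0 x)) I else 0)); first by ring.
  case: m => [|m]; rewrite /= ?S0; case: I => [|a I] /=; rewrite ?mulr0 ?addr0 //;
  by case: eqP; rewrite ?mulr0 ?addr0.
rewrite rev_ord21 in O1; rewrite S1 !O1 S1.
have -> : (fun K => t ^+ m * consv 0 (divop 1 t m x) K + match m with
     | 0%N => 0 | m'.+1 => consv 1 (divop 1 t m' x) K end) = fun K =>
     t ^+ m * consv 0 (divop 1 t m x) K + (if m is m'.+1 then consv 1 (divop 1 t m' x) else fun=> 0) K.
  by apply/funext => K; case: (m).
rewrite (_ : consv 1 (fun K => _ + _) I = t ^+ m * consv 1 (consv 0 (divop 1 t m x)) I
     + (if m is m'.+1 then consv 1 (divop 1 t m' (consv 1 x)) I else 0)); first by ring.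
case: m => [|m]; rewrite /= ?S1; case: I => [|a I] /=; rewrite ?mulr0 ?addr0 //;
by case: eqP; rewrite ?mulr0 ?addr0.
Qed.

Lemma detvZ a x I : detv (fun K => a * x K) I = a * detv x I.
Proof. by rewrite /detv !consvZ mulrBr. Qed.

(* A basis vector of the Weyl module of highest weight (s + d, s) inside the
   tensor space of degree d + 2 s. *)
Definition weylv t s d i : wvec R := iter s detv (symv t d i).

Lemma divop_iter_detv i t m s x I :
  divop i t m (iter s detv x) I = t ^+ (m * s) * iter s detv (divop i t m x) I.
Proof.
elim: s I => [|s IHs] I; first by rewrite muln0 expr0 mul1r.
rewrite /= divop_detv (_ : divop i t m (iter s detv x) =
  fun K => t ^+ (m * s) * iter s detv (divop i t m x) K).
  by rewrite detvZ mulrA -exprD mulnS.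
by apply/funext => K; rewrite IHs.
Qed.

Lemma iter_detvZ s a x I : iter s detv (fun K => a * x K) I = a * iter s detv x I.
Proof.
elim: s I => //= s IHs I; rewrite -detvZ; congr (detv _ I).
by apply/funext => K; rewrite IHs.
Qed.

Lemma weylv_up t s d i m I : divop 1 t m (weylv t s d i) I =
  t ^+ (m * s) * gbin t m i * weylv t s d (m + i) I.
Proof.
have e : divop 1 t m (symv t d i) = fun K => gbin t m i * symv t d (m + i) K.
  by apply/funext => K; exact: symv_up.
by rewrite divop_iter_detv e iter_detvZ mulrA.
Qed.

Lemma weylv_down q s d i m I : q != 0 -> divop 0 q m (weylv q^-1 s d i) I =
  if (m <= i <= d)%N then q ^+ (m * s) * (q ^+ (m * i) / q ^+ (m * m)
    * gbin q^-1 (d - i) m) * weylv q^-1 s d (i - m) I else 0.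
Proof.
move=> q0; rewrite divop_iter_detv; case: ifP => h.
  have -> : divop 0 q m (symv q^-1 d i) = fun K => q ^+ (m * i) / q ^+ (m * m) *
    gbin q^-1 (d - i) m * symv q^-1 d (i - m) K.
    by apply/funext => K; rewrite symv_down // h.
  by rewrite iter_detvZ !mulrA.
rewrite (_ : divop 0 q m _ = fun K => 0 * (fun=> 0) K).
  by rewrite iter_detvZ mul0r mulr0.
by apply/funext => K; rewrite symv_down // h mul0r.
Qed.

Lemma symv_supp t d i I : symv t d i I != 0 -> size I = d /\ n1 I = i.
Proof.
move=> h; have [[K [sK cK dK]]|nK] := pselect (exists K,
    [/\ size K = size I, (n1 K + i = n1 I)%N & wdelta R (nseq d 0) K != 0]); last first.
  case/eqP: h; rewrite /symv -(divop0v 1 t i I); apply: divop_eq => K sK cK.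
  by apply/eqP; apply: contra_notT nK => dK; exists K.
move: dK; rewrite /wdelta; case: (K =P _) => [eK _|_ /eqP //].
by rewrite -sK -cK eK /n1 count_nseq size_nseq mul0n.
Qed.

Lemma weylv_supp t s d i I : weylv t s d i I != 0 ->
  size I = (s + s + d)%N /\ n1 I = (s + i)%N.
Proof.
elim: s I => [|s IHs] I; first by move/symv_supp.
case: I => [|a [|b I]]; rewrite /= /detv /= ?subr0 ?eqxx //.
  by case: (a == 0); case: (a == 1); rewrite ?subr0 ?eqxx.
elim/ord2_ind: a; elim/ord2_ind: b; rewrite /= ?subr0 ?sub0r ?oppr_eq0 ?eqxx //.
  by move=> /IHs[-> e]; rewrite /n1 /= -/(n1 I) e; lia.
by move=> /IHs[-> e]; rewrite /n1 /= -/(n1 I) e; lia.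
Qed.

Lemma weylv_gt t s d i : (d < i)%N -> weylv t s d i = fun=> 0.
Proof.
move=> lt; rewrite /weylv (_ : symv t d i = fun K => 0 * (fun=> 0) K).
  by apply/funext => I; rewrite iter_detvZ mul0r.
by apply/funext => K; rewrite symv_gt // mul0r.
Qed.

(** A test word for [weylv t s d i]: this vector takes a power of t on it, while the other vectors
    of the string vanish there by weight. Coordinates along the string are read off on such
    words. *)
Definition wword s d i : seq 'I_2 :=
  iter s (fun K => [:: 0, 1 & K]) (nseq (d - i) 0 ++ nseq i 1).

Lemma size_wword s d i : (i <= d)%N -> size (wword s d i) = (s + s + d)%N.
Proof.
move=> id; rewrite /wword; elim: s => [|s IHs] /=; last by rewrite IHs; lia.
by rewrite size_cat !size_nseq; lia.
Qed.

Lemma n1_wword s d i : n1 (wword s d i) = (s + i)%N.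
Proof.
rewrite /wword /n1; elim: s => [|s IHs] /=; last by rewrite IHs; lia.
by rewrite count_cat !count_nseq /=; lia.
Qed.

Lemma weylv_wword t s d i : (i <= d)%N ->
  weylv t s d i (wword s d i) = t ^+ (i * (d - i)).
Proof.
move=> id; rewrite /weylv /wword; elim: s => [|s IHs]; last first.
  by rewrite /= /detv /= subr0 IHs.
rewrite /=; move: (d - i)%N (subnK id) => e <-.
elim: e => [|e IHe]; last first.
  by rewrite /= -[LHS]/(tlv 0 (symv t (e + i).+1 i) (nseq e 0 ++ nseq i 1)) tlv0_sym IHe -exprD mulnS.
rewrite /= muln0 expr0 add0n; elim: i {id} => [|i IHi] //=.
by rewrite -[LHS]/(tlv 1 (symv t i.+1 i.+1) (nseq i 1)) tlv1_sym IHi.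
Qed.

End Weyl.

(** * The string y_0, ..., y_d and its coordinates *)

Section WeylVectors.
Variables (k : fieldType) (eps : k).
Hypothesis eps0 : eps != 0.
Variables (r s d : nat).
Hypothesis hr : (s + s + d)%N = r.
Local Notation q := (eps ^+ 2).
Local Notation N := #|{: r.-tuple 'I_2}|.

Definition yv i : 'cV[k]_N := vecw r (weylv q^-1 s d i).

Lemma yv_gt i : (d < i)%N -> yv i = 0.
Proof. by move=> lt; apply/matrixP => a b; rewrite !mxE weylv_gt. Qed.

Lemma dop_weylv w i I : size I = r ->
  dop w (weylv q^-1 s d i) I = w (s + (d - i))%N (s + i)%N * weylv q^-1 s d i I.
Proof.
move=> sI; rewrite /dop; have [->|] := eqVneq (weylv q^-1 s d i I) 0.
  by rewrite !mulr0.
case: (leqP i d) => [id|lt]; last by rewrite weylv_gt ?eqxx.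
move/weylv_supp => [sz e1]; have := size_count2 I; rewrite -/(n0 I) -/(n1 I) e1 sz => e0.
by congr (w _ _ * _); move: e0 id; clear; lia.
Qed.

Lemma dop_yv w i : mxop r (dop w) *m yv i = w (s + (d - i))%N (s + i)%N *: yv i.
Proof.
rewrite mxop_vec; last exact: lop_dop.
by apply/matrixP => a b; rewrite !mxE dop_weylv ?size_wd.
Qed.

Lemma mxop_yv0 D i : lop D -> (forall I, D (weylv q^-1 s d i) I = 0) -> mxop r D *m yv i = 0.
Proof.
by move=> lD h; rewrite mxop_vec //; apply/matrixP => a b; rewrite !mxE.
Qed.

Lemma Eop_yv m i : exists c, mxop r (Eop eps m) *m yv i = c *: yv (i - m).
Proof.
case e : (m <= i <= d)%N; last first.
  exists 0; rewrite scale0r; apply: mxop_yv0; first exact: lop_Eop.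
  by move=> I; rewrite /Eop weylv_down ?q0 // e mulr0.
rewrite mxop_vec; last exact: lop_Eop.
eexists; apply/matrixP => a b; rewrite !mxE /Eop weylv_down ?q0 // e mulrCA.
rewrite [X in _ * X](dop_weylv (fun a _ => eps ^+ (m * m) / eps ^+ (m * a))) ?size_wd //.
exact: mulrA.
Qed.

Lemma Eop_yv0 m : (0 < m)%N -> mxop r (Eop eps m) *m yv 0 = 0.
Proof.
move=> m0; apply: mxop_yv0; first exact: lop_Eop.
by move=> I; rewrite /Eop weylv_down ?q0 // leqNgt m0 mulr0.
Qed.

Lemma Fop_yv m i : exists c, mxop r (Fop eps m) *m yv i = c *: yv (m + i) /\
  (c == 0) = (gbin q^-1 m i == 0).
Proof.
rewrite mxop_vec; last exact: lop_Fop.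
eexists; split.
  apply/matrixP => a b; rewrite !mxE /Fop weylv_up mulrCA.
  rewrite [X in _ * X](dop_weylv (fun a b => eps ^+ (m * m + 2 * m * a) / eps ^+ (m * b)))
    ?size_wd //.
  exact: mulrA.
rewrite -mulrA mulf_eq0 expf_eq0 invr_eq0 expf_eq0 (negPf eps0) !andbF /=.
by rewrite mulf_eq0 mulf_eq0 invr_eq0 !expf_eq0 (negPf eps0) !andbF /= orbF.
Qed.

(* E^(m) kills y_b as soon as E does, since E^m = [m]! E^(m) and [m]! <> 0 for
   m < l, while E^(m) y_b = 0 for m > b. *)
Lemma Eop_sing l b m : (forall u, (0 < u < l)%N -> \sum_(i < u) q ^+ i != 0) ->
  (b < l)%N -> \sum_(i < (d - b).+1) q^-1 ^+ i = 0 -> (0 < m)%N ->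
  mxop r (Eop eps m) *m yv b = 0.
Proof.
move=> nz bl h0 m0; apply: mxop_yv0; first exact: lop_Eop.
move=> I; rewrite /Eop (_ : divop _ _ _ _ _ = 0) ?mulr0 //.
elim: m m0 I => // m IHm _ I.
case: (leqP m.+1 b) => mb; last first.
  by rewrite weylv_down ?q0 // leqNgt mb.
case: m IHm mb => [|m] IHm mb.
  by rewrite weylv_down ?q0 // gbinn1 h0 mulr0 mulr0 mul0r if_same.
have ml : \sum_(i < m.+2) q ^+ i != 0 by apply: nz; lia.
apply: (mulfI ml); rewrite -divop_comp mulr0.
rewrite (_ : divop 0 q m.+1 _ = fun=> 0) ?divop0v //.
by apply/funext => K; apply: IHm; lia.
Qed.

(** Used with n = l for the two small algebras and n = d + 1 for the full one. Indices beyond d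
    contribute zero vectors, so l and d need not be compared. *)
Definition Sp n (x : 'cV[k]_N) := exists c : nat -> k, x = \sum_(i < n) c i *: yv i.

Lemma Sp_yv n i : (i < n)%N -> Sp n (yv i).
Proof.
move=> lt; exists (fun j => (j == i)%:R); rewrite (bigD1 (Ordinal lt)) //= eqxx scale1r.
rewrite big1 ?addr0 // => j ji; rewrite (_ : (_ == _) = false) ?scale0r //.
by apply: contraNF ji => /eqP e; apply/eqP/val_inj.
Qed.

Lemma Sp_lin n a x y : Sp n x -> Sp n y -> Sp n (a *: x + y).
Proof.
move=> [c ->] [e ->]; exists (fun i => a * c i + e i).
rewrite scaler_sumr -big_split; apply: eq_bigr => i _.
by rewrite scalerDl scalerA.
Qed.

Lemma Sp0 n : Sp n 0.
Proof. by exists (fun=> 0); rewrite big1 // => i _; rewrite scale0r. Qed.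

Lemma SpZ n a x : Sp n x -> Sp n (a *: x).
Proof. by move=> h; rewrite -[_ *: _]addr0; apply: Sp_lin => //; apply: Sp0. Qed.

Lemma Sp_stable n (X : 'M[k]_N) : (forall i, (i < n)%N -> Sp n (X *m yv i)) ->
  forall x, Sp n x -> Sp n (X *m x).
Proof.
move=> h x [c ->]; rewrite mulmx_sumr.
elim/big_ind: _ => [|y z hy hz|i _]; first exact: Sp0.
  by rewrite -[y]scale1r; apply: Sp_lin.
by rewrite -scalemxAr; apply/SpZ/h.
Qed.

Definition wcoef j (x : 'cV[k]_N) : k :=
  x (rk r (wword s d j)) 0 / q^-1 ^+ (j * (d - j)).

Lemma wcoef_lin j a x y : wcoef j (a *: x + y) = a * wcoef j x + wcoef j y.
Proof. by rewrite /wcoef !mxE mulrDl mulrA. Qed.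

Lemma wcoef_yv j i : (j <= d)%N -> wcoef j (yv i) = (i == j)%:R.
Proof.
move=> jd; rewrite /wcoef mxE rkK ?size_wword //.
have [->|ij] := eqVneq i j.
  by rewrite weylv_wword // divff // expf_neq0 // invr_neq0 // q0.
rewrite (_ : weylv _ _ _ _ _ = 0) ?mul0r //; apply/eqP; apply: contraT.
by move/weylv_supp => [_]; rewrite n1_wword => /addnI e; case/eqP: ij.
Qed.

Lemma wcoefZ j a x : wcoef j (a *: x) = a * wcoef j x.
Proof. by rewrite /wcoef !mxE mulrA. Qed.

Lemma proj_Sp n j (X : 'M[k]_N) x : (j <= d)%N -> (j < n)%N ->
  (forall i, (i < n)%N -> X *m yv i = (i == j)%:R *: yv i) -> Sp n x ->
  X *m x = wcoef j x *: yv j.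
Proof.
move=> jd jn hX [c ->].
have -> : wcoef j (\sum_(i < n) c i *: yv i) = c j.
  rewrite (_ : wcoef j _ = \sum_(i < n) c i * wcoef j (yv i)).
    rewrite (bigD1 (Ordinal jn)) //= wcoef_yv // eqxx mulr1 big1 ?addr0 // => i ij.
    rewrite wcoef_yv // (_ : (_ == _) = false) ?mulr0 //.
    by apply: contraNF ij => /eqP e; apply/eqP/val_inj.
  rewrite /wcoef summxE mulr_suml; apply: eq_bigr => i _.
  by rewrite !mxE mulrA.
rewrite mulmx_sumr (bigD1 (Ordinal jn)) //= -scalemxAr hX // eqxx scale1r.
rewrite big1 ?addr0 // => i ij; rewrite -scalemxAr hX //.
rewrite (_ : (_ == _) = false) ?scale0r ?scaler0 //.
by apply: contraNF ij => /eqP e; apply/eqP/val_inj.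
Qed.

End WeylVectors.

(** * Simple modules attached to the vectors y_b *)

Section HighestWeightModule.
Variables (k : fieldType) (eps : k).
Hypothesis eps0 : eps != 0.
Variables (r s d : nat).
Hypothesis hr : (s + s + d)%N = r.
Local Notation N := #|{: r.-tuple 'I_2}|.
Variables (A : algebraType k) (io : A -> 'M[k]_N).
Hypotheses (io_inj : injective io) (ioB : zmod_morphism io)
  (ioM : forall a b, io (a * b) = io a *m io b) (io1 : io 1 = 1%:M)
  (ioS : forall c, io c%:S = c%:M).
Local Notation y := (yv eps r s d).
Local Notation cf := (@wcoef _ eps r s d).

Definition psi b (a : A) : k := cf b (io a *m y b).

Lemma psiB b : zmod_morphism (psi b).
Proof.
move=> a c; rewrite /psi ioB mulmxBl -[X in _ - X]scale1r -scaleNr addrC wcoef_lin.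
by rewrite mulN1r addrC.
Qed.

Definition hwmod b : lmodType A := coef_module (psiB b).
Definition hwvec b : hwmod b := cvec (psi b) 1.

Lemma hwmod_generated b : generates (hwvec b).
Proof.
elim/cvec_ind => a; exists a.
by rewrite [RHS]scale_cvec mulr1.
Qed.

Lemma hwmod_fin_dim b : fin_dim (hwmod b).
Proof. exact: generated_fin_dim io_inj ioB ioM ioS _ _ (@hwmod_generated b). Qed.

Lemma psiS b c a : psi b (c%:S * a) = c * psi b a.
Proof. by rewrite /psi ioM ioS mul_scalar_mx -scalemxAl wcoefZ. Qed.

Lemma hwvec_eig b a c : io a *m y b = c *: y b -> a *: hwvec b = c%:S *: hwvec b.
Proof.
move=> h; apply/cmod_inj/funext => x /=; rewrite !mulr1 /psi !ioM -!mulmxA h ioS.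
by rewrite mul_scalar_mx.
Qed.

Section Simple.
Variables (n b : nat).
Hypotheses (bd : (b <= d)%N) (bn : (b < n)%N).
Hypothesis stab : forall a x, Sp eps s d n x -> Sp eps s d n (io a *m x).
Variable pi : A.
Hypothesis hpi : forall i, (i < n)%N -> io pi *m y i = (i == b)%:R *: y i.

Lemma psi1 : psi b 1 = 1.
Proof. by rewrite /psi io1 mul1mx wcoef_yv // eqxx. Qed.

Lemma pi_act a : io pi *m (io a *m y b) = psi b a *: y b.
Proof. by rewrite (proj_Sp eps0 hr bd bn hpi) //; apply/stab/Sp_yv. Qed.

Lemma psi_pi a c : psi b (a * pi * c) = psi b a * psi b c.
Proof. by rewrite {1}/psi !ioM -!mulmxA pi_act -scalemxAr wcoefZ mulrC. Qed.

Lemma hwvec_neq0 : hwvec b != 0.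
Proof.
apply: contra_eq_neq psi1 => h; have := congr1 (fun g : hwmod b => cmod_val g 1) h.
rewrite (cmod_val0 (psiB b)) /= mulr1 => ->.
by rewrite eq_sym oner_eq0.
Qed.

Lemma hwmod_simple : simple_module (hwmod b).
Proof.
split; first exact: hwmod_fin_dim; first by exists (hwvec b); exact: hwvec_neq0.
exact: (cmod_simple (psiS b) psi_pi).
Qed.

Lemma central_hwvec e : central_idempotent e -> psi b e = 1 -> io e *m y b = y b.
Proof.
move=> [ee eC] e1; have := pi_act e; rewrite e1 scale1r mulmxA -ioM -(eC pi) ioM.
by rewrite -mulmxA hpi // eqxx scale1r.
Qed.

End Simple.

Lemma hwmod_same_block n b b' pi pi' g c : (b <= d)%N -> (b < n)%N ->
  (b' <= d)%N -> (b' < n)%N ->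
  (forall a x, Sp eps s d n x -> Sp eps s d n (io a *m x)) ->
  (forall i, (i < n)%N -> io pi *m y i = (i == b)%:R *: y i) ->
  (forall i, (i < n)%N -> io pi' *m y i = (i == b')%:R *: y i) ->
  c != 0 -> io g *m y b = c *: y b' -> same_block (hwmod b) (hwmod b').
Proof.
move=> bd bn b'd b'n stab hpi hpi' c0 hg.
have [e [eB e1]] := block_exists (psiB b) (psi1 bd)
  (psi_pi bd bn stab hpi) io_inj ioM.
have [eC _ _] := eB.
exists e; split=> // x.
  exact: (central_act (psiB b) (psi1 bd) (psi_pi bd bn stab hpi)).
apply: (central_act (psiB b') (psi1 b'd) (psi_pi b'd b'n stab hpi')) => //.
have ey : io e *m y b' = y b'.
  apply: (scalerI c0); rewrite scalemxAr -hg mulmxA -ioM eC.2 ioM -mulmxA.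
  by rewrite (central_hwvec bd bn stab hpi eC e1).
by rewrite /psi ey wcoef_yv // eqxx.
Qed.

End HighestWeightModule.

Lemma addV_eq (k : fieldType) (x y : k) : x != 0 -> y != 0 ->
  x + x^-1 = y + y^-1 -> x = y \/ x * y = 1.
Proof.
move=> x0 y0 h; have : (x - y) * (x * y - 1) = 0.
  rewrite (_ : _ * _ = (x + x^-1 - (y + y^-1)) * (x * y)); last by field; rewrite x0 y0.
  by rewrite h subrr mul0r.
move/eqP; rewrite mulf_eq0 !subr_eq0 => /orP[/eqP|/eqP]; [by left|by right].
Qed.

(** * Linkage *)

Section CasimirLinkage.
Variables (k : fieldType) (l : nat) (eps : k).
Hypothesis heps : l.-primitive_root eps.
Hypothesis eps0 : eps != 0.
Variables (r : nat) (A : algebraType k) (j : A -> Ukr eps r).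
Hypotheses (j_inj : injective j) (jH : is_alghom j).
Local Notation N := #|{: r.-tuple 'I_2}|.

Definition io_of (a : A) : 'M[k]_N := val (j a).

Lemma io_of_inj : injective io_of.
Proof. by move=> a b /val_inj /j_inj. Qed.

Lemma io_ofB : zmod_morphism io_of.
Proof. by move=> a b; rewrite /io_of (alghomB jH) rmorphB. Qed.

Lemma io_ofM a b : io_of (a * b) = io_of a *m io_of b.
Proof. by rewrite /io_of (alghomM jH) val_mul. Qed.

Lemma io_of1 : io_of 1 = 1%:M.
Proof. by rewrite /io_of (alghom1 jH) -(rmorph1 (@cst k (Ukr eps r))) val_cst. Qed.

Lemma io_ofS c : io_of c%:S = c%:M.
Proof. by rewrite /io_of (alghomS jH) val_cst. Qed.

Variables (e f : A) (kk : 'I_2 -> A).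
Hypotheses (je : j e = qE eps0 r 1) (jf : j f = qF eps0 r 1)
  (jkk : forall i, j (kk i) = qD eps0 r (wKi eps i 1)).

Lemma qD_exp w n : qD eps0 r w ^+ n = qD eps0 r (fun a b => w a b ^+ n).
Proof.
elim: n => [|n IHn]; last first.
  by rewrite [LHS]exprS IHn qD_mul; apply: qD_ext => a b _; rewrite [RHS]exprS.
by rewrite [LHS]expr0 -[LHS](qD1 eps0 r); apply: qD_ext => a b _; rewrite expr0.
Qed.

Lemma wKi_mulV i : qD eps0 r (wKi eps i 1) * qD eps0 r (wKi eps i (-1)) = 1.
Proof.
rewrite qD_mul -(qD1 eps0 r); apply: qD_ext => a b _.
rewrite /wKi /wK -expfzDr //; case: (i == 0);
  by rewrite ?mulr0 ?mulr1 ?mulrN1 ?add0r ?addr0 subrr.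
Qed.

Lemma jkkV i : j (kk i ^+ l.-1) = qD eps0 r (wKi eps i (-1)).
Proof.
have l0 := prim_order_gt0 heps.
rewrite (alghomX jH) jkk -[LHS]mulr1 -(wKi_mulV i) mulrA -exprSr prednK // qD_exp.
rewrite (_ : qD _ _ _ = 1) ?mul1r // -(qD1 eps0 r); apply: qD_ext => a b _.
by rewrite /wKi /wK exprnP exprzAC -exprnP (prim_expr_order heps) exp1rz.
Qed.

(* The Casimir element, with k_j^-1 written k_j^(l-1). *)
Definition casA : A := casimir eps e f (kk 0 * kk 1 ^+ l.-1) (kk 1 * kk 0 ^+ l.-1).

Lemma j_casA : j casA = cask eps0 r.
Proof.
rewrite /casA /casimir !(alghomD jH) !(alghomM jH) !(alghomS jH) !jkkV !jkk je jf.
by [].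
Qed.

Lemma casA_central x : casA * x = x * casA.
Proof. by apply: j_inj; rewrite !(alghomM jH) j_casA caskC. Qed.

Section Weight.
Variables (V : lmodType A) (w : V) (a : 'I_2 -> nat).
Hypotheses (gw : generates w) (ew : e *: w = 0)
  (kw : forall i, kk i *: w = (eps ^+ a i)%:S *: w).

Lemma kkX_weight i n : kk i ^+ n *: w = (eps ^+ (a i * n))%:S *: w.
Proof.
elim: n => [|n IHn]; first by rewrite muln0 !expr0 rmorph1 !scale1r.
rewrite exprSr -scalerA kw scalerA -cst_central -scalerA IHn scalerA -rmorphM -exprD.
by rewrite mulnS.
Qed.

Definition casval (a0 a1 : nat) : k := eps ^+ a0.+1 / eps ^+ a1 + (eps ^+ a0.+1 / eps ^+ a1)^-1.

Lemma prim_expV m : eps ^+ (m * l.-1) = (eps ^+ m)^-1.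
Proof.
have l0 := prim_order_gt0 heps.
have em : eps ^+ m != 0 by rewrite expf_neq0.
apply: (mulfI em); rewrite mulfV // -exprD -mulnS prednK // mulnC exprM.
by rewrite (prim_expr_order heps) expr1n.
Qed.

Lemma casA_weight (x : V) : casA *: x = (casval (a 0) (a 1))%:S *: x.
Proof.
have E : casA *: w = (casval (a 0) (a 1))%:S *: w; last first.
  have [b ->] := gw x.
  by rewrite scalerA casA_central -scalerA E [LHS]scalerA -cst_central -scalerA.
rewrite /casA /casimir !scalerDl -!scalerA ew !scaler0 add0r !kkX_weight !prim_expV.
rewrite (scalerA (kk 0)) -(cst_central _ (kk 0)) -(scalerA _ (kk 0)) kw.
rewrite (scalerA (kk 1)) -(cst_central _ (kk 1)) -(scalerA _ (kk 1)) kw.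
rewrite !scalerA -!rmorphM -scalerDl -rmorphD; apply: (congr1 (fun c : k => c%:S *: w)).
rewrite /casval exprS invfM invfM invrK; ring.
Qed.

End Weight.

(** With x and y the values of eps^(la_1 - la_2 + 1) at the two weights, the alternatives are x = y
    and x y = 1, written as congruences of exponents from which subtractions have been cleared. *)
Lemma casimir_linkage (V W : lmodType A) (v : V) (w : W) (a b : 'I_2 -> nat) :
  simple_module V -> simple_module W -> generates v -> generates w ->
  e *: v = 0 -> e *: w = 0 ->
  (forall i, kk i *: v = (eps ^+ a i)%:S *: v) ->
  (forall i, kk i *: w = (eps ^+ b i)%:S *: w) ->
  same_block V W ->
  ((a 0%R).+1 + b 1%R == (b 0%R).+1 + a 1%R %[mod l])%N \/
  ((a 0%R).+1 + (b 0%R).+1 == a 1%R + b 1%R %[mod l])%N.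
Proof.
move=> [_ V0 _] [_ W0 _] gv gw ev ew kv kw VW.
have en m : eps ^+ m != 0 by rewrite expf_neq0.
have h : casval (a 0) (a 1) = casval (b 0) (b 1).
  apply: (same_block_eigen io_of_inj io_ofB io_ofM io_of1 io_ofS casA_central V0 W0 _ _ VW).
    exact: casA_weight.
  exact: casA_weight.
have [||h'|h'] := addV_eq _ _ h; rewrite ?mulf_neq0 ?invr_neq0 //; [left|right].
  rewrite -(eq_prim_root_expr heps) !exprD; apply/eqP.
  have : eps ^+ (a 0).+1 / eps ^+ a 1 * (eps ^+ a 1 * eps ^+ b 1) =
         eps ^+ (b 0).+1 / eps ^+ b 1 * (eps ^+ a 1 * eps ^+ b 1) by rewrite h'.
  by rewrite mulrA mulfVK // => ->; rewrite mulrCA mulfVK // mulrC.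
rewrite -(eq_prim_root_expr heps) !exprD; apply/eqP.
have : eps ^+ (a 0).+1 / eps ^+ a 1 * (eps ^+ (b 0).+1 / eps ^+ b 1)
    * (eps ^+ a 1 * eps ^+ b 1) = eps ^+ a 1 * eps ^+ b 1 by rewrite h' mul1r.
by rewrite (mulrACA (eps ^+ (a 0).+1)) -invfM mulfVK ?mulf_neq0.
Qed.

End CasimirLinkage.

Lemma geom_sum (R : comNzRingType) (t : R) u :
  (t - 1) * \sum_(i < u) t ^+ i = t ^+ u - 1.
Proof. by rewrite subrX1. Qed.

Section RootsOfUnity.
Variables (k : fieldType) (l : nat) (t : k).
Hypotheses (l1 : (1 < l)%N) (ht : l.-primitive_root t).

Lemma prim_geom_neq0 u : (0 < u < l)%N -> \sum_(i < u) t ^+ i != 0.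
Proof.
move=> /andP[u0 ul]; apply: contraTneq u0 => h; have := geom_sum t u.
rewrite h mulr0 => /esym/eqP; rewrite subr_eq0 -(prim_order_dvd ht).
by case: u ul {h} => // u ul; rewrite gtnNdvd.
Qed.

Lemma prim_geom_eq0 u : (l %| u)%N -> \sum_(i < u) t ^+ i = 0.
Proof.
move=> lu; have := geom_sum t u; move: lu; rewrite (prim_order_dvd ht) => /eqP ->.
rewrite subrr => /eqP; rewrite mulf_eq0 subr_eq0 => /orP[|/eqP //].
by rewrite -[t == 1](prim_order_dvd ht 1) dvdn1; move: l1; case: eqP => // ->.
Qed.
End RootsOfUnity.

Section RootsSquare.
Variables (k : fieldType) (l : nat) (eps : k).
Hypotheses (hodd : odd l) (heps : l.-primitive_root eps).

Lemma prim_q : l.-primitive_root (eps ^+ 2).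
Proof. by rewrite (prim_root_exp_coprime _ heps) coprime2n. Qed.

Lemma prim_eps_neq0 : eps != 0.
Proof.
apply: contraTneq heps => ->; apply/negP => h.
have := prim_expr_order h; have := prim_order_gt0 h; rewrite expr0n => /lt0n_neq0/negPf ->.
by move/esym/eqP; rewrite oner_eq0.
Qed.

Lemma prim_qV : l.-primitive_root (eps ^+ 2)^-1.
Proof.
rewrite -(prim_expV heps prim_eps_neq0) (prim_root_exp_coprime _ heps).
by rewrite coprimeMl coprime2n hodd coprimePn ?(prim_order_gt0 heps).
Qed.

End RootsSquare.

(** * Action of the generators on the string *)

Section Generators.
Variables (k : fieldType) (l : nat) (eps : k).
Hypotheses (hl : (1 < l)%N) (hodd : odd l) (heps : l.-primitive_root eps).
Hypothesis eps0 : eps != 0.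
Variables (r : nat) (A : algebraType k) (j : A -> Ukr eps r).
Hypotheses (j_inj : injective j) (jH : is_alghom j).
Variables (e f : A) (kk : 'I_2 -> A).
Hypotheses (je : j e = qE eps0 r 1) (jf : j f = qF eps0 r 1)
  (jkk : forall i, j (kk i) = qD eps0 r (wKi eps i 1)).
Local Notation io := (io_of j).
Variables (s d : nat).
Hypothesis hr : (s + s + d)%N = r.
Local Notation y := (yv eps r s d).

Lemma io_dop a w i : j a = qD eps0 r w ->
  io a *m y i = w (s + (d - i))%N (s + i)%N *: y i.
Proof. by move=> ja; rewrite /io_of ja; exact: dop_yv. Qed.

Lemma io_kk c i : io (kk c) *m y i = eps ^+ (nsel c (s + (d - i)) (s + i)) *: y i.
Proof.
rewrite (io_dop _ (jkk c)) /wKi /wK /nsel; case: (c == 0);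
  by rewrite mulr1 mulr0 ?addr0 ?add0r.
Qed.

Lemma io_fX b : (b < l)%N -> exists2 c : k, c != 0 & io (f ^+ b) *m y 0 = c *: y b.
Proof.
elim: b => [|b IHb] bl.
  by exists 1; rewrite ?oner_neq0 // expr0 io_of1 // mul1mx scale1r.
have [c c0 hc] := IHb (ltnW bl).
have [c' [hc' c'0]] := Fop_yv eps0 r s d 1 b.
exists (c * c').
  rewrite mulf_neq0 // c'0 gbin1 (prim_geom_neq0 (prim_qV hodd heps)) //.
rewrite exprS io_ofM // -mulmxA hc -scalemxAr -[RHS]scalerA; congr (_ *: _).
by rewrite /io_of jf; exact: hc'.
Qed.

Lemma stab_e n i : (i < n)%N -> Sp eps s d n (io e *m y i).
Proof.
move=> lt; have [c hc] := Eop_yv eps0 r s d 1 i.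
rewrite /io_of je [X in Sp _ _ _ _ X]hc; apply/SpZ/Sp_yv; exact: leq_ltn_trans (leq_subr _ _) lt.
Qed.

Lemma stab_f i : (i < l)%N -> Sp eps s d l (io f *m y i).
Proof.
move=> lt; have [c [hc c0]] := Fop_yv eps0 r s d 1 i.
rewrite /io_of jf [X in Sp _ _ _ _ X]hc; case: (ltnP (1 + i) l) => il.
  exact/SpZ/Sp_yv.
have -> : c = 0; last by rewrite scale0r; exact: Sp0.
apply/eqP; rewrite c0 gbin1 (prim_geom_eq0 hl (prim_qV hodd heps)) //.
by rewrite (_ : i.+1 = l) //; apply/eqP; rewrite eqn_leq lt.
Qed.

Lemma stab_dop a w n i : j a = qD eps0 r w -> (i < n)%N -> Sp eps s d n (io a *m y i).
Proof. by move=> ja lt; rewrite (io_dop _ ja); apply/SpZ/Sp_yv. Qed.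

Lemma io_prod (I : finType) (P : pred I) (F : I -> A) (c : I -> k) i :
  (forall x, io (F x) *m y i = c x *: y i) ->
  io (\prod_(x | P x) F x) *m y i = (\prod_(x | P x) c x) *: y i.
Proof.
move=> h; elim/big_rec2: _ => [|x a b _ hb]; first by rewrite io_of1 // mul1mx scale1r.
by rewrite io_ofM // -mulmxA hb -scalemxAr h scalerA mulrC.
Qed.

(** Lagrange interpolation: k_2 acts on y_x by [eps ^+ (s + x)], and for x < l these eigenvalues are
    distinct because [eps] has order l. *)
Definition lagr b : A := \prod_(x : 'I_l | x != b :> nat)
  (((eps ^+ (s + b) - eps ^+ (s + x))^-1)%:S * (kk 1 - (eps ^+ (s + x))%:S)).

Lemma lagrP b i : (b < l)%N -> (i < l)%N -> io (lagr b) *m y i = (i == b)%:R *: y i.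
Proof.
move=> bl il; have E (x : 'I_l) :
    io (((eps ^+ (s + b) - eps ^+ (s + x))^-1)%:S * (kk 1 - (eps ^+ (s + x))%:S)) *m y i =
    ((eps ^+ (s + b) - eps ^+ (s + x))^-1 * (eps ^+ (s + i) - eps ^+ (s + x))) *: y i.
  rewrite io_ofM // io_ofB // !io_ofS // mul_scalar_mx -scalemxAl mulmxBl io_kk.
  by rewrite mul_scalar_mx -scalerBl scalerA.
rewrite /lagr (io_prod _ E).
congr (_ *: _); have [->|ib] := eqVneq i b.
  rewrite big1 // => x xb; rewrite mulVf // subr_eq0 (eq_prim_root_expr heps) eqn_modDl.
  by rewrite !modn_small // eq_sym.
by rewrite (bigD1 (Ordinal il)) //= subrr mulr0 mul0r.
Qed.

End Generators.

Lemma galg_val_hom (R : comNzRingType) (A : algebraType R) I (gen : I -> A) :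
  is_alghom (@galg_val R A I gen).
Proof. by split=> [a b||]; [|split|]. Qed.

Lemma galg_val_inj (R : comNzRingType) (A : algebraType R) I (gen : I -> A) :
  injective (@galg_val R A I gen).
Proof. exact: val_inj. Qed.

Lemma galg_generated (R : comNzRingType) (A : algebraType R) I (gen : I -> A)
  (x : galg gen) : generated gen (galg_val x).
Proof. by case: x => x hx; move/asboolP: (hx). Qed.

Section SmallAlgebras.
Variables (k : fieldType) (l : nat) (eps : k).
Hypotheses (hl : (1 < l)%N) (hodd : odd l) (heps : l.-primitive_root eps).
Let eps0 : eps != 0 := prim_eps_neq0 heps.
Variable r : nat.

Lemma Eop_singular s d b m : (s + s + d)%N = r -> (b < l)%N ->
  b = 0%N \/ (l %| (d - b).+1)%N -> (0 < m)%N ->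
  mxop r (Eop eps m) *m yv eps r s d b = 0.
Proof.
move=> hr bl hb m0; case: hb => [->|lb]; first exact: Eop_yv0.
apply: (Eop_sing eps0 hr (l := l)) => //.
  by move=> u; apply: prim_geom_neq0; exact: prim_q.
by apply: (prim_geom_eq0 hl _ lb); exact: prim_qV.
Qed.

(* The weight of y_b. *)
Definition wt (s d b : nat) : 'rV[int]_2 := \row_i (nsel i (s + (d - b)) (s + b))%:Z.

Section Stable.
Variables (s d : nat).

Definition stableU n (X : Ukr eps r) :=
  forall x, Sp eps s d n x -> Sp eps s d n (val X *m x).

Lemma stable_cst n c : stableU n c%:S.
Proof. by move=> x hx; rewrite val_cst mul_scalar_mx; exact: SpZ. Qed.

Lemma stableB n X Y : stableU n X -> stableU n Y -> stableU n (X - Y).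
Proof.
move=> hX hY x hx; rewrite rmorphB mulmxBl addrC -scaleN1r.
by apply: Sp_lin; [exact: hY|exact: hX].
Qed.

Lemma stableM n X Y : stableU n X -> stableU n Y -> stableU n (X * Y).
Proof. by move=> hX hY x hx; rewrite val_mul -mulmxA; apply/hX/hY. Qed.

End Stable.

Lemma zeta_little_hom : is_alghom (@zeta_little k eps r).
Proof.
have H := zetak_hom eps0 r; split.
- by move=> a b; apply: val_inj; exact: (alghomB H).
- split; first by apply: val_inj; exact: (alghom1 H).
  by move=> a b; apply: val_inj; exact: (alghomM H).
- by move=> c; apply: val_inj; exact: (alghomS H).
Qed.

Lemma zeta_little_surj (b : ukr eps r) : exists a, b = zeta_little r a.
Proof.
have H := zetak_hom eps0 r.
suff h x : generated (fun a : uk eps => zetak r (val a)) x ->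
    exists a : uk eps, x = zetak r (val a).
  by have [a ha] := h _ (galg_generated b); exists a; apply: val_inj.
elim=> [a|c|x1 y1 _ [a ha] _ [a' ha']|x1 y1 _ [a ha] _ [a' ha']].
- by exists a.
- by exists c%:S; rewrite -(alghomS H).
- by exists (a - a'); rewrite /= (alghomB H) ha ha'.
- by exists (a * a'); rewrite /= (alghomM H) ha ha'.
Qed.

(* [v] generates a module in which every operator acts on [v] as it acts on the
   vector y_b of the tensor space, as long as this is by a scalar. *)
Definition eigen_like (A : algebraType k) (j : A -> Ukr eps r) s d b
    (V : lmodType A) (v : V) : Prop :=
  generates v /\ forall a c, io_of j a *m yv eps r s d b = c *: yv eps r s d b ->
    a *: v = c%:S *: v.

Definition linked_pair (A : algebraType k) (j : A -> Ukr eps r) s d b : Prop :=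
  exists (V W : lmodType A) (v : V) (w : W),
    [/\ simple_module V, simple_module W, same_block V W,
        eigen_like j s d 0 v & eigen_like j s d b w].

Section Link.
Variables (A : algebraType k) (j : A -> Ukr eps r).
Hypotheses (j_inj : injective j) (jH : is_alghom j).

Lemma linked_pairI n s d b pi pi' g c : (s + s + d)%N = r -> (0 < n)%N -> (b < n)%N ->
  (b <= d)%N -> (forall a, stableU s d n (j a)) ->
  (forall i, (i < n)%N -> io_of j pi *m yv eps r s d i = (i == 0%N)%:R *: yv eps r s d i) ->
  (forall i, (i < n)%N -> io_of j pi' *m yv eps r s d i = (i == b)%:R *: yv eps r s d i) ->
  c != 0 -> io_of j g *m yv eps r s d 0 = c *: yv eps r s d b -> linked_pair j s d b.
Proof.
move=> hr n0 bn bd st hpi hpi' c0 hg.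
have ioi := io_of_inj j_inj; have ioB := io_ofB jH; have ioM := io_ofM jH.
have io1 := io_of1 jH; have ioS := io_ofS jH.
exists (hwmod eps s d ioB 0), (hwmod eps s d ioB b).
exists (hwvec eps s d ioB 0), (hwvec eps s d ioB b); split.
- exact: (hwmod_simple eps0 hr ioi ioB ioM io1 ioS (leq0n d) n0 st hpi).
- exact: (hwmod_simple eps0 hr ioi ioB ioM io1 ioS bd bn st hpi').
- exact: (hwmod_same_block eps0 hr ioi ioB ioM io1 (leq0n d) n0 bd bn st hpi hpi' c0 hg).
- split; first exact: hwmod_generated.
  by move=> a c' h; exact: hwvec_eig.
- split; first exact: hwmod_generated.
  by move=> a c' h; exact: hwvec_eig.
Qed.

Variables (e f : A) (kk : 'I_2 -> A).
Hypotheses (je : j e = qE eps0 r 1) (jf : j f = qF eps0 r 1)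
  (jkk : forall i, j (kk i) = qD eps0 r (wKi eps i 1)).

Lemma small_linked_pair s d b : (s + s + d)%N = r -> (b < l)%N -> (b <= d)%N ->
  (forall a, stableU s d l (j a)) -> linked_pair j s d b.
Proof.
move=> hr bl bd st; have l0 := prim_order_gt0 heps.
have [c c0 hc] := io_fX hodd heps jH jf s d bl.
have E0 i := @lagrP _ _ _ heps _ _ _ _ jH _ jkk s d 0 i l0.
have Eb i := @lagrP _ _ _ heps _ _ _ _ jH _ jkk s d b i bl.
exact: (linked_pairI hr l0 bl bd st E0 Eb c0 hc).
Qed.

End Link.
End SmallAlgebras.

Section Instances.
Variables (k : fieldType) (l : nat) (eps : k).
Hypotheses (hl : (1 < l)%N) (hodd : odd l) (heps : l.-primitive_root eps).
Let eps0 : eps != 0 := prim_eps_neq0 heps.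
Variable r : nat.

Definition linked_weights (a b : 'I_2 -> nat) : Prop :=
  ((a 0%R).+1 + b 1%R == (b 0%R).+1 + a 1%R %[mod l])%N \/
  ((a 0%R).+1 + (b 0%R).+1 == a 1%R + b 1%R %[mod l])%N.

Section StableGenerators.
Variables (s d : nat).
Local Notation st := (@stableU k eps r s d l).

Lemma stable_E : st (zt eps r (Ugen gE)).
Proof.
rewrite (zt_E eps0) => x; apply: Sp_stable => i il.
exact: (@stab_e _ _ eps0 _ (Ukr eps r) id _ erefl).
Qed.

Lemma stable_F : st (zt eps r (Ugen gF)).
Proof.
rewrite (zt_F eps0) => x; apply: Sp_stable => i il.
exact: (@stab_f _ _ _ hl hodd heps eps0 _ (Ukr eps r) id _ erefl).
Qed.

Lemma stable_D w : st (qD eps0 r w).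
Proof.
move=> x; apply: Sp_stable => i il.
exact: (@stab_dop _ _ eps0 _ (Ukr eps r) id _ _ _ w _ _ erefl).
Qed.

Lemma stable_gen g : st (zt eps r (Ugen g)).
Proof.
case: g => [||i|i]; [exact: stable_E|exact: stable_F| |].
  by rewrite (zt_K eps0); exact: stable_D.
by rewrite (zt_Kinv eps0); exact: stable_D.
Qed.

Lemma stable_little (a : ukr eps r) : st (val a).
Proof.
have H := zetak_hom eps0 r.
have [[x gx] ->] := zeta_little_surj heps a; rewrite /= {a}.
have {gx} : generated (fun g : gl2_gen => tens1 eps (Ugen g)) x by apply/asboolP.
elim=> [g|c|x1 y1 _ h1 _ h2|x1 y1 _ h1 _ h2].
- exact: stable_gen.
- by rewrite (alghomS H); exact: stable_cst.
- by rewrite (alghomB H); exact: stableB.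
- by rewrite (alghomM H); exact: stableM.
Qed.

Lemma stable_inf (a : skr eps r) : st (val a).
Proof.
suff h x : generated (inf_genval eps r) x -> st x by apply/h/galg_generated.
elim=> [g|c|x1 y1 _ h1 _ h2|x1 y1 _ h1 _ h2].
- case: g => [||i|i t]; [exact: stable_E|exact: stable_F| |].
    exact: (stable_gen (gK i)).
  by rewrite [inf_genval _ _ _](zt_Kbin eps0 r i t); exact: stable_D.
- exact: stable_cst.
- exact: stableB.
- exact: stableM.
Qed.

End StableGenerators.

End Instances.

(** * Constructed links and Casimir constraints for the three algebras *)

Section LittleInf.
Variables (k : fieldType) (l : nat) (eps : k).
Hypotheses (hl : (1 < l)%N) (hodd : odd l) (heps : l.-primitive_root eps).
Let eps0 : eps != 0 := prim_eps_neq0 heps.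
Variable r : nat.

Lemma redl_nat (la : 'rV[int]_2) i : 0 <= la 0 i ->
  (redl l la 0 i : nat) = (absz (la 0%R i) %% l)%N.
Proof.
by rewrite mxE; case: (la 0 i) => // n _; rewrite -pmulrn val_Zp_nat.
Qed.

Lemma wt_nat s d b i : absz (wt s d b 0 i) = nsel i (s + (d - b)) (s + b).
Proof. by rewrite mxE. Qed.

Lemma eps_redl s d b i :
  eps ^+ (redl l (wt s d b) 0 i : nat) = eps ^+ nsel i (s + (d - b)) (s + b).
Proof. by rewrite redl_nat ?mxE // (prim_expr_mod heps). Qed.

Section Little.
Local Notation kk := (fun i : 'I_2 => zeta_little r (ukgen eps (gK i))).

Definition little_val : ukr eps r -> Ukr eps r := @galg_val _ _ _ _.

Lemma little_kk i : little_val (kk i) = qD eps0 r (wKi eps i 1).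
Proof. exact: zt_K. Qed.

Lemma little_E : little_val (zeta_little r (ukgen eps gE)) = qE eps0 r 1.
Proof. exact: zt_E. Qed.

Lemma little_F : little_val (zeta_little r (ukgen eps gF)) = qF eps0 r 1.
Proof. exact: zt_F. Qed.

Lemma little_val_inj : injective little_val. Proof. exact: galg_val_inj. Qed.

Lemma little_val_hom : is_alghom little_val. Proof. exact: galg_val_hom. Qed.

Lemma frakL_of_eigen s d b (V : lmodType (ukr eps r)) (v : V) : (s + s + d)%N = r ->
  (b < l)%N -> b = 0%N \/ (l %| (d - b).+1)%N -> simple_module V ->
  eigen_like little_val s d b v -> is_frakL (redl l (wt s d b)) V.
Proof.
move=> hr bl hb Vs [gv ev]; split=> //; exists v; split=> [x|a [a' [b' ->]]].
  by have [a ->] := gv x; have [c ->] := zeta_little_surj heps a; exists c.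
have H := zeta_little_hom heps r.
rewrite (alghomD H) (alghomM H) scalerDl -scalerA.
have -> : zeta_little r (ukgen eps gE) *: v = 0.
  rewrite -[RHS](scale0r v) -(rmorph0 (@cst k (ukr eps r))); apply: ev.
  rewrite scale0r /io_of little_E.
  exact: (@Eop_singular _ _ _ hl hodd heps _ _ _ _ 1).
rewrite scaler0 add0r (big_morph _ (alghomD H) (alghom0 H)) scaler_suml big1 // => i _.
rewrite (alghomM H) -scalerA (alghomB H) scalerBl (alghomS H) eps_redl.
rewrite (ev _ _ (io_kk (@little_kk) s d i b)).
by rewrite subrr scaler0.
Qed.

Lemma low_little s d b : (s + s + d)%N = r -> (b < l)%N -> (b <= d)%N ->
  b = 0%N \/ (l %| (d - b).+1)%N ->
  exists V W, [/\ is_frakL (eps := eps) (r := r) (redl l (wt s d 0)) V,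
    is_frakL (redl l (wt s d b)) W & same_block V W].
Proof.
move=> hr bl bd hb.
have [V [W [v [w [Vs Ws VW hv hw]]]]] : linked_pair little_val s d b.
  apply: (small_linked_pair hodd little_val_inj little_val_hom little_F little_kk) => //.
  by move=> a; exact: stable_little.
exists V, W; split=> //; last exact: frakL_of_eigen hw.
by apply: frakL_of_eigen hv => //; [exact: ltnW|left].
Qed.

Lemma up_little (nu mu : 'rV['Z_l]_2) V W : is_frakL (eps := eps) (r := r) nu V -> is_frakL mu W ->
  same_block V W -> linked_weights l (fun i => nu 0 i : nat) (fun i => mu 0 i : nat).
Proof.
have H := zeta_little_hom heps r.
have aux (nu' : 'rV['Z_l]_2) U : is_frakL (eps := eps) (r := r) nu' U -> exists u : U, [/\ generates u,
    zeta_little r (ukgen eps gE) *: u = 0 &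
    forall i, kk i *: u = (eps ^+ (nu' 0 i : nat))%:S *: u].
  move=> [_ [u [gu hu]]]; exists u; split.
  - by move=> x; have [a ->] := gu x; exists (zeta_little r a).
  - apply: hu; exists 1, (fun=> 0); rewrite mul1r big1 ?addr0 // => i _.
    by rewrite mul0r.
  - move=> i; apply/eqP; rewrite -subr_eq0 -scalerBl -(alghomS H) -(alghomB H).
    apply/eqP/hu; exists 0, (fun i' => (i' == i)%:R).
    rewrite mul0r add0r (bigD1 i) //= eqxx mul1r big1 ?addr0 // => i' /negPf ->.
    by rewrite mul0r.
move=> hV hW; have [v [gv ev kv]] := aux _ _ hV; have [w [gw ew kw]] := aux _ _ hW.
apply: (casimir_linkage heps little_val_inj little_val_hom little_E little_F little_kk hV.1 hW.1 gv gw ev ew kv kw).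
Qed.

End Little.
End LittleInf.

Section InfinitesimalAndFull.
Variables (k : fieldType) (l : nat) (eps : k).
Hypotheses (hl : (1 < l)%N) (hodd : odd l) (heps : l.-primitive_root eps).
Let eps0 : eps != 0 := prim_eps_neq0 heps.
Variable r : nat.

Lemma klambda_proj (la : 'rV[int]_2) : (absz (la 0%R 0%R) + absz (la 0%R 1%R))%N = r ->
  klambda_U eps r la = qD eps0 r (fun a _ => (a == absz (la 0%R 0%R))%:R).
Proof.
move=> h; have e1 : absz (la 0%R 1%R) = (r - absz (la 0%R 0%R))%N by rewrite -h addKn.
rewrite -qD_proj; last by rewrite -h leq_addr.
rewrite /klambda_U big_ord2 e1 (zt_mul eps0) //; exact: Zform_bin.
Qed.

Lemma qD_wK_proj i n0 n1 : (n0 + n1)%N = r ->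
  qD eps0 r (wKi eps i 1) * qD eps0 r (fun a _ => (a == n0)%:R) =
  (eps ^+ nsel i n0 n1)%:S * qD eps0 r (fun a _ => (a == n0)%:R).
Proof.
move=> h; rewrite qD_mul qD_scale; apply: qD_ext => a b ab.
have [e|_] := eqVneq a n0; last by rewrite !mulr0.
have -> : b = n1 by move: h ab; rewrite e; clear; lia.
rewrite e /wKi /wK /nsel; case: (i == 0); by rewrite mulr1 mulr0 ?addr0 ?add0r.
Qed.

Lemma klambda_fix_yv s d b : (s + s + d)%N = r ->
  \val (klambda_U eps r (wt s d b)) *m yv eps r s d b = yv eps r s d b.
Proof.
move=> hr.
have idh : is_alghom (@id (Ukr eps r)) by split=> //; split.
have E i : io_of (@id (Ukr eps r)) (zeta_bin eps r i (absz (wt s d b 0 i))) *m yv eps r s d b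
    = 1 *: yv eps r s d b.
  rewrite (@io_dop _ _ eps0 r (Ukr eps r) id s d _ _ b (zt_Kbin eps0 r i _)) wt_nat.
  by rewrite /nsel; case: (i == 0); rewrite qbinnn.
have := io_prod idh predT E; rewrite big1_eq scale1r.
by [].
Qed.

Lemma generates_neq0 (A : algebraType k) (V : lmodType A) (v : V) :
  simple_module V -> generates v -> v != 0.
Proof.
move=> [_ [x x0] _] gv; apply: contra_neq x0 => e; have [a ->] := gv x.
by rewrite e scaler0.
Qed.

Section Algebra.
Variables (A : algebraType k) (j : A -> Ukr eps r).
Hypotheses (j_inj : injective j) (jH : is_alghom j).
Variables (kk : 'I_2 -> A).
Hypothesis jkk : forall i, j (kk i) = qD eps0 r (wKi eps i 1).

(** The image of [kl] is the projection onto the weight space of [la], on which k_i is a scalar. So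
    a vector fixed by [kl] has the k_i-eigenvalues that the Casimir argument requires. *)
Lemma klambda_weight (la : 'rV[int]_2) kl (V : lmodType A) (w : V) i :
  (absz (la 0%R 0%R) + absz (la 0%R 1%R))%N = r -> j kl = klambda_U eps r la ->
  kl *: w = w -> kk i *: w = (eps ^+ absz (la 0%R i))%:S *: w.
Proof.
move=> h jkl kw; rewrite -{1}kw scalerA.
have -> : kk i * kl = (eps ^+ absz (la 0%R i))%:S * kl; last by rewrite -scalerA kw.
apply: j_inj; rewrite !(alghomM jH) (alghomS jH) jkl jkk klambda_proj //.
by rewrite (qD_wK_proj i h) /nsel; elim/ord2_ind: i.
Qed.

End Algebra.

Section Infinitesimal.

Definition inf_val : skr eps r -> Ukr eps r := @galg_val _ _ _ _.

Lemma inf_val_inj : injective inf_val. Proof. exact: galg_val_inj. Qed.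

Lemma inf_val_hom : is_alghom inf_val. Proof. exact: galg_val_hom. Qed.

Lemma inf_E : inf_val (skgen eps r iE) = qE eps0 r 1. Proof. exact: zt_E. Qed.

Lemma inf_F : inf_val (skgen eps r iF) = qF eps0 r 1. Proof. exact: zt_F. Qed.

Lemma inf_kk i : inf_val (skgen eps r (iK i)) = qD eps0 r (wKi eps i 1).
Proof. exact: zt_K. Qed.

Lemma inf_klambda la : inf_val (klambda_s eps r la) = klambda_U eps r la.
Proof. by rewrite /klambda_s /klambda_U !big_ord2 (alghomM inf_val_hom). Qed.

Lemma Lhat_of_eigen s d b (V : lmodType (skr eps r)) (v : V) : (s + s + d)%N = r ->
  (b < l)%N -> b = 0%N \/ (l %| (d - b).+1)%N -> simple_module V ->
  eigen_like inf_val s d b v -> is_Lhat (wt s d b) V.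
Proof.
move=> hr bl hb Vs [gv ev]; split=> //; exists v; split=> //.
- exact: generates_neq0 gv.
- rewrite -[RHS]scale1r -(rmorph1 (@cst k (skr eps r))); apply: ev.
  by rewrite scale1r /io_of inf_klambda; exact: klambda_fix_yv.
- rewrite -[RHS](scale0r v) -(rmorph0 (@cst k (skr eps r))); apply: ev.
  rewrite scale0r /io_of inf_E.
  exact: (@Eop_singular _ _ _ hl hodd heps _ _ _ _ 1).
Qed.

Lemma low_inf s d b : (s + s + d)%N = r -> (b < l)%N -> (b <= d)%N ->
  b = 0%N \/ (l %| (d - b).+1)%N ->
  exists V W, [/\ is_Lhat (eps := eps) (r := r) (wt s d 0) V,
    is_Lhat (wt s d b) W & same_block V W].
Proof.
move=> hr bl bd hb.
have [V [W [v [w [Vs Ws VW hv hw]]]]] : linked_pair inf_val s d b.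
  apply: (small_linked_pair hodd inf_val_inj inf_val_hom inf_F inf_kk) => //.
  by move=> a; exact: stable_inf.
exists V, W; split=> //; last exact: Lhat_of_eigen hw.
by apply: Lhat_of_eigen hv => //; [exact: ltnW|left].
Qed.

Lemma up_inf (la mu : 'rV[int]_2) V W :
  (absz (la 0%R 0%R) + absz (la 0%R 1%R))%N = r ->
  (absz (mu 0%R 0%R) + absz (mu 0%R 1%R))%N = r ->
  is_Lhat (eps := eps) (r := r) la V -> is_Lhat mu W -> same_block V W ->
  linked_weights l (fun i => absz (la 0%R i)) (fun i => absz (mu 0%R i)).
Proof.
move=> hla hmu [Vs [v [_ gv kv ev]]] [Ws [w [_ gw kw ew]]].
apply: (casimir_linkage heps inf_val_inj inf_val_hom inf_E inf_F inf_kk Vs Ws gv gw ev ew) => i.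
  exact: (klambda_weight inf_val_inj inf_val_hom inf_kk _ hla (inf_klambda la)).
exact: (klambda_weight inf_val_inj inf_val_hom inf_kk _ hmu (inf_klambda mu)).
Qed.

End Infinitesimal.

Section Full.

Lemma full_id_hom : is_alghom (@id (Ukr eps r)). Proof. by split=> //; split. Qed.

Lemma full_id_inj : injective (@id (Ukr eps r)). Proof. by []. Qed.

(** Here the whole string is taken: F^(l) y_0 is a nonzero multiple of y_l, so for d >= l the first
    l vectors no longer span a stable subspace. Stability is tested on the spanning products. *)
Lemma stable_full s d (X : Ukr eps r) : stableU s d d.+1 X.
Proof.
have id0 := full_id_hom.
case: X => X hX x; move: x; rewrite [\val _]/=; move: hX.
apply: (qschur_span eps0 (P := fun X => forall x, Sp eps s d d.+1 x -> Sp eps s d d.+1 (X *m x))).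
- move=> a Y Z hY hZ x hx; rewrite mulmxDl -scalemxAl.
  by apply: Sp_lin; [exact: hY|exact: hZ].
- by move=> x _; rewrite mul0mx; exact: Sp0.
move=> b c n x hx; rewrite mxop_Xop -!mulmxA.
have st i : Sp eps s d d.+1 (yv eps r s d i).
  case: (leqP i d) => id; first exact: Sp_yv.
  by rewrite yv_gt //; exact: Sp0.
apply: Sp_stable => [i _|]; last apply: Sp_stable => [i _|]; last apply: Sp_stable => // i _.
- by have [c' ->] := Eop_yv eps0 r s d b i; apply: SpZ.
- by have [c' [-> _]] := Fop_yv eps0 r s d c i; apply: SpZ.
- by rewrite dop_yv; apply: SpZ.
Qed.

Lemma L_of_eigen s d b (V : lmodType (Ukr eps r)) (v : V) : (s + s + d)%N = r ->
  (b < l)%N -> b = 0%N \/ (l %| (d - b).+1)%N -> simple_module V ->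
  eigen_like id s d b v -> is_L (wt s d b) V.
Proof.
move=> hr bl hb Vs [gv ev]; split=> //; exists v; split=> //.
- exact: generates_neq0 gv.
- rewrite -[RHS]scale1r -(rmorph1 (@cst k (Ukr eps r))); apply: ev.
  by rewrite scale1r; exact: klambda_fix_yv.
- move=> m m0; rewrite -[RHS](scale0r v) -(rmorph0 (@cst k (Ukr eps r))); apply: ev.
  rewrite scale0r /io_of [zeta_div _ _ _ _](zt_divE eps0).
  exact: (@Eop_singular _ _ _ hl hodd heps).
Qed.

Lemma low_full s d b : (s + s + d)%N = r -> (b < l)%N -> (b <= d)%N ->
  b = 0%N \/ (l %| (d - b).+1)%N ->
  exists V W, [/\ is_L (eps := eps) (r := r) (wt s d 0) V,
    is_L (wt s d b) W & same_block V W].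
Proof.
move=> hr bl bd hb.
(* The weights along the whole string are distinct integers, so here weight projections replace the
   interpolation in k_2, whose eigenvalues repeat modulo l. *)
pose pi c : Ukr eps r := qD eps0 r (fun a _ => (a == s + (d - c))%N%:R).
have hpi c i : (c <= d)%N -> (i < d.+1)%N ->
    io_of id (pi c) *m yv eps r s d i = (i == c)%:R *: yv eps r s d i.
  move=> cd il; rewrite (@io_dop _ _ eps0 r (Ukr eps r) id s d _ _ i erefl); congr (_%:R *: _).
  by rewrite eqn_add2l; apply/eqP/eqP; move: cd il; clear; lia.
(* The divided power F^(b) leads from y_0 to y_b in one step, with a coefficient governed by the
   binomial [gbin _ b 0], which is 1. *)
have [c [hc c0]] := Fop_yv eps0 r s d b 0.
have [V [W [v [w [Vs Ws VW hv hw]]]]] : linked_pair (@id (Ukr eps r)) s d b.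
  have hg : io_of (@id (Ukr eps r)) (qF eps0 r b) *m yv eps r s d 0 = c *: yv eps r s d b.
    by rewrite addn0 in hc; exact: hc.
  have c1 : c != 0 by rewrite c0 gbinm0 oner_neq0.
  have h0 i := hpi 0%N i (leq0n d); have h1 i := hpi b i bd.
  exact: (@linked_pairI _ _ _ heps _ _ _ full_id_inj full_id_hom d.+1 s d b _ _ _ c hr
    (ltn0Sn d) bd bd (@stable_full s d) h0 h1 c1 hg).
exists V, W; split=> //; last exact: L_of_eigen hw.
by apply: L_of_eigen hv => //; [exact: ltnW|left].
Qed.

Lemma up_full (la mu : 'rV[int]_2) V W :
  (absz (la 0%R 0%R) + absz (la 0%R 1%R))%N = r ->
  (absz (mu 0%R 0%R) + absz (mu 0%R 1%R))%N = r ->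
  is_L (eps := eps) (r := r) la V -> is_L mu W -> same_block V W ->
  linked_weights l (fun i => absz (la 0%R i)) (fun i => absz (mu 0%R i)).
Proof.
move=> hla hmu [Vs [v [_ gv kv ev]]] [Ws [w [_ gw kw ew]]].
have jE := erefl (qE eps0 r 1); have jF := erefl (qF eps0 r 1).
have jK i := erefl (qD eps0 r (wKi eps i 1)).
have aux (U : lmodType (Ukr eps r)) (u : U) : (forall m, (0 < m)%N -> zeta_div eps r gE m *: u = 0) ->
    qE eps0 r 1 *: u = 0.
  by move/(_ 1%N isT); rewrite [zeta_div _ _ _ _](zt_divE eps0).
apply: (casimir_linkage heps full_id_inj full_id_hom jE jF jK Vs Ws gv gw (aux _ _ ev) (aux _ _ ew)) => i.
  exact: (klambda_weight full_id_inj full_id_hom jK _ hla (erefl (klambda_U eps r la))).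
exact: (klambda_weight full_id_inj full_id_hom jK _ hmu (erefl (klambda_U eps r mu))).
Qed.

End Full.
End InfinitesimalAndFull.

(** * Weights modulo l *)

Section Weights.
Variables (l : nat).
Hypotheses (hl : (1 < l)%N).

Lemma intr_Zp_eq0 (z : int) : (z%:~R == 0 :> 'Z_l) = (l %| absz z)%N.
Proof.
have h n : (n%:R == 0 :> 'Z_l) = (l %| n)%N.
  by rewrite -val_eqE /= val_Zp_nat.
by case: z => n; rewrite ?NegzE ?rmorphN ?oppr_eq0 -?pmulrn h.
Qed.

Lemma intr_Zp_eqP (x y : int) : x%:~R = y%:~R :> 'Z_l <-> exists z, x = y + l%:Z * z.
Proof.
split=> [/eqP|[z ->]].
  rewrite -subr_eq0 -rmorphB intr_Zp_eq0 => h.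
  have /dvdzP[z e] : (l%:Z %| x - y)%Z by rewrite dvdzE.
  by exists z; rewrite mulrC -e addrC subrK.
by apply/eqP; rewrite -subr_eq0 -rmorphB addrAC subrr add0r intr_Zp_eq0 abszM dvdn_mulr.
Qed.

Lemma redl_eqP (x y : 'rV[int]_2) : redl l x = redl l y <->
  (exists z, x 0 0 = y 0 0 + l%:Z * z) /\ (exists z, x 0 1 = y 0 1 + l%:Z * z).
Proof.
rewrite -!intr_Zp_eqP; split=> [e|[e0 e1]].
  by split; [move/matrixP/(_ 0 0): e|move/matrixP/(_ 0 1): e]; rewrite !mxE.
by apply/matrixP => i; rewrite (ord1 i) => j; elim/ord2_ind: j; rewrite !mxE.
Qed.

Lemma rV2_eqP (x y : 'rV[int]_2) : x 0 0 = y 0 0 -> x 0 1 = y 0 1 -> x = y.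
Proof.
by move=> e0 e1; apply/matrixP => i; rewrite (ord1 i) => j; elim/ord2_ind: j.
Qed.

Lemma wt0 s d b : wt s d b 0 0 = (s + (d - b))%N%:Z.
Proof. by rewrite mxE. Qed.

Lemma wt1 s d b : wt s d b 0 1 = (s + b)%N%:Z.
Proof. by rewrite mxE. Qed.

Lemma dominant_wt r la : dominant r la ->
  exists s d, la = wt s d 0 /\ (s + s + d)%N = r.
Proof.
case=> h1 h2 h3; exists (absz (la 0 1)), (absz (la 0%R 0%R) - absz (la 0%R 1%R))%N; split.
  apply: rV2_eqP; rewrite ?wt0 ?wt1; move: (la 0 0) (la 0 1) h1 h2 {h3} => x y; clear; lia.
move: (la 0 0) (la 0 1) h1 h2 h3 => x y; clear; lia.
Qed.

Lemma wt_dominant s d b r : (s + s + d)%N = r -> (b + b <= d)%N -> dominant r (wt s d b).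
Proof. by move=> hr bd; split; rewrite ?wt0 ?wt1; move: hr bd; clear; lia. Qed.

Definition wt_of (x y : int) : 'rV[int]_2 := \row_i (if i == 0 then x else y).

Lemma wt_of0 x y : wt_of x y 0 0 = x. Proof. by rewrite mxE. Qed.
Lemma wt_of1 x y : wt_of x y 0 1 = y. Proof. by rewrite mxE. Qed.

Lemma dominant_X1r r : dominant r `<=` X1r l r.
Proof.
move=> _ /dominant_wt[s [d [-> hr]]]; split; last first.
  by rewrite wt0 wt1 -hr; clear; lia.
have l0 := ltnW hl.
(* The second entry s and the difference d are reduced modulo l separately; the first entry of the
   reduced weight may therefore exceed l - 1, which [X1] allows. *)
exists (wt_of ((s %% l)%N + (d %% l)%N)%:Z (s %% l)%N),
  (\row_i (if i == 0 then (s %/ l + d %/ l)%N else (s %/ l)%N)); split.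
  rewrite /X1 /= wt_of0 wt_of1; move: (ltn_pmod s l0) (ltn_pmod d l0); clear; lia.
have := divn_eq s l; have := divn_eq d l => ed es.
apply: rV2_eqP; rewrite ?wt0 ?wt1 !mxE /=.
  by rewrite subn0 [in LHS]es [in LHS]ed; clear; lia.
by rewrite [in LHS]es; clear; lia.
Qed.

Lemma redl_dominant r : redl l @` dominant r = redl l @` X1r l r.
Proof.
apply/seteqP; split=> nu [la hla <-].
  by exists la => //; exact: dominant_X1r.
case: hla => -[mu [n [[h1 h2] ->]]]; rewrite !mxE => hr.
(* The multiple of l in the second entry is moved to the first. Sum and residues are unchanged, and
   the weight becomes dominant. *)
exists (wt_of (mu 0 0 + l%:Z * (n 0%R 0%R + n 0%R 1%R)%N%:Z) (mu 0 1)).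
  rewrite /dominant /=; rewrite !wt_of0 !wt_of1.
  move: (mu 0 0) (mu 0 1) (n 0 0) (n 0 1) h1 h2 hr => x y a b h1 h2 hr.
  have la0 : 0 <= l%:Z * a by rewrite mulr_ge0.
  have lb0 : 0 <= l%:Z * b by rewrite mulr_ge0.
  rewrite PoszD mulrDr; split; move: la0 lb0 h1 h2 hr; clear; lia.
apply/redl_eqP; rewrite wt_of0 wt_of1 !mxE.
move: (mu 0 0) (mu 0 1) (n 0 0) (n 0 1) => x y a b.
by split; [exists b%:Z|exists (- b%:Z)]; rewrite ?PoszD ?mulrDr ?mulrN; clear; lia.
Qed.

Lemma X1r_ge0 r la : X1r l r la -> [/\ 0 <= la 0 0, 0 <= la 0 1 & la 0 0 + la 0 1 = r%:Z].
Proof.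
case=> -[mu [n [[h1 h2] ->]]] hr; split=> //; rewrite !mxE;
  apply: addr_ge0; rewrite ?mulr_ge0 //; move: (mu 0 0) (mu 0 1) h1 h2 => x y; clear; lia.
Qed.

Definition dot_refl (la : 'rV[int]_2) : 'rV[int]_2 := wt_of (la 0 1 - 1) (la 0 0 + 1).

Lemma dot_orbitP la mu : dot_orbit la mu <-> mu = la \/ mu = dot_refl la.
Proof.
split=> [[w ->]|[->|->]].
- have [w0|w0] : w 0 = 0 \/ w 0 = 1 by elim/ord2_ind: (w 0); [left|right].
    left; have w1 : w 1 = 1.
      have : w 1 != w 0 by rewrite (inj_eq perm_inj).
      by rewrite w0; elim/ord2_ind: (w 1).
    by apply: rV2_eqP; rewrite !mxE ?w0 ?w1 /=; ring.
  right; have w1 : w 1 = 0.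
    have : w 1 != w 0 by rewrite (inj_eq perm_inj).
    by rewrite w0; elim/ord2_ind: (w 1).
  by apply: rV2_eqP; rewrite !mxE ?w0 ?w1 /=; ring.
- by exists 1%g; apply: rV2_eqP; rewrite !mxE !perm1 /=; ring.
- exists (tperm 0 1); apply: rV2_eqP; rewrite !mxE ?tpermL ?tpermR /=; ring.
Qed.

End Weights.

Lemma eqmod_int l m n : (m == n %[mod l])%N -> exists z : int, m%:Z = n%:Z + l%:Z * z.
Proof.
move=> /eqP h; exists ((m %/ l)%N%:Z - (n %/ l)%N%:Z).
rewrite {1}(divn_eq m l) {1}(divn_eq n l) h !PoszD !PoszM; ring.
Qed.

Section BlockFormula.
Variables (l r : nat).
Hypotheses (hl : (1 < l)%N) (hodd : odd l).

(** Writing l = 2 c + 1 gives x = l x - c (2 x), and 2 x is a multiple of l. *)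
Lemma halve (x z : int) : x + x = l%:Z * z -> exists t, x = l%:Z * t.
Proof.
move=> h; exists (x - (l./2)%:Z * z).
have el : l%:Z = 1 + (l./2)%:Z + (l./2)%:Z.
  by have := odd_double_half l; rewrite hodd; move: (l./2) => c; clear; lia.
rewrite mulrBr mulrCA -h {1}el; ring.
Qed.

(** Both weights have sum r, so the congruence between their differences becomes one between twice
    their first entries, and l is odd. *)
Lemma linked_orbit la mu : dominant r la -> X1r l r mu ->
  linked_weights l (fun i => absz (la 0%R i)) (fun i => absz (mu 0%R i)) ->
  redl l mu = redl l la \/ redl l mu = redl l (dot_refl la).
Proof.
move=> /dominant_X1r - /(_ l hl) /X1r_ge0[a0 a1 ar] /X1r_ge0[b0 b1 br].
rewrite !(redl_eqP hl) /dot_refl wt_of0 wt_of1 /linked_weights.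
move: (la 0 0) (la 0 1) (mu 0 0) (mu 0 1) a0 a1 ar b0 b1 br => x y u v.
case: x => // x; case: y => // y; case: u => // u; case: v => // v _ _ ar _ _ br.
rewrite !absz_nat => -[] /eqmod_int[z hz]; [left|right].
  have [t ht] : exists t, u%:Z - x%:Z = l%:Z * t.
    apply: (halve (z := - z)); rewrite mulrN; move: ar br hz; move: (l%:Z * z) => w.
    by clear; lia.
  split; [exists t|exists (- t)]; rewrite ?mulrN -ht; move: ar br; clear; lia.
have [t ht] : exists t, u%:Z - (y%:Z - 1) = l%:Z * t.
  apply: (halve (z := z)); move: ar br hz; move: (l%:Z * z) => w.
  by clear; lia.
split; [exists t|exists (- t)]; rewrite ?mulrN -ht; move: ar br; clear; lia.
Qed.

(** The reflected weight itself is never dominant; what is sought is a dominant weight in its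
    residue class that one step along a string links to [la]. The weight [mu] only witnesses that
    the class meets the dominant weights. *)
Lemma wt_dot_refl_mem (B : 'rV[int]_2 -> 'rV[int]_2 -> Prop) :
  (forall x y, B x y -> B y x) ->
  (forall s d b, (s + s + d)%N = r -> (b < l)%N -> (b <= d)%N ->
    b = 0%N \/ (l %| (d - b).+1)%N -> B (wt s d 0) (wt s d b)) ->
  forall la mu, dominant r la -> dominant r mu -> redl l mu = redl l (dot_refl la) ->
  exists nu, [/\ dominant r nu, B la nu & redl l nu = redl l mu].
Proof.
move=> Bsym Blow _ _ /dominant_wt[s [d [-> hr]]] /dominant_wt[s1 [d1 [-> hr1]]] e.
rewrite e; move/(redl_eqP hl): e; rewrite /dot_refl !wt_of0 !wt_of1 !wt0 !wt1.
rewrite !subn0 !addn0 => -[[z0 h0] [z1 h1]].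
pose b := (d.+1 %% l)%N; pose a := (d.+1 %/ l)%N.
have l0 := ltnW hl; have bl : (b < l)%N by rewrite ltn_pmod.
have db : d.+1 = (a * l + b)%N := divn_eq _ _.
(* If l divides d + 1, the reflection is congruent to [la] itself. *)
have [b0|b0] := posnP b.
  exists (wt s d 0); split; first exact: wt_dominant.
    by apply: Blow => //; left.
  apply/(redl_eqP hl); rewrite /dot_refl !wt_of0 !wt_of1 !wt0 !wt1 !subn0 !addn0.
  have {}db : d.+1%:Z = l%:Z * a%:Z by rewrite db b0 addn0 PoszM mulrC.
  split; [exists a%:Z|exists (- a%:Z)]; rewrite ?mulrN -db; clear; lia.
(* If d + 1 < l, no step down the string of [la] is available, and [la] is reached from a higher
   weight instead. *)
have [a0|a0] := posnP a.
  have {}db : b = d.+1 by rewrite db a0.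
  have dl : (d.+1 < l)%N by rewrite -db.
  have z1p : (l.-1 <= s + d)%N.
    (* Equal sums give z0 = - z1, and dominance of [mu] then makes z1 negative. As the second entry
       s + d + 1 + l z1 of [mu] is nonnegative, s + d + 1 >= l. *)
    have z10 : z1 < 0.
      have : l%:Z * z1 < 0.
        have ez : z0 = - z1.
          have l0' : l%:Z != 0 by move: l0; clear; lia.
          apply: (mulfI l0'); move: h0 h1 hr hr1; rewrite mulrN.
          by move: (l%:Z * z0) (l%:Z * z1) => w0 w1; clear; lia.
        move: h0 h1; rewrite ez mulrN; move: (l%:Z * z1) => w; clear; lia.
      by rewrite pmulr_rlt0 //; move: l0; clear; lia.
    have : l%:Z * z1 <= - l%:Z.
      rewrite -mulrN1 ler_pM2l; last by move: l0; clear; lia.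
      by move: z10; clear; lia.
    by move: h1 l0; move: (l%:Z * z1) => w; clear; lia.
  (* The value of b' solves d' - b' + 1 = d + b' + 1 = l, the divisibility condition at the lower
     end of the string from (s' + d', s') to [la]; the bound on s + d yields b' <= s. *)
  pose b' := (l.-1 - d)%N; pose s' := (s - b')%N; pose d' := (d + b' + b')%N.
  have bs : (b' <= s)%N by rewrite /b'; move: z1p; clear; lia.
  have bl' : (b' < l)%N by rewrite /b'; move: l0; clear; lia.
  have ela : wt s d 0 = wt s' d' b'.
    by apply: rV2_eqP; rewrite ?wt0 ?wt1 /s' /d'; move: bs; clear; lia.
  have hr' : (s' + s' + d')%N = r by rewrite /s' /d' -hr; move: bs; clear; lia.
  exists (wt s' d' 0); split; first exact: wt_dominant.
    rewrite ela; apply/Bsym/Blow => //; first by rewrite /d'; clear; lia.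
    right; rewrite (_ : _.+1 = l) // /d' /b'; move: dl; clear; lia.
  apply/(redl_eqP hl); rewrite /dot_refl !wt_of0 !wt_of1 !wt0 !wt1 !subn0 !addn0.
  have eb : b'%:Z + d%:Z + 1 = l%:Z by rewrite /b'; move: dl; clear; lia.
  have es : s'%:Z = s%:Z - b'%:Z by rewrite /s'; move: bs; clear; lia.
  have ed : d'%:Z = d%:Z + b'%:Z + b'%:Z by rewrite /d'; clear; lia.
  split; [exists 1|exists (- 1)]; rewrite ?mulrN mulr1; move: eb es ed; clear; lia.
(* Now b < l <= a l, so 2 b < d + 1: the weight of y_b is dominant, and d - b + 1 = a l is divisible
   by l. *)
have bd : (b + b <= d)%N.
  have : (l <= a * l)%N by rewrite leq_pmull.
  by move: bl db; move: (a * l)%N => w; clear; lia.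
have dab : (d - b).+1 = (a * l)%N by move: bd db; clear; lia.
exists (wt s d b); split; first exact: wt_dominant.
  apply: Blow => //; first by move: bd; clear; lia.
  by right; rewrite dab dvdn_mull.
apply/(redl_eqP hl); rewrite /dot_refl !wt_of0 !wt_of1 !wt0 !wt1 ?subn0 ?addn0.
have {}db : l%:Z * a%:Z = (d - b).+1%:Z by rewrite dab PoszM mulrC.
split; [exists a%:Z|exists (- a%:Z)]; rewrite ?mulrN db; move: bd; clear; lia.
Qed.

(** The part common to the three algebras, with [D] the set of labels of simple modules: linked
    pairs along strings give one inclusion, and the Casimir constraint gives the other. *)
Lemma block_formula (D : set 'rV[int]_2) (B : 'rV[int]_2 -> 'rV[int]_2 -> Prop) la :
  dominant r `<=` D -> D `<=` X1r l r ->
  (forall x y, B x y -> B y x) ->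
  (forall s d b, (s + s + d)%N = r -> (b < l)%N -> (b <= d)%N ->
    b = 0%N \/ (l %| (d - b).+1)%N -> B (wt s d 0) (wt s d b)) ->
  (forall la mu, dominant r la -> X1r l r mu -> B la mu ->
    linked_weights l (fun i => absz (la 0%R i)) (fun i => absz (mu 0%R i))) ->
  dominant r la ->
  redl l @` [set mu | D mu /\ B la mu] = (redl l @` dot_orbit la) `&` (redl l @` dominant r).
Proof.
move=> sD Ds Bsym Blow Bup hla; apply/seteqP; split=> nu.
  case=> mu [/Ds hmu hB] <-; split; last by rewrite redl_dominant //; exists mu.
  case: (linked_orbit hla hmu (Bup _ _ hla hmu hB)) => ->.
    by exists la => //; apply/dot_orbitP; left.
  by exists (dot_refl la) => //; apply/dot_orbitP; right.
case=> -[mu /dot_orbitP hmu <-] [mu' hmu' e].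
case: hmu e => -> e.
  exists la => //; split; first exact: sD.
  by have [s [d [-> hr]]] := dominant_wt hla; apply: Blow => //; [exact: ltnW|left].
have [nu' [dnu Bnu enu]] := wt_dot_refl_mem Bsym Blow hla hmu' e.
by exists nu'; [split => //; exact: sD|rewrite enu].
Qed.

End BlockFormula.

Lemma same_block_sym (k : fieldType) (A : algebraType k) (V W : lmodType A) :
  same_block V W -> same_block W V.
Proof. by case=> e [eB eV eW]; exists e. Qed.

(** The simple modules of the little algebra are labelled by residues, so the Casimir argument sees
    only representatives below l; this carries its conclusion back to integral weights. *)
Lemma linked_weights_mod (l : nat) (a b a' b' : 'I_2 -> nat) :
  (forall i, a i = a' i %% l)%N -> (forall i, b i = b' i %% l)%N ->
  linked_weights l a b -> linked_weights l a' b'.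
Proof.
have aux c x y : (c + (x %% l + y %% l) = c + (x + y) %[mod l])%N.
  by rewrite -modnDmr modnDm modnDmr.
have aux1 x y : ((x %% l).+1 + y %% l = x.+1 + y %[mod l])%N by exact: (aux 1%N).
have aux2 x y : ((x %% l).+1 + (y %% l).+1 = x.+1 + y.+1 %[mod l])%N.
  by rewrite !addnS; exact: (aux 2%N).
move=> ha hb; rewrite /linked_weights (ha 0) (ha 1) (hb 0) (hb 1).
by rewrite !aux1 aux2 modnDm.
Qed.

Theorem proposition8p4 (k : closedFieldType) (p : nat) (hp : p \in [pchar k])
    (l : nat) (hl : (3 <= l)%N) (hodd : odd l)
    (eps : k) (heps : l.-primitive_root eps) (r : nat) :
  redl l @` dominant r = redl l @` X1r l r /\
  forall la : 'rV[int]_2, dominant r la ->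
    [/\ little_block eps r (redl l la) =
          (redl l @` dot_orbit la) `&` (redl l @` dominant r),
        little_block eps r (redl l la) = redl l @` schur_block eps r la &
        little_block eps r (redl l la) = redl l @` inf_block eps l r la].
Proof.
have l1 : (1 < l)%N := ltnW hl.
split=> [|la hla]; first exact: redl_dominant.
have abs_sum mu : X1r l r mu -> (absz (mu 0%R 0%R) + absz (mu 0%R 1%R))%N = r.
  case/X1r_ge0; case: (mu 0 0) => // x; case: (mu 0 1) => // y _ _.
  by rewrite -PoszD => -[].
have dX := @dominant_X1r l l1 r.
have little : little_block eps r (redl l la) =
    (redl l @` dot_orbit la) `&` (redl l @` dominant r).
  pose B x y := exists V W, [/\ is_frakL (eps := eps) (r := r) (redl l x) V,
    is_frakL (redl l y) W & same_block V W].
  rewrite -(@block_formula l r l1 hodd (X1r l r) B la dX (@subset_refl _ _)); last exact: hla.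
  - apply/seteqP; split=> [_ [[mu hmu <-] hB]|_ [mu [hmu hB] <-]].
      by exists mu.
    by split=> //; exists mu.
  - by move=> x y [V [W [hV hW h]]]; exists W, V; split=> //; exact: same_block_sym.
  - by move=> s d b; exact: low_little.
  - move=> x y /dX hx hy [V [W [hV hW h]]].
    apply: linked_weights_mod (up_little heps hV hW h) => i; apply: redl_nat => //.
      by have [h0 h1 _] := X1r_ge0 hx; elim/ord2_ind: i.
    by have [h0 h1 _] := X1r_ge0 hy; elim/ord2_ind: i.
have schur : redl l @` schur_block eps r la =
    (redl l @` dot_orbit la) `&` (redl l @` dominant r).
  pose B x y := exists V W, [/\ is_L (eps := eps) (r := r) x V,
    is_L y W & same_block V W].
  rewrite -(@block_formula l r l1 hodd (dominant r) B la (@subset_refl _ _) dX); last exact: hla.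
  - exact: erefl.
  - by move=> x y [V [W [hV hW h]]]; exists W, V; split=> //; exact: same_block_sym.
  - by move=> s d b; exact: low_full.
  - move=> x y /dX hx hy [V [W [hV hW h]]].
    exact: (up_full heps (abs_sum _ hx) (abs_sum _ hy) hV hW h).
have inf : redl l @` inf_block eps l r la =
    (redl l @` dot_orbit la) `&` (redl l @` dominant r).
  pose B x y := exists V W, [/\ is_Lhat (eps := eps) (r := r) x V,
    is_Lhat y W & same_block V W].
  rewrite -(@block_formula l r l1 hodd (X1r l r) B la dX (@subset_refl _ _)); last exact: hla.
  - exact: erefl.
  - by move=> x y [V [W [hV hW h]]]; exists W, V; split=> //; exact: same_block_sym.
  - by move=> s d b; exact: low_inf.
  - move=> x y /dX hx hy [V [W [hV hW h]]].
    exact: (up_inf heps (abs_sum _ hx) (abs_sum _ hy) hV hW h).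
by split; rewrite ?schur ?inf.
Qed.
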